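(* Let $\omega_0\in L^\infty(\mathbb{R}_+^2)$ be non-negative, with bounded support, and not identically zero, and let $\omega(t,\cdot)$ be the solution of the two-dimensional Euler equation in the half-plane $\mathbb{R}_+^2$ with initial vorticity $\omega_0$. Let $m,M,E,P_2(0)$ and $V_P$ be the quantities associated with $\omega_0$ as defined in the context. Suppose that $\omega_0$ admits a decomposition $\omega_0=\omega_{0,d}+\omega_{0,r}$, where $\omega_{0,d}$ and $\omega_{0,r}$ are non-negative and compactly supported in $\mathbb{R}_+^2$, and that $\omega_{0,d}$ satisfies the following sparse condition: for some constant $0\le C_0<V_P$, $m_d:=\|\omega_{0,d}\|_{L^1}>0$ and $$\|\omega_{0,d}\|_{L^\infty}\le\left(\frac{C_0}{2m}\right)^2\|\omega_{0,d}\|_{L^1}.$$ Then the diameter of $D(t):=\operatorname{supp}(\omega(t,\cdot))\cap\mathbb{R}_+^2$ grows at least linearly: $$\operatorname{diam}(D(t))\ge (V_P-C_0)\,t-O(1),$$ where $O(1)$ denotes a quantity whose absolute value is bounded by a constant depending solely on the initial profile $\omega_0$ (and not on $t\ge 0$).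
   Context: Write $\mathbb{R}_+^2=\{x=(x_1,x_2)\in\mathbb{R}^2: x_2>0\}$, $x^\perp=(-x_2,x_1)$, and $\bar y=(y_1,-y_2)$. The 2D Euler equation in the half-plane (equivalently, for vorticity on $\mathbb{R}^2$ odd in $x_2$) in vorticity form is $\partial_t\omega+v\cdot\nabla\omega=0$, $\omega|_{t=0}=\omega_0$, with velocity $$v(t,x)=\int_{\mathbb{R}_+^2}K(x,y)\,\omega(t,y)\,dy,\qquad K(x,y)=\frac1{2\pi}\left(\frac{(x-y)^\perp}{|x-y|^2}-\frac{(x-\bar y)^\perp}{|x-\bar y|^2}\right).$$ For $\omega_0\in L^1\cap L^\infty(\mathbb{R}_+^2)$, ''the solution'' is the unique global weak (Yudovich) solution; $\omega(t,\cdot)$ is transported by the area-preserving flow of $v$. For non-negative, not identically zero $\omega_0$ define $$m=\|\omega_0\|_{L^1(\mathbb{R}_+^2)},\quad M=\|\omega_0\|_{L^\infty(\mathbb{R}_+^2)},\quad P_2(0)=\frac1m\int_{\mathbb{R}_+^2}x_2\,\omega_0(x)\,dx,$$ $$E=\frac1{4\pi}\int_{\mathbb{R}_+^2}\int_{\mathbb{R}_+^2}\log\left(1+\frac{4x_2y_2}{|x-y|^2}\right)\omega_0(x)\,\omega_0(y)\,dx\,dy,$$ $$V_P=10^{-3}\,\frac{E^4}{P_2(0)^3\,m^2\,M}.$$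
   Formalization: In V_P the energy E is replaced by E/m, so V_P = 10^{-3} E^4/(P_2(0)^3 m^6 M); with the printed formula the claim is false, since under ω_0 → aω_0 the printed V_P scales like a^5 while Euler velocities scale like a. *)

(* Defs.v *)
From HB Require Import structures.
From mathcomp Require Import all_boot all_order all_algebra.
From mathcomp Require Import all_classical all_reals all_analysis.

Set Implicit Arguments.
Unset Strict Implicit.
Unset Printing Implicit Defensive.

Import Order.TTheory GRing.Theory Num.Theory.
Import numFieldNormedType.Exports.

Local Open Scope classical_set_scope.
Local Open Scope ring_scope.

(* The plane is the product [R * R]: its library topology and norm are those of
   the sup norm, but lengths below are Euclidean.  Functions on the half-plane
   are total functions [R * R -> R] whose values off [halfplane] never matter. *)

Definition halfplane (R : realType) : set (R * R) := [set x | 0 < x.2].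
Arguments halfplane : clear implicits.

Definition spacetime (R : realType) : set (R * (R * R)) :=
  [set p | 0 <= p.1 /\ halfplane R p.2].
Arguments spacetime : clear implicits.

Notation leb2 R := (@lebesgue_measure R \x @lebesgue_measure R)%E.

Section plane.
Context {R : realType}.
Implicit Types (x y z : R * R) (f : R * R -> R) (A : set (R * R)).

Definition sqnorm z : R := z.1 ^+ 2 + z.2 ^+ 2.
Definition dist x y : R := Num.sqrt (sqnorm (x - y)).
Definition perp z : R * R := (- z.2, z.1).
Definition reflect2 y : R * R := (y.1, - y.2).

(* [diam set0 = -oo]; the supports to which it is applied are never empty. *)
Definition diam A : \bar R :=
  ereal_sup [set (dist p.1 p.2)%:E | p in A `*` A].

Definition Linf_finite f : Prop :=
  ('N[leb2 R]_+oo [(EFin \o f) \_ (halfplane R)] < +oo)%E.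
Definition L1norm f : R := fine 'N[leb2 R]_1 [(EFin \o f) \_ (halfplane R)].
Definition Linfnorm f : R := fine 'N[leb2 R]_+oo [(EFin \o f) \_ (halfplane R)].

Definition ae_halfplane (P : R * R -> Prop) : Prop :=
  {ae leb2 R, forall x, halfplane R x -> P x}.

(* Essential support: the closure in the plane, so that it may touch the
   boundary line. *)
Definition supp f : set (R * R) :=
  [set x | forall U, nbhs x U -> ~ ae_halfplane (fun y => U y -> f y = 0)].

Definition compactly_supported f : Prop :=
  compact (supp f) /\ supp f `<=` halfplane R.

Definition BSkernel x y : R * R :=
  (2 * pi)^-1 *: ((sqnorm (x - y))^-1 *: perp (x - y)
                  - (sqnorm (x - reflect2 y))^-1 *: perp (x - reflect2 y)).

Definition velocity f x : R * R :=
  (\int[leb2 R]_(y in halfplane R) ((BSkernel x y).1 * f y),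
   \int[leb2 R]_(y in halfplane R) ((BSkernel x y).2 * f y)).

End plane.

Section euler.
Context {R : realType}.
Implicit Types (omega : R -> R * R -> R) (Phi : R -> R * R -> R * R).

Fixpoint class_C (V : normedModType R) (k : nat) (f : V -> R) : Prop :=
  if k is k'.+1 then
    (forall x, differentiable f x) /\ (forall v, class_C k' ('D_v f))
  else continuous f.

(* Restricted to t >= 0 and x_2 > 0, these are the test functions of class
   C_c^oo on the closed set [0, +oo) x {x_2 >= 0}. *)
Definition test_function (phi : R * (R * R) -> R) : Prop :=
  (forall k, class_C k phi) /\ bounded_set [set p | phi p != 0].

(* [v . grad phi] is the directional derivative of [phi] along [(0, v)]. *)
Definition weak_euler (omega0 : R * R -> R) omega : Prop :=
  forall phi, test_function phi ->
    \int[lebesgue_measure]_(t in `[0, +oo[)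
      (\int[leb2 R]_(x in halfplane R)
        (omega t x * ('D_(1, 0) phi (t, x)
                      + 'D_(0, velocity (omega t) x) phi (t, x))))
    + \int[leb2 R]_(x in halfplane R) (omega0 x * phi (0, x)) = 0.

(* The initial condition together with continuity up to t = 0 makes the ODE on
   t > 0 an initial value problem. *)
Definition is_flow (v : R -> R * R -> R * R) Phi : Prop :=
  [/\ forall t : R, 0 <= t -> set_bij (halfplane R) (halfplane R) (Phi t),
      {within spacetime R,
         continuous (fun p : R * (R * R) => Phi p.1 p.2)},
      forall x, halfplane R x -> Phi 0 x = x
    & forall (x : R * R) (t : R), halfplane R x -> 0 < t ->
        is_derive t 1 (fun s => Phi s x) (v t (Phi t x))].

Definition area_preserving Phi : Prop :=
  forall t : R, 0 <= t -> forall A, measurable A -> A `<=` halfplane R ->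
    leb2 R (halfplane R `&` Phi t @^-1` A) = leb2 R A.

(* Bounded in L^1 and L^oo, solving the vorticity equation in the sense of
   distributions, and transported by the area-preserving flow of its velocity.
   Such a solution is unique up to null sets at each time. *)
Definition yudovich_solution (omega0 : R * R -> R) omega : Prop :=
  [/\ measurable_fun (spacetime R)
        (fun p : R * (R * R) => omega p.1 p.2),
      exists B : R, forall t : R, 0 <= t ->
        ('N[leb2 R]_1 [(EFin \o omega t) \_ (halfplane R)] <= B%:E)%E /\
        ('N[leb2 R]_+oo [(EFin \o omega t) \_ (halfplane R)] <= B%:E)%E,
      weak_euler omega0 omega
    & exists Phi,
        [/\ is_flow (fun t => velocity (omega t)) Phi,
            area_preserving Phi
          & forall t : R, 0 <= t ->
              ae_halfplane (fun x => omega t (Phi t x) = omega0 x)]].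

Definition P2 (omega0 : R * R -> R) : R :=
  (L1norm omega0)^-1 *
  \int[leb2 R]_(x in halfplane R) (x.2 * omega0 x).

Definition energy (omega0 : R * R -> R) : R :=
  (4 * pi)^-1 *
  \int[leb2 R]_(x in halfplane R)
    (\int[leb2 R]_(y in halfplane R)
      (ln (1 + 4 * x.2 * y.2 / sqnorm (x - y)) * omega0 x * omega0 y)).

(* The energy enters per unit mass.  With [energy omega0 ^+ 4] in its place V_P
   would scale like [a ^+ 5] under [omega0 -> a omega0], whereas the Euler
   velocity scales like [a]. *)
Definition V_P (omega0 : R * R -> R) : R :=
  10 ^- 3 * ((energy omega0 / L1norm omega0) ^+ 4
    / (P2 omega0 ^+ 3 * L1norm omega0 ^+ 2 * Linfnorm omega0)).

End euler.

(* Main.v *)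
Require Import Defs.
From HB Require Import structures.
From mathcomp Require Import all_boot all_order all_algebra.
From mathcomp Require Import all_classical all_reals all_analysis.
From mathcomp Require Import ring lra measurable_realfun ess_sup_inf.

Set Implicit Arguments.
Unset Strict Implicit.
Unset Printing Implicit Defensive.

Import Order.TTheory GRing.Theory Num.Theory.
Import numFieldNormedType.Exports.

Local Open Scope classical_set_scope.
Local Open Scope ring_scope.

(* Labelling points by their initial position turns omega(t) into the push-forward
   of the fixed measure mu = omega0 dx under the flow, and this push-forward keeps a
   density at most M.  Symmetrizing the kernel, the mu-integral of the horizontal
   velocity is 1/(2 pi) times the mirror energy, the double integral of
   (z2 + y2) / |z - reflect2 y|^2, while the mean height is conserved.  The kinetic
   energy does not decrease (it is conserved, but one inequality suffices): its
   logarithmic kernel is regularized at scale e, and the antisymmetry of the kernel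
   makes the rate of change of the regularized energy vanish with e.  Interpolating
   the logarithm between the mirror energy, the mean height and a singularity that
   bounded density controls, the energy forces the center of mass of omega to move
   at speed at least V_P.  A near/far splitting at the optimal radius bounds by C0
   the speed of the center of mass of the sparse part.  So the two centers separate
   at rate V_P - C0, and some points of the support are at least that far apart. *)

(** The bound $1/|z|\le |z_1|^{-1/2}|z_2|^{-1/2}$ has a product on the right, so Tonelli reduces
    every singular planar integral to integrals on the line and polar coordinates are avoided. The
    interpolation is pointwise: the fourth power of the logarithm is at most (mirror interaction)
    times (sum of heights)$^2$ times (an integrable singular factor). Weighted AM-GM then plays the
    part of Hölder with exponents 1/4, 1/2, 1/4, its weights being optimized only after integration.
    With $J=\int x_2\omega_0=mP_2(0)$ this gives $L^4\lesssim(\text{mirror energy})\,(mJ)^2\,(MJ)$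
    for the double integral $L$ of the logarithm; division by the mass produces the powers of
    $P_2(0)$, $m$ and $M$ in [V_P]. The regularized energy is almost constant because its gradient
    at a point, once integrated over the other point, is close to $2\pi v^\perp$, hence almost
    orthogonal to the velocity $v$ of that point. *)

Lemma ge0_integral_measure_preserving {R : realType} d (T : measurableType d)
    (la : {measure set T -> \bar R}) (phi : T -> T) (f : T -> \bar R) :
  measurable_fun setT phi -> (forall A, measurable A -> la (phi @^-1` A) = la A) ->
  measurable_fun setT f -> (forall x, 0 <= f x)%E ->
  (\int[la]_x f (phi x) = \int[la]_x f x)%E.
Proof.
move=> mphi phiE mf f0.
have := @ge0_integral_pushforward _ _ _ _ R phi mphi la setT f measurableT mf
  (fun x _ => f0 x).
rewrite preimage_setT => <-.
by apply: eq_measure_integral => A mA _; exact: phiE.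
Qed.

(** * Translations and reflections of the line *)

Section lebesgue_affine.
Context {R : realType}.
Notation leb := (@lebesgue_measure R).
Local Open Scope ereal_scope.

(** The push-forward of Lebesgue measure agrees with it on half-open intervals, hence everywhere by
    uniqueness. *)
Lemma ge0_integral_lebesgue_invariant (phi : measurableTypeR R -> measurableTypeR R)
    (mphi : measurable_fun setT phi) (f : measurableTypeR R -> \bar R) :
  (forall a b : R, (a < b)%R -> leb (phi @^-1` `]a, b]) = (b - a)%:E) ->
  measurable_fun setT f -> (forall x, 0 <= f x) ->
  \int[leb]_x f (phi x) = \int[leb]_x f x.
Proof.
move=> phiE mf f0.
apply: ge0_integral_measure_preserving => // A mA; apply/esym.
pose phim : {mfun _ >-> _} := HB.pack phi (isMeasurableFun.Build _ _ _ _ _ mphi).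
apply: (@lebesgue_measure_unique _ (pushforward leb phim)) => // X /=.
rewrite ocitvP => -[->|[[a b] /= ab ->]]; first by rewrite !measure0.
rewrite /pushforward phiE//.
by rewrite lebesgue_measure_itv/= lte_fin ab -EFinB.
Qed.

Lemma ge0_integral_addr (f : R -> \bar R) (c : R) :
  measurable_fun setT f -> (forall x, 0 <= f x) ->
  \int[leb]_x f (x + c)%R = \int[leb]_x f x.
Proof.
move=> mf f0.
apply: (@ge0_integral_lebesgue_invariant (fun x => x + c)%R) => //.
  by apply: measurable_funD => //; exact: measurable_cst.
move=> a b ab.
have -> : ((fun x : R => x + c)%R @^-1` `]a, b])%classic =
    `](a - c)%R, (b - c)%R]%classic.
  by apply/seteqP; split=> x /=; rewrite !in_itv/= ltrBlDr lerBrDr.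
rewrite lebesgue_measure_itv/= lte_fin ltrD2r ab -!EFinB.
by congr EFin; ring.
Qed.

Lemma ge0_integral_opp (f : R -> \bar R) :
  measurable_fun setT f -> (forall x, 0 <= f x) ->
  \int[leb]_x f (- x)%R = \int[leb]_x f x.
Proof.
move=> mf f0.
apply: (@ge0_integral_lebesgue_invariant (@GRing.opp R)) => //.
move=> a b ab.
have -> : (@GRing.opp R @^-1` `]a, b])%classic = `[(- b)%R, (- a)%R[%classic.
  by apply/seteqP; split=> x /=; rewrite !in_itv/= lerNl ltrNr andbC.
rewrite lebesgue_measure_itv/= lte_fin ltrN2 ab -!EFinB.
by congr EFin; ring.
Qed.

End lebesgue_affine.

(** * One-dimensional integrals of the inverse square root *)

Section inverse_square_root.
Context {R : realType}.
Notation leb := (@lebesgue_measure R).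
Local Open Scope ereal_scope.

(* The value [+oo] at [0] makes [1 / |z| <= isqrt z.1 * isqrt z.2] hold
   everywhere, including on the axes. *)
Definition isqrt (u : R) : \bar R :=
  if u == 0%R then +oo else ((Num.sqrt `|u|)^-1)%:E.

Lemma isqrt_gt0 u : 0 < isqrt u.
Proof.
rewrite /isqrt; case: eqP => [//|/eqP u0].
by rewrite lte_fin invr_gt0 sqrtr_gt0 normr_gt0.
Qed.

Lemma isqrt_ge0 u : 0 <= isqrt u.
Proof. exact/ltW/isqrt_gt0. Qed.

Lemma isqrtN u : isqrt (- u)%R = isqrt u.
Proof. by rewrite /isqrt oppr_eq0 normrN. Qed.

Lemma measurable_invr : measurable_fun setT (@GRing.inv R).
Proof.
have -> : @GRing.inv R = (fun x => if x == 0 then 0 else x^-1)%R.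
  by apply/funext => x; case: eqP => // ->; rewrite invr0.
apply: measurable_fun_if => //.
- exact: measurable_fun_eqr.
- have -> : setT `&` [set x : R | (x == 0%R) = false] = ~` [set 0%R].
    by rewrite setTI; apply/seteqP; split => x /=; [move=> /negbT/eqP|move=> /eqP/negbTE].
  have o0 : open (~` [set (0:R)%R]) by by apply: closed_openC; apply: accessible_closed_set1; apply: hausdorff_accessible; exact: Rhausdorff.
  apply: open_continuous_measurable_fun => // x; rewrite inE/= => x0.
  by apply: inv_continuous; apply/eqP.
Qed.

Lemma measurable_sqrt : measurable_fun setT (@Num.sqrt R).
Proof. by apply: continuous_measurable_fun; exact: sqrt_continuous. Qed.

Lemma measurable_isqrt : measurable_fun setT isqrt.
Proof.
apply: measurable_fun_ifT => //.
- exact: measurable_fun_eqr.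
- apply/measurable_EFinP/(measurableT_comp measurable_invr).
  exact: (measurableT_comp measurable_sqrt).
Qed.

Lemma integral_isqrt_itv (a r : R) : (0 < a)%R -> (a < r)%R ->
  \int[leb]_(x in `[a, r]) isqrt x = (2 * Num.sqrt r - 2 * Num.sqrt a)%:E.
Proof.
move=> a0 ar.
have Fd (x : R) : (0 < x)%R ->
    is_derive x 1%R (fun x => 2 * Num.sqrt x)%R (Num.sqrt x)^-1%R.
  move=> x0; have d := is_derive1_sqrt x0.
  apply: is_derive_eq; rewrite /GRing.scale/= invfM mulrA divff ?mul1r//.
rewrite EFinB -(@continuous_FTC2 _ (fun x => (Num.sqrt x)^-1)%R
  (fun x => 2 * Num.sqrt x)%R)//.
- apply: eq_integral => x; rewrite inE/= in_itv/= => /andP[ax _].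
  have x0 := lt_le_trans a0 ax.
  by rewrite /isqrt gt_eqF// gtr0_norm.
- apply: continuous_in_subspaceT => x; rewrite inE/= in_itv/= => /andP[ax _].
  apply: continuousV; last exact: sqrt_continuous.
  by rewrite gt_eqF// sqrtr_gt0 (lt_le_trans a0).
- have c : continuous (fun x : R => 2 * Num.sqrt x)%R.
    by move=> x; apply: cvgM; [exact: cvg_cst|exact: sqrt_continuous].
  split.
  + move=> x; rewrite in_itv/= => /andP[ax _].
    by have [] := Fd x (lt_trans a0 ax).
  + exact/cvg_at_right_filter/c.
  + exact/cvg_at_left_filter/c.
- move=> x; rewrite in_itv/= => /andP[ax _]; rewrite derive1E.
  by have [_ ->] := Fd x (lt_trans a0 ax).
Qed.

Lemma integral_isqrt_near (r : R) : (0 < r)%R ->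
  \int[leb]_(x in `]0%R, r[) isqrt x <= (2 * Num.sqrt r)%:E.
Proof.
(* Dividing by [n.+2] and not [n.+1] keeps the left end strictly below [r] already for [n = 0], as
   [integral_isqrt_itv] requires. *)
move=> r0; pose F n := `[(r / n.+2%:R)%R, r]%classic.
have Fpos n : (0 < r / n.+2%:R)%R by rewrite divr_gt0.
have mi D : measurable_fun D isqrt by exact: measurable_funTS measurable_isqrt.
apply: (@le_trans _ _ (\int[leb]_(x in \bigcup_n F n) isqrt x)).
  apply: ge0_subset_integral => //.
  - by apply: bigcup_measurable => n _; exact: measurable_itv.
  - exact: mi.
  - by move=> x _; exact: isqrt_ge0.
  - move=> x /=; rewrite in_itv/= => /andP[x0 xr].
    exists (Num.bound (r / x)) => //; rewrite /F /= in_itv/= (ltW xr) andbT.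
    rewrite ler_pdivrMr// mulrC -ler_pdivrMr//.
    rewrite (le_trans (ltW (archi_boundP (ltW (divr_gt0 r0 x0)))))//.
    by rewrite ler_nat; do 2 apply: leqW.
have FE n : \int[leb]_(x in F n) isqrt x =
    (2 * Num.sqrt r - 2 * Num.sqrt (r / n.+2%:R))%:E.
  by rewrite integral_isqrt_itv// ltr_pdivrMr// ltr_pMr// ltr1n.
have Fnd : {homo F : n m / (n <= m)%N >-> (n <= m)%O}.
  move=> n m nm; apply/subsetPset/subset_itvr.
  by rewrite bnd_simp ler_pM2l// lef_pV2 ?posrE// ler_nat !ltnS.
have cv : (fun n => \int[leb]_(x in F n) isqrt x) @ \oo -->
    \int[leb]_(x in \bigcup_n F n) isqrt x.
  apply: ge0_nondecreasing_set_cvg_integral => //.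
  - by move=> n; exact: measurable_itv.
  - by move=> n; exact: mi.
  - by move=> n x _; exact: isqrt_ge0.
rewrite -(cvg_lim _ cv)//; apply: lime_le; first by apply/cvg_ex; eexists; exact: cv.
apply: nearW => n; rewrite FE lee_fin gerBl.
by rewrite mulr_ge0// sqrtr_ge0.
Qed.

Lemma ge0_integral_even (f : R -> \bar R) :
  measurable_fun setT f -> (forall x, 0 <= f x) -> (forall x, f (- x)%R = f x) ->
  \int[leb]_x f x = 2%:E * \int[leb]_(x in `]0%R, +oo[) f x.
Proof.
move=> mf f0 fN.
pose g := f \_ `]0%R, +oo[.
have mg : measurable_fun setT g.
  by apply/(measurable_restrictT _ _).1 => //; exact: measurable_funTS.
have g0 x : 0 <= g x by rewrite /g/patch; case: ifPn.
have -> : \int[leb]_x f x = \int[leb]_x (g x + g (- x)%R).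
  apply: ae_eq_integral => //.
  - by apply: emeasurable_funD => //; by apply: (measurableT_comp mg); exact: oppr_measurable.
  (* The two open half-lines miss the origin, so the equality holds only off this null set. *)
  - exists [set 0%R]; split => //; first exact: lebesgue_measure_set1.
    move=> x /=; apply: contra_notP => /eqP x0 _.
    rewrite /g /patch !mem_setE !in_itv/= !andbT oppr_gt0.
    by case: ltgtP x0 => // _ _; rewrite ?add0e ?adde0 ?fN.
rewrite ge0_integralD//; last first.
  by apply: (measurableT_comp mg); exact: oppr_measurable.
rewrite ge0_integral_opp// -integral_mkcond.
by rewrite -[2%R]/(1 + 1)%R EFinD ge0_muleDl// mul1e.
Qed.

Lemma integral_isqrt_sym (r : R) : (0 < r)%R ->
  \int[leb]_(x in `](- r)%R, r[) isqrt x <= (4 * Num.sqrt r)%:E.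
Proof.
move=> r0; rewrite integral_mkcond ge0_integral_even.
- have -> : (4 * Num.sqrt r)%:E = 2%:E * (2 * Num.sqrt r)%:E.
    by rewrite -EFinM; congr EFin; ring.
  rewrite lee_pmul2l//; apply: le_trans (integral_isqrt_near r0).
  rewrite integral_mkcond [leRHS]integral_mkcond.
  rewrite le_eqVlt; apply/orP; left; apply/eqP; apply: eq_integral => x _.
  rewrite /patch !mem_setE !in_itv/= andbT.
  case: (ltrP 0%R x) => //= x0.
  by rewrite (lt_trans _ x0) ?oppr_lt0.
- by apply/(measurable_restrictT _ _).1 => //; exact: measurable_funTS measurable_isqrt.
- by move=> x; rewrite /patch; case: ifPn => // _; exact: isqrt_ge0.
- by move=> x; rewrite /patch !mem_setE !in_itv/= isqrtN ltrN2 ltrNl andbC.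
Qed.

(** On each half-line, the part before [b] has constant weight $1/b$ and the part beyond [b] is the
    integral of $x^{-3/2}$, with primitive $-2x^{-1/2}$; each is at most $2/\sqrt b$, and there are
    four of them. *)
Lemma integral_isqrt_decay (b : R) : (0 < b)%R ->
  \int[leb]_x (isqrt x * ((Num.max b `|x|)^-1)%:E) <= (8 / Num.sqrt b)%:E.
Proof.
move=> b0.
have m0 (x : R) : (0 < Num.max b `|x|)%R by rewrite lt_max b0.
have mm : measurable_fun setT (fun x : R => ((Num.max b `|x|)^-1)%:E).
  apply/measurable_EFinP/(measurableT_comp measurable_invr).
  apply: measurable_maxr; [exact: measurable_cst|exact: normr_measurable].
have mf : measurable_fun setT (fun x => isqrt x * ((Num.max b `|x|)^-1)%:E).
  by apply: emeasurable_funM => //; exact: measurable_isqrt.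
have f0 x : 0 <= isqrt x * ((Num.max b `|x|)^-1)%:E.
  by rewrite mule_ge0 ?isqrt_ge0// lee_fin invr_ge0 ltW.
rewrite ge0_integral_even//; last by move=> x; rewrite isqrtN normrN.
have -> : (8 / Num.sqrt b)%:E = 2%:E * ((2 / Num.sqrt b)%:E + (2 / Num.sqrt b)%:E).
  by rewrite -EFinD -EFinM; congr EFin; field; rewrite gt_eqF// sqrtr_gt0.
rewrite lee_pmul2l//.
have -> : `]0%R, +oo[%classic = `]0%R, b[%classic `|` `[b, +oo[%classic.
  by rewrite -itv_bndbnd_setU// bnd_simp ltW.
rewrite ge0_integral_setU//=; last 2 first.
- exact: measurable_funTS.
- apply/disj_setPLR => x /=; rewrite !in_itv/= andbT => /andP[_ xb].
  by rewrite leNgt xb.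
have sb : (0 < Num.sqrt b)%R by rewrite sqrtr_gt0.
apply: leeD.
- apply: (@le_trans _ _ (\int[leb]_(x in `]0%R, b[) (isqrt x * (b^-1)%:E))).
    apply: ge0_le_integral => //.
    + exact: measurable_funTS.
    + apply: measurable_funTS; apply: emeasurable_funM => //; first exact: measurable_isqrt.
    + move=> x _; rewrite lee_wpmul2l ?isqrt_ge0// lee_fin lef_pV2 ?posrE//.
      by rewrite le_max lexx.
  rewrite ge0_integralZr//; last 3 first.
  + exact: measurable_funTS measurable_isqrt.
  + by move=> x _; exact: isqrt_ge0.
  + by rewrite lee_fin invr_ge0 ltW.
  apply: (@le_trans _ _ ((2 * Num.sqrt b)%:E * (b^-1)%:E)).
    apply: lee_wpmul2r; first by rewrite lee_fin invr_ge0 ltW.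
    exact: integral_isqrt_near.
  rewrite -EFinM lee_fin -{2}(sqr_sqrtr (ltW b0)) le_eqVlt; apply/orP; left.
  by apply/eqP; field; rewrite gt_eqF.
- have c (x : R) : (0 < x)%R -> {for x, continuous (fun x : R => (x * Num.sqrt x)^-1)%R}.
    move=> x0; apply: continuousV.
      by rewrite mulf_neq0// gt_eqF// sqrtr_gt0.
    by apply: cvgM; [exact: cvg_id|exact: sqrt_continuous].
  have Fd (x : R) : (0 < x)%R ->
      is_derive x 1%R (fun x => - 2 * (Num.sqrt x)^-1)%R (x * Num.sqrt x)^-1%R.
    move=> x0; have d := is_derive1_sqrt x0.
    have sx : (0 < Num.sqrt x)%R by rewrite sqrtr_gt0.
    have dV := is_deriveV (lt0r_neq0 sx) d.
    apply: is_derive_eq.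
    rewrite /GRing.scale/= -{3}(sqr_sqrtr (ltW x0)).
    by field; rewrite gt_eqF.
  have F0 : (- 2 * (Num.sqrt x)^-1 : R)%R @[x --> +oo%R] --> (0 : R)%R.
    rewrite -[X in _ --> X](mulr0 (-2)%R); apply: cvgM; first exact: cvg_cst.
    apply/gtr0_cvgV0.
      by apply: filterS (nbhs_pinfty_gt (num_real 0%R)) => x; rewrite sqrtr_gt0.
    apply/cvgryPge => A; apply: filterS (nbhs_pinfty_ge (num_real (A ^+ 2)%R)) => x Ax.
    by rewrite (le_trans (ler_norm A))// -sqrtr_sqr ler_wsqrtr.
  have := @ge0_continuous_FTC2y _ (fun x => (x * Num.sqrt x)^-1)%R
    (fun x => - 2 * (Num.sqrt x)^-1)%R b 0%R _ _ F0 _ _ _.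
  have -> : \int[leb]_(x in `[b, +oo[) (isqrt x * (Num.max b `|x|)^-1%:E) =
     \int[leb]_(x in `[b, +oo[) ((x * Num.sqrt x)^-1)%:E.
    apply: eq_integral => x; rewrite inE/= in_itv/= andbT => bx.
    have x0 := lt_le_trans b0 bx.
    rewrite /isqrt gt_eqF// gtr0_norm// -EFinM; congr EFin.
    by move/max_idPr : bx => ->; rewrite invfM mulrC.
  move=> ->.
  + by rewrite -EFinB sub0r mulNr opprK.
  + move=> x bx; have x0 := lt_le_trans b0 bx.
    by rewrite invr_ge0 mulr_ge0 ?sqrtr_ge0// ltW.
  + apply: continuous_in_subspaceT => x; rewrite inE/= in_itv/= andbT => bx.
    exact/c/(lt_le_trans b0 bx).
  + by move=> x bx; have [] := Fd x (lt_trans b0 bx).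
  + apply: cvg_at_right_filter.
    apply: cvgM; first exact: cvg_cst.
    by apply: continuousV; [rewrite gt_eqF|exact: sqrt_continuous].
  + move=> x; rewrite in_itv/= andbT => bx; rewrite derive1E.
    by have [_ ->] := Fd x (lt_trans b0 bx).
Qed.

End inverse_square_root.

(** * Singular integrals in the plane against a measure of bounded density *)

Section plane_kernels.
Context {R : realType}.
Notation leb := (@lebesgue_measure R).
Local Open Scope ereal_scope.

Lemma integral_tensor (F G : R -> \bar R) (c : R * R) :
  measurable_fun setT F -> measurable_fun setT G ->
  (forall u, 0 <= F u) -> (forall u, 0 <= G u) ->
  \int[leb2 R]_z (F (z.1 - c.1)%R * G (z.2 - c.2)%R) =
  (\int[leb]_u F u) * (\int[leb]_u G u).
Proof.
move=> mF mG F0 G0.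
have mFs (c1 : R) : measurable_fun setT (fun u : R => F (u - c1)%R).
  apply: (measurableT_comp mF); apply: measurable_funB => //.
have mGs (c1 : R) : measurable_fun setT (fun u : R => G (u - c1)%R).
  apply: (measurableT_comp mG); apply: measurable_funB => //.
rewrite fubini_tonelli1//=; last 2 first.
- apply: emeasurable_funM.
  + exact: (measurableT_comp (mFs c.1) measurable_fst).
  + exact: (measurableT_comp (mGs c.2) measurable_snd).
- by move=> z; rewrite mule_ge0.
rewrite /fubini_F /=.
under eq_integral => x _.
  rewrite ge0_integralZl//=; last exact: mGs.
  rewrite (ge0_integral_addr (f := G))//.
  over.
rewrite ge0_integralZr//=; last 2 first.
- exact: mFs.
- exact: integral_ge0.
by rewrite (ge0_integral_addr (f := F)).
Qed.

Definition inv_norm (z : R * R) : R := ((Num.sqrt (sqnorm z))^-1)%R.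

Lemma sqnorm_ge0 (z : R * R) : (0 <= sqnorm z)%R.
Proof. by rewrite addr_ge0// sqr_ge0. Qed.

Lemma inv_norm_ge0 z : (0 <= inv_norm z)%R.
Proof. by rewrite invr_ge0 sqrtr_ge0. Qed.

Lemma sqnormN (z : R * R) : sqnorm (- z)%R = sqnorm z.
Proof. by rewrite /sqnorm /= !sqrrN. Qed.

(** From $|z_1||z_2|\le|z|^2$. The product on the right is still locally integrable in the plane. *)
Lemma inv_norm_le_isqrt z : (inv_norm z)%:E <= isqrt z.1 * isqrt z.2.
Proof.
have [z1|z1] := eqVneq z.1 0%R.
  by rewrite {1}/isqrt z1 eqxx gt0_mulye ?leey// isqrt_gt0.
have [z2|z2] := eqVneq z.2 0%R.
  by rewrite {2}/isqrt z2 eqxx gt0_muley ?leey// isqrt_gt0.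
rewrite /isqrt (negbTE z1) (negbTE z2) -EFinM lee_fin -invfM -sqrtrM//.
have z12 : (0 < `|z.1| * `|z.2|)%R by rewrite mulr_gt0 ?normr_gt0.
have le12 : (`|z.1| * `|z.2| <= sqnorm z)%R.
  rewrite /sqnorm -(real_normK (num_real z.1)) -(real_normK (num_real z.2)).
  move: (normr_ge0 z.1) (normr_ge0 z.2).
  move: `|z.1|%R `|z.2|%R => a b a0 b0; nra.
rewrite lef_pV2 ?posrE ?sqrtr_gt0//; first exact: ler_wsqrtr.
exact: lt_le_trans le12.
Qed.

Lemma norm1_le_sqnorm (z : R * R) : (`|z.1| <= Num.sqrt (sqnorm z))%R.
Proof. by rewrite -sqrtr_sqr ler_wsqrtr// lerDl sqr_ge0. Qed.

Lemma norm2_le_sqnorm (z : R * R) : (`|z.2| <= Num.sqrt (sqnorm z))%R.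
Proof. by rewrite -sqrtr_sqr ler_wsqrtr// lerDr sqr_ge0. Qed.

Lemma measurable_sqnorm : measurable_fun setT (@sqnorm R).
Proof. by apply: measurable_funD; apply: measurable_funX. Qed.

Lemma measurable_inv_norm : measurable_fun setT inv_norm.
Proof.
apply: (measurableT_comp (@measurable_invr R)).
exact: (measurableT_comp (@measurable_sqrt R) measurable_sqnorm).
Qed.

(** Says that the push-forward of [nu] by [Z] has a density at most [M], without naming that
    density; tested on functions, it can be applied directly to kernels. *)
Definition density_le d (Y : measurableType d) (nu : {measure set Y -> \bar R})
    (Z : Y -> R * R) (M : R) :=
  forall g : R * R -> \bar R, measurable_fun setT g -> (forall z, 0 <= g z) ->
  \int[nu]_y g (Z y) <= M%:E * \int[leb2 R]_z g z.

Section density_bounds.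
Context d (Y : measurableType d) (nu : {finite_measure set Y -> \bar R}).
Variables (Z : Y -> R * R) (M : R).
Hypotheses (mZ : measurable_fun setT Z) (M0 : (0 <= M)%R)
  (ZM : density_le nu Z M).
Let m := fine (nu setT).

Lemma fine_measureT : nu setT = m%:E.
Proof. by rewrite /m fineK// fin_num_measure. Qed.

Lemma mass_ge0 : (0 <= m)%R.
Proof. by rewrite fine_ge0. Qed.

(** Near/far splitting: over the box [D1 x D2] around [c] the density bound meets the product
    majorant, and elsewhere [k] is at most [s] on a total mass [m]. *)
Lemma density_integral_le (k : R * R -> R) (D1 D2 : set R) (c : R * R) (a1 a2 s : R) :
  measurable D1 -> measurable D2 -> measurable_fun setT k ->
  (forall z, 0 <= k z)%R -> (0 <= s)%R -> (0 <= a1)%R ->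
  (forall z, D1 z.1 -> D2 z.2 -> (k z)%:E <= isqrt z.1 * isqrt z.2) ->
  (forall z, ~ (D1 z.1 /\ D2 z.2) -> (k z <= s)%R) ->
  \int[leb]_(u in D1) isqrt u <= a1%:E -> \int[leb]_(u in D2) isqrt u <= a2%:E ->
  \int[nu]_y (k (Z y - c)%R)%:E <= (M * (a1 * a2) + m * s)%:E.
Proof.
move=> mD1 mD2 mk k0 s0 a10 kin kout I1 I2.
pose F := isqrt \_ D1; pose G := isqrt \_ D2.
have mF : measurable_fun setT F.
  by apply/(measurable_restrictT _ _).1 => //; exact: measurable_funTS measurable_isqrt.
have mG : measurable_fun setT G.
  by apply/(measurable_restrictT _ _).1 => //; exact: measurable_funTS measurable_isqrt.
have F0 u : 0 <= F u by rewrite /F/patch; case: ifPn => // _; exact: isqrt_ge0.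
have G0 u : 0 <= G u by rewrite /G/patch; case: ifPn => // _; exact: isqrt_ge0.
pose g z := F (z.1 - c.1)%R * G (z.2 - c.2)%R.
have mg : measurable_fun setT g.
  apply: emeasurable_funM.
  - apply: (measurableT_comp mF); apply: measurable_funB => //.
  - apply: (measurableT_comp mG); apply: measurable_funB => //.
have g0 z : 0 <= g z by rewrite mule_ge0.
have mgZ : measurable_fun setT (fun y => g (Z y)) by exact: measurableT_comp.
apply: (@le_trans _ _ (\int[nu]_y (g (Z y) + s%:E))).
  apply: ge0_le_integral => //=.
  - by move=> y _; rewrite lee_fin.
  - apply/measurable_EFinP/(measurableT_comp mk).
    have [m1 m2] := (measurable_fun_pairP Z).1 mZ.
    by apply/measurable_fun_pair; apply: measurable_funB.
  - by apply: emeasurable_funD.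
  - move=> y _; have [[h1 h2]|h] := pselect (D1 (Z y - c)%R.1 /\ D2 (Z y - c)%R.2).
    + apply: (le_trans (kin _ h1 h2)).
      by rewrite /g /F /G /patch !mem_set// leeDl// lee_fin.
    + by apply: (@le_trans _ _ s%:E); [rewrite lee_fin kout|rewrite leeDr].
rewrite ge0_integralD//= integral_cst//= fine_measureT -EFinM EFinD mulrC.
apply: leeD => //; apply: (le_trans (ZM mg g0)).
rewrite EFinM lee_wpmul2l ?lee_fin// integral_tensor// EFinM.
rewrite -!integral_mkcond.
by apply: lee_pmul => //; apply: integral_ge0 => u _; exact: isqrt_ge0.
Qed.

Lemma sqrt_sqnorm_ge (z : R * R) (r : R) :
  ~ (`](- r)%R, r[%classic z.1 /\ `](- r)%R, r[%classic z.2) ->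
  (r <= Num.sqrt (sqnorm z))%R.
Proof.
move=> h; rewrite leNgt; apply/negP => zr; apply: h => /=.
rewrite !in_itv/= -!ltr_norml.
by split; apply: le_lt_trans zr; [exact: norm1_le_sqnorm|exact: norm2_le_sqnorm].
Qed.

Lemma density_inv_norm c r : (0 < r)%R ->
  \int[nu]_y (inv_norm (Z y - c)%R)%:E <= (16 * M * r + m / r)%:E.
Proof.
move=> r0.
have -> : (16 * M * r + m / r = M * ((4 * Num.sqrt r) * (4 * Num.sqrt r)) + m * r^-1)%R.
  by rewrite -{1}(sqr_sqrtr (ltW r0)); ring.
apply: (@density_integral_le inv_norm `](- r)%R, r[%classic `](- r)%R, r[%classic) => //.
- exact: measurable_inv_norm.
- exact: inv_norm_ge0.
- by rewrite invr_ge0 ltW.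
- by move=> z _ _; exact: inv_norm_le_isqrt.
- move=> z /sqrt_sqnorm_ge h; rewrite /inv_norm lef_pV2 ?posrE//.
  exact: lt_le_trans h.
- exact: integral_isqrt_sym.
- exact: integral_isqrt_sym.
Qed.

(** The near box is now half as large, so 8 replaces 16. The sparse condition depends on this gain:
    with 16, the bound in [sparse_velocity_le] would be $8Qn/\pi$, larger than $2Qn$. *)
Lemma density_inv_norm_upper c r : (0 < r)%R ->
  \int[nu]_y (if 0 < (Z y - c)%R.2 then inv_norm (Z y - c) else 0)%R%:E <=
    (8 * M * r + m / r)%:E.
Proof.
move=> r0.
have -> : (8 * M * r + m / r = M * ((4 * Num.sqrt r) * (2 * Num.sqrt r)) + m * r^-1)%R.
  by rewrite -{1}(sqr_sqrtr (ltW r0)); ring.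
apply: (@density_integral_le (fun z => if 0 < z.2 then inv_norm z else 0)%R
  `](- r)%R, r[%classic `]0%R, r[%classic) => //.
- by apply: measurable_fun_ifT; [exact: measurable_fun_ltr|exact: measurable_inv_norm|].
- by move=> z; case: ifP => // _; exact: inv_norm_ge0.
- by rewrite invr_ge0 ltW.
- move=> z _ _; apply: le_trans (inv_norm_le_isqrt z); rewrite lee_fin.
  by case: ifP => // _; exact: inv_norm_ge0.
- move=> z h; case: (ltrP 0%R z.2) => z2; last by rewrite invr_ge0 ltW.
  rewrite /inv_norm lef_pV2 ?posrE//.
    apply: sqrt_sqnorm_ge => -[h1 h2]; apply: h; split => //.
    by move: h2; rewrite /= !in_itv/= z2 => /andP[].
  by rewrite sqrtr_gt0 /sqnorm ltr_wpDl ?sqr_ge0// exprn_gt0.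
- exact: integral_isqrt_sym.
- exact: integral_isqrt_near.
Qed.

Lemma density_inv_norm_lower c r : (0 < r)%R ->
  \int[nu]_y (if (Z y - c)%R.2 < 0 then inv_norm (Z y - c) else 0)%R%:E <=
    (8 * M * r + m / r)%:E.
Proof.
move=> r0.
have -> : (8 * M * r + m / r = M * ((4 * Num.sqrt r) * (2 * Num.sqrt r)) + m * r^-1)%R.
  by rewrite -{1}(sqr_sqrtr (ltW r0)); ring.
apply: (@density_integral_le (fun z => if z.2 < 0 then inv_norm z else 0)%R
  `](- r)%R, r[%classic `](- r)%R, 0%R[%classic) => //.
- by apply: measurable_fun_ifT; [exact: measurable_fun_ltr|exact: measurable_inv_norm|].
- by move=> z; case: ifP => // _; exact: inv_norm_ge0.
- by rewrite invr_ge0 ltW.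
- move=> z _ _; apply: le_trans (inv_norm_le_isqrt z); rewrite lee_fin.
  by case: ifP => // _; exact: inv_norm_ge0.
- move=> z h; case: (ltrP z.2 0%R) => z2; last by rewrite invr_ge0 ltW.
  rewrite /inv_norm lef_pV2 ?posrE//.
    apply: sqrt_sqnorm_ge => -[h1 h2]; apply: h; split => //.
    by move: h2; rewrite /= !in_itv/= z2 andbT => /andP[].
  by rewrite sqrtr_gt0 /sqnorm ltr_wpDl ?sqr_ge0// exprn_even_gt0//= lt_eqF.
- exact: integral_isqrt_sym.
- rewrite integral_mkcond -ge0_integral_opp.
  + apply: le_trans (integral_isqrt_near r0); rewrite [leRHS]integral_mkcond.
    rewrite le_eqVlt; apply/orP; left; apply/eqP; apply: eq_integral => u _.
    by rewrite /patch !mem_setE !in_itv/= isqrtN ltrN2 oppr_lt0 andbC.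
  + by apply/(measurable_restrictT _ _).1 => //; exact: measurable_funTS measurable_isqrt.
  + by move=> u; rewrite /patch; case: ifPn => // _; exact: isqrt_ge0.
Qed.

(** Off the origin this is $1/|z|-|z|/(|z|^2+e)$, the error made by regularizing the singularity at
    scale [e]. *)
Definition inv_norm_defect (e : R) (z : R * R) : R :=
  (e / (Num.sqrt (sqnorm z) * (sqnorm z + e)))%R.

Lemma inv_norm_defectE e z : inv_norm_defect e z = (inv_norm z * (e / (sqnorm z + e)))%R.
Proof. by rewrite /inv_norm_defect /inv_norm invfM mulrCA. Qed.

Lemma inv_norm_defect_ge0 e z : (0 < e)%R -> (0 <= inv_norm_defect e z)%R.
Proof.
move=> e0; rewrite inv_norm_defectE mulr_ge0 ?inv_norm_ge0//.
by rewrite divr_ge0 ?(ltW e0)// addr_ge0 ?sqnorm_ge0// ltW.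
Qed.

(** Near [c] the defect is at most $1/|z|$, and at distance [r] or more it is at most $e/r^3$. With
    $e=r^4$ the whole bound is of order [r]. *)
Lemma density_inv_norm_defect c e r : (0 < e)%R -> (0 < r)%R ->
  \int[nu]_y (inv_norm_defect e (Z y - c)%R)%:E <=
    (16 * M * r + m * (e / r ^+ 3))%:E.
Proof.
move=> e0 r0.
have -> : (16 * M * r + m * (e / r ^+ 3) =
   M * ((4 * Num.sqrt r) * (4 * Num.sqrt r)) + m * (e / r ^+ 3))%R.
  by rewrite -{1}(sqr_sqrtr (ltW r0)); ring.
have qe z : (0 < sqnorm z + e)%R by rewrite ltr_wpDl// sqnorm_ge0.
apply: (@density_integral_le (inv_norm_defect e)
  `](- r)%R, r[%classic `](- r)%R, r[%classic) => //.
- rewrite (_ : inv_norm_defect e = fun z => inv_norm z * (e * (sqnorm z + e)^-1))%R.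
    apply: measurable_funM; first exact: measurable_inv_norm.
    apply: measurable_funM => //; apply: (measurableT_comp measurable_invr).
    by apply: measurable_funD => //; exact: measurable_sqnorm.
  by apply/funext => z; rewrite inv_norm_defectE.
- by move=> z; exact: inv_norm_defect_ge0.
- by rewrite divr_ge0 ?exprn_ge0 ?ltW.
- move=> z _ _; apply: le_trans (inv_norm_le_isqrt z); rewrite lee_fin.
  rewrite inv_norm_defectE ler_piMr ?inv_norm_ge0// ler_pdivrMr// mul1r.
  by rewrite lerDr sqnorm_ge0.
- move=> z /sqrt_sqnorm_ge h; rewrite /inv_norm_defect ler_pM2l//.
  have s0 : (0 < Num.sqrt (sqnorm z))%R by exact: lt_le_trans h.
  rewrite lef_pV2 ?posrE ?exprn_gt0 ?mulr_gt0//.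
  rewrite exprSr mulrC; apply: ler_pM; rewrite ?exprn_ge0 ?(ltW r0)//.
  apply: (@le_trans _ _ (sqnorm z)); last by rewrite lerDl ltW.
  rewrite -[leRHS]sqr_sqrtr ?sqnorm_ge0//.
  by rewrite lerXn2r ?nnegrE ?(ltW r0)// ltW.
- exact: integral_isqrt_sym.
- exact: integral_isqrt_sym.
Qed.

(** The inverse square root with an extra decay beyond the scale [b], which makes it integrable on
    the whole line. *)
Definition isqrt_decay (b u : R) : \bar R := isqrt u * ((Num.max b `|u|)^-1)%:E.

Lemma isqrt_decay_ge0 b u : (0 < b)%R -> 0 <= isqrt_decay b u.
Proof.
by move=> b0; rewrite mule_ge0 ?isqrt_ge0// lee_fin invr_ge0 le_max ltW.
Qed.

Lemma measurable_isqrt_decay b : measurable_fun setT (isqrt_decay b).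
Proof.
apply: emeasurable_funM; first exact: measurable_isqrt.
apply/measurable_EFinP/(measurableT_comp measurable_invr).
by apply: measurable_maxr; [exact: measurable_cst|exact: normr_measurable].
Qed.

(** No far part and no mass term here: the kernel is integrable on the whole plane, with integral at
    most $(8/\sqrt b)^2$. *)
Lemma density_isqrt_decay c b : (0 < b)%R ->
  \int[nu]_y (isqrt_decay b (Z y - c)%R.1 * isqrt_decay b (Z y - c)%R.2) <=
    (M * (64 / b))%:E.
Proof.
move=> b0.
have mh := measurable_isqrt_decay b; have h0 u := isqrt_decay_ge0 u b0.
have := ZM (g := fun z => isqrt_decay b (z - c)%R.1 * isqrt_decay b (z - c)%R.2).
move=> /(_ _ _)/le_trans; apply.
- apply: emeasurable_funM.
  + by apply: (measurableT_comp mh); apply: measurable_funB.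
  + by apply: (measurableT_comp mh); apply: measurable_funB.
- by move=> z; rewrite mule_ge0.
rewrite EFinM lee_wpmul2l ?lee_fin//.
rewrite integral_tensor//.
have -> : (64 / b)%:E = (8 / Num.sqrt b)%:E * (8 / Num.sqrt b)%:E.
  rewrite -EFinM; congr EFin; rewrite -[in LHS](sqr_sqrtr (ltW b0)).
  by field; rewrite gt_eqF// sqrtr_gt0.
by apply: lee_pmul; rewrite ?integral_ge0// ?integral_isqrt_decay.
Qed.

End density_bounds.
End plane_kernels.

(** * Integrability of real-valued functions *)

Section integrable_EFin.
Context d (Y : measurableType d) {R : realType} (nu : {measure set Y -> \bar R}).
Implicit Types f g : Y -> R.
Notation int f := (nu.-integrable setT (EFin \o f)).

Lemma integrable_EFinD f g : int f -> int g -> int (fun y => f y + g y).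
Proof. by move=> i j; exact: (integrableD measurableT i j). Qed.

Lemma integrable_EFinB f g : int f -> int g -> int (fun y => f y - g y).
Proof. by move=> i j; exact: (integrableB measurableT i j). Qed.

Lemma integrable_EFinN f : int f -> int (fun y => - f y).
Proof. by move=> i; exact: (integrableN i). Qed.

Lemma integrable_EFinZ (k : R) f : int f -> int (fun y => k * f y).
Proof. by move=> i; exact: (integrableZl measurableT k i). Qed.

Lemma integrable_EFin_measurable f : int f -> measurable_fun setT f.
Proof. by move=> /integrableP[/measurable_EFinP]. Qed.

Lemma ge0_integrable_EFin f (c : R) : measurable_fun setT f ->
  (forall y, 0 <= f y) -> (\int[nu]_y (f y)%:E <= c%:E)%E -> int f.
Proof.
move=> mf f0 fc; apply/integrableP; split; first exact/measurable_EFinP.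
under eq_integral do rewrite /= ger0_norm//.
by apply: le_lt_trans fc _; rewrite ltry.
Qed.

Lemma ge0_Rintegral_le f (c : R) : (forall y, 0 <= f y) -> 
  (\int[nu]_y (f y)%:E <= c%:E)%E -> \int[nu]_y f y <= c.
Proof.
move=> f0 fc; rewrite /Rintegral -lee_fin fineK//.
rewrite ge0_fin_numE; first by apply: le_lt_trans fc _; rewrite ltry.
by apply: integral_ge0 => y _; rewrite lee_fin.
Qed.

Lemma dominated_integrable f g : measurable_fun setT f ->
  (forall y, `|f y| <= g y) -> int g -> int f.
Proof.
move=> mf fg; apply: le_integrable => //; first exact/measurable_EFinP.
by move=> y _; rewrite /= lee_fin (le_trans (fg y))// ler_norm.
Qed.

End integrable_EFin.

(** * Growth in time of an integral along trajectories *)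

Section integral_growth.
Context {R : realType}.

Lemma derive_within_continuous (g g' : R -> R) (t : R) : 0 < t ->
  g s @[s --> 0^'+] --> g 0 ->
  (forall s : R, 0 < s -> is_derive s 1 g (g' s)) ->
  {within `[0, t], continuous g}.
Proof.
move=> t0 g0 dg.
have cg (s : R) : 0 < s -> {for s, continuous g}.
  move=> s0; have [d _] := dg s s0.
  exact/differentiable_continuous/derivable1_diffP.
apply/continuous_within_itvP => //; split => //.
- by move=> s; rewrite in_itv/= => /andP[s0 _]; exact: cg.
- exact/cvg_at_left_filter/cg.
Qed.

(** The flow equation is known for positive times only; at time 0 continuity from the right takes
    its place. *)
Lemma MVT_right (g g' : R -> R) (t : R) : 0 < t ->
  g s @[s --> 0^'+] --> g 0 ->
  (forall s : R, 0 < s -> is_derive s 1 g (g' s)) ->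
  exists2 s : R, 0 < s & g t - g 0 = g' s * t.
Proof.
move=> t0 g0 dg.
have dg' (s : R) : s \in `]0, t[ -> is_derive s 1 g (g' s).
  by rewrite in_itv/= => /andP[s0 _]; exact: dg.
have [s] := MVT t0 dg' (derive_within_continuous t0 g0 dg).
by rewrite in_itv/= subr0 => /andP[s0 _] ->; exists s.
Qed.

Section bounded.
Context d (Y : measurableType d) (nu : {finite_measure set Y -> \bar R}).

Lemma measureT_lty : (nu setT < +oo)%E.
Proof. by rewrite ltey_eq fin_num_measure. Qed.

Lemma bounded_integrable (f : Y -> R) (G : R) : measurable_fun setT f ->
  (forall y, `|f y| <= G) -> nu.-integrable setT (EFin \o f).
Proof.
by move=> mf fG; exact: (dominated_integrable mf fG (finite_measure_integrable_cst _ _ measurableT)).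
Qed.

End bounded.

Context d (Y : measurableType d) (nu : {measure set Y -> \bar R}).
Hypothesis nufin : (nu setT < +oo)%E.

Let integrable_cst (G : R) : nu.-integrable setT (EFin \o cst G).
Proof.
apply/integrableP; split; first exact/measurable_EFinP.
by rewrite (eq_integral (cst `|G|%:E))// integral_cst// lte_mul_pinfty.
Qed.

(** Differentiation under the integral for positive times, then the mean value theorem. The measure
    is a plain one of finite total mass so that the product [mu \x mu] is covered too. *)
Lemma integral_growth (f f' : R -> Y -> R) (G c t : R) :
  (forall s : R, 0 <= s -> nu.-integrable setT (EFin \o f s)) ->
  (forall y, f s y @[s --> 0^'+] --> f 0 y) ->
  (forall (s : R) y, 0 < s -> is_derive s 1 (f^~ y) (f' s y)) ->
  (forall (s : R) y, 0 < s -> `|f' s y| <= G) ->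
  (forall s : R, 0 < s -> c <= \int[nu]_y f' s y) ->
  0 <= t -> c * t <= \int[nu]_y f t y - \int[nu]_y f 0 y.
Proof.
move=> fint f0 df f'G cf'; rewrite le_eqVlt => /predU1P[<-|t0].
  by rewrite subrr mulr0.
pose F s := \int[nu]_y f s y.
have dF (s : R) : 0 < s -> is_derive s 1 F (\int[nu]_y f' s y).
  move=> s0.
  have s0' : `]0, (s + 1)[%classic s by rewrite /= in_itv/= s0 ltrDl ltr01.
  have I0 (x : R) : `]0, (s + 1)[%classic x -> 0 < x by rewrite /= in_itv/= => /andP[].
  have d1 (x : R) y : 0 < x -> partial1of2 f x y = f' x y.
    by move=> x0; rewrite partial1of2E; have [_ ->] := df x y x0.
  have G0 (y : Y) : 0 <= G by apply: le_trans (f'G s y s0).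
  have GE : (fun=> G) = (fun y : Y => `|G|).
    by apply/funext => y; rewrite ger0_norm// (G0 y).
  have i1 (x : R) : `]0, (s + 1)[%classic x -> nu.-integrable setT (EFin \o f x).
    by move=> /I0 /ltW; exact: fint.
  have i2 (x : R) y : `]0, (s + 1)[%classic x -> setT y -> derivable (f^~ y) x 1.
    by move=> /I0 x0 _; have [] := df x y x0.
  (* The dominating constant is the absolute value of [G] because [G] is only known to be
     non-negative once [Y] has a point. *)
  have i3 : nu.-integrable setT (EFin \o (fun=> `|G|)).
    exact: integrable_cst.
  have i4 (x : R) y : `]0, (s + 1)[%classic x -> setT y -> `|partial1of2 f x y| <= `|G|.
    by move=> /I0 x0 _; rewrite d1// (le_trans (f'G x y x0))// ler_norm.
  have -> : \int[nu]_y f' s y = \int[nu]_y partial1of2 f s y.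
    by apply: eq_Rintegral => y _; rewrite d1.
  have dF := derivable_under_integral measurableT s0' i1 i2 (fun _ => normr_ge0 _) i3 i4.
  apply: DeriveDef => //.
  rewrite -derive1E.
  exact: (differentiation_under_integral measurableT s0' i1 i2 (fun _ => normr_ge0 _) i3 i4).
(* This Lipschitz bound is uniform in [y], so right continuity at 0 passes from [f] to its
   integral. *)
have lip (s : R) y : 0 < s -> `|f s y - f 0 y| <= G * s.
  move=> s0; have [r r0 ->] := MVT_right s0 (f0 y) (fun s => df s y).
  by rewrite normrM (gtr0_norm s0) ler_wpM2r ?(ltW s0)// f'G.
pose m := fine (nu setT).
have m0 : 0 <= m by rewrite fine_ge0.
have F0 : F s @[s --> 0^'+] --> F 0.
  have lipF (s : R) : 0 < s -> `|F 0 - F s| <= G * s * m.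
    move=> s0; rewrite -RintegralB//; [|exact: fint|exact/fint/ltW].
    have i : nu.-integrable setT (EFin \o (fun y => f 0 y - f s y)).
      by apply: integrable_EFinB; [exact: fint|exact/fint/ltW].
    apply: (le_trans (le_normr_Rintegral measurableT i)).
    rewrite -(@Rintegral_cst _ _ _ nu setT measurableT (G * s)).
    apply: le_Rintegral => //.
    + exact: (integrable_abse i).
    + exact: integrable_cst.
    + by move=> y _; rewrite distrC lip.
  have : (G * s * m) @[s --> 0^'+] --> (0 : R).
    apply: cvg_at_right_filter.
    rewrite -[X in _ --> X](mul0r m) -[X in _ --> X * m](mulr0 G).
    by apply: cvgM; [apply: cvgM; [exact: cvg_cst|exact: cvg_id]|exact: cvg_cst].
  move=> /cvgrPdist_le Gs0; apply/cvgrPdist_le => e e0.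
  near=> s.
  have s0 : 0 < s by near: s; exact: nbhs_right_gt.
  apply: (le_trans (lipF s s0)); apply: (le_trans (ler_norm _)).
  rewrite -normrN -[- _]add0r.
  by near: s; exact: Gs0.
have [s s0 E] := MVT_right t0 F0 dF.
by rewrite -/(F t) -/(F 0) E ler_wpM2r ?(ltW t0)// cf'.
Unshelve. all: by end_near. Qed.

End integral_growth.

(** * Fubini for real-valued integrals *)

Section product_Rintegral.
Context {R : realType} d1 d2 (X1 : measurableType d1) (X2 : measurableType d2).
Variables (m1 : {finite_measure set X1 -> \bar R})
  (m2 : {finite_measure set X2 -> \bar R}).

Lemma prod_integrable (f : X1 * X2 -> R) (C : R) :
  measurable_fun setT f ->
  (forall x, (\int[m2]_y `|f (x, y)|%:E <= C%:E)%E) ->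
  (m1 \x m2)%E.-integrable setT (EFin \o f).
Proof.
move=> mf fC; apply/integrable12ltyP; first exact/measurable_EFinP.
apply: (@le_lt_trans _ _ (\int[m1]_x C%:E)%E).
  apply: ge0_le_integral => //.
  - by move=> x _; apply: integral_ge0 => y _; rewrite lee_fin.
  - apply: (@measurable_fun_fubini_tonelli_F _ _ _ _ _ m2 (fun p => `|f p|%:E)) => //.
    by apply/measurable_EFinP; exact: measurableT_comp.
  - by move=> x _; exact: fC.
by rewrite integral_cst// ltey_eq fin_numM// fin_num_measure.
Qed.

Lemma bounded_prod_integrable (f : X1 * X2 -> R) (C : R) :
  measurable_fun setT f -> (forall p, `|f p| <= C) ->
  (m1 \x m2)%E.-integrable setT (EFin \o f).
Proof.
move=> mf fC; apply: (@prod_integrable _ (C * fine (m2 setT))) => // x.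
apply: (@le_trans _ _ (\int[m2]_y C%:E)%E).
  apply: ge0_le_integral => //.
  - apply/measurable_EFinP; apply: measurableT_comp => //.
    exact: (measurableT_comp mf (pair1_measurable x)).
  - by move=> y _; rewrite lee_fin.
by rewrite integral_cst// EFinM fineK// fin_num_measure.
Qed.

Section sections.
Variable f : X1 * X2 -> R.
Hypothesis fint : (m1 \x m2)%E.-integrable setT (EFin \o f).
Hypothesis f1 : forall x, m2.-integrable setT (EFin \o (fun y => f (x, y))).

(** Every section is integrable, not only almost every one, so [fine] loses nothing inside the
    iterated integrals. *)
Lemma EFin_section x :
  (\int[m2]_y f (x, y))%:E = (\int[m2]_y (f (x, y))%:E)%E.
Proof. by rewrite /Rintegral fineK//; exact: (integrable_fin_num measurableT (f1 x)). Qed.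

Lemma integrable_section :
  m1.-integrable setT (EFin \o (fun x => \int[m2]_y f (x, y))).
Proof.
have := integrable_fubini_F fint; rewrite /fubini_F.
by under eq_fun do rewrite /= -EFin_section.
Qed.

Lemma Rintegral_sections :
  \int[m1]_x \int[m2]_y f (x, y) = \int[(m1 \x m2)%E]_p f p.
Proof.
rewrite /Rintegral; congr fine.
rewrite -(integral12_prod_meas1 fint) /fubini_F.
by apply: eq_integral => x _; exact: EFin_section.
Qed.

Hypothesis f2 : forall y, m1.-integrable setT (EFin \o (fun x => f (x, y))).

Lemma Rintegral_swap :
  \int[m1]_x \int[m2]_y f (x, y) = \int[m2]_y \int[m1]_x f (x, y).
Proof.
rewrite Rintegral_sections /Rintegral; congr fine.
rewrite -(integral21_prod_meas1 fint) /fubini_G.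
apply: eq_integral => y _; rewrite fineK//.
exact: (integrable_fin_num measurableT (f2 y)).
Qed.

End sections.
End product_Rintegral.

(** * Pointwise bounds on the Biot-Savart kernel *)

Section biot_savart.
Context {R : realType}.
Implicit Types z y : R * R.

Lemma BSkernel1E z y : (BSkernel z y).1 =
  (2 * pi)^-1 * ((z.2 + y.2) / sqnorm (z - reflect2 y) - (z.2 - y.2) / sqnorm (z - y)).
Proof.
by rewrite /BSkernel /= /GRing.scale /=; congr (_ * _); rewrite opprK; ring.
Qed.

Lemma BSkernel2E z y : (BSkernel z y).2 =
  (2 * pi)^-1 * ((z.1 - y.1) / sqnorm (z - y) - (z.1 - y.1) / sqnorm (z - reflect2 y)).
Proof.
by rewrite /BSkernel /= /GRing.scale /=; congr (_ * _); ring.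
Qed.

Lemma sqnorm_reflect z y : sqnorm (z - reflect2 y) = sqnorm (y - reflect2 z).
Proof. by rewrite /sqnorm/=; ring. Qed.

Lemma sqnormC z y : sqnorm (z - y) = sqnorm (y - z).
Proof. by rewrite -sqnormN opprB. Qed.

Lemma sqnorm_reflectE z y : sqnorm (z - reflect2 y) = sqnorm (z - y) + 4 * z.2 * y.2.
Proof. by rewrite /sqnorm/=; ring. Qed.

(* Also true at [q = 0], where [a / q] and [q^-1] are [0]. *)
Lemma norm_div_le (a q : R) : a ^+ 2 <= q -> `|a / q| <= (Num.sqrt q)^-1.
Proof.
move=> aq; have q0 : 0 <= q by rewrite (le_trans (sqr_ge0 a)).
have [->|q_neq0] := eqVneq q 0; first by rewrite invr0 mulr0 normr0 sqrtr0 invr0.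
have sq0 : 0 < Num.sqrt q by rewrite sqrtr_gt0 lt0r q_neq0.
rewrite normrM normfV (ger0_norm q0) ler_pdivrMr ?lt0r ?q_neq0//.
rewrite -{2}(sqr_sqrtr q0) expr2 mulKf ?gt_eqF//.
by rewrite -sqrtr_sqr ler_wsqrtr.
Qed.

(** The difference is $-(a/q)\,e/(q+e)$. If [q] is 0 then so is [a], hence division by zero does no
    harm. *)
Lemma norm_div_defect (a q e : R) : 0 < e -> a ^+ 2 <= q ->
  `|a / (q + e) - a / q| <= e / (Num.sqrt q * (q + e)).
Proof.
move=> e0 aq; have q0 : 0 <= q by rewrite (le_trans (sqr_ge0 a)).
have [q_eq0|q_neq0] := eqVneq q 0.
  have -> : a = 0.
    by apply/eqP; rewrite -sqrf_eq0 eq_le sqr_ge0 -q_eq0 aq.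
  by rewrite !mul0r subrr normr0 q_eq0 sqrtr0 mul0r invr0 mulr0.
have qe : 0 < q + e by rewrite ltr_wpDl.
have -> : a / (q + e) - a / q = - (a / q) * (e / (q + e)).
  by field; rewrite q_neq0 gt_eqF.
rewrite normrM normrN (gtr0_norm (divr_gt0 e0 qe)).
rewrite invfM [leRHS]mulrCA; apply: ler_wpM2r; last exact: norm_div_le.
by rewrite divr_ge0// ltW.
Qed.

(** For $e\le1$ one has $|a|e\le a^2+e$. *)
Lemma norm_div_reg (a q e : R) : 0 < e <= 1 -> a ^+ 2 <= q -> `|a / (q + e)| <= e^-1.
Proof.
move=> /andP[e0 e1] aq; have q0 : 0 <= q by rewrite (le_trans (sqr_ge0 a)).
have qe : 0 < q + e by rewrite ltr_wpDl.
rewrite normrM normfV (gtr0_norm qe) ler_pdivrMr// mulrC ler_pdivlMr//.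
rewrite -(real_normK (num_real a)) in aq.
have := normr_ge0 a; move: `|a| aq => b b2 b0; nra.
Qed.

Lemma sqr1_le_sqnorm z : z.1 ^+ 2 <= sqnorm z.
Proof. by rewrite lerDl sqr_ge0. Qed.

Lemma sqr2_le_sqnorm z : z.2 ^+ 2 <= sqnorm z.
Proof. by rewrite lerDr sqr_ge0. Qed.

Lemma pi_ge1 : 1 <= pi :> R.
Proof. by apply: le_trans (pi_ge2 R); rewrite ler1n. Qed.

Lemma norm_BSkernel1 z y :
  `|(BSkernel z y).1| <= inv_norm (y - reflect2 z) + inv_norm (y - z).
Proof.
have := pi_ge1; set p := pi => p1.
rewrite BSkernel1E normrM (@ger0_norm _ (2 * p)^-1) ?invr_ge0; last by lra.
have h1 : `|(z.2 + y.2) / sqnorm (z - reflect2 y)| <= inv_norm (y - reflect2 z).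
  rewrite /inv_norm (sqnorm_reflect y z); apply: norm_div_le.
  by have := sqr2_le_sqnorm (z - reflect2 y); rewrite /= opprK.
have h2 : `|(z.2 - y.2) / sqnorm (z - y)| <= inv_norm (y - z).
  by rewrite /inv_norm (sqnormC y z); apply: norm_div_le; exact: (sqr2_le_sqnorm (z - y)).
rewrite ler_pdivrMl; last by lra.
apply: (le_trans (ler_normB _ _)).
have := inv_norm_ge0 (y - reflect2 z); have := inv_norm_ge0 (y - z).
nra.
Qed.

Lemma norm_BSkernel2 z y :
  `|(BSkernel z y).2| <= inv_norm (y - reflect2 z) + inv_norm (y - z).
Proof.
have := pi_ge1; set p := pi => p1.
rewrite BSkernel2E normrM (@ger0_norm _ (2 * p)^-1) ?invr_ge0; last by lra.
have h1 : `|(z.1 - y.1) / sqnorm (z - reflect2 y)| <= inv_norm (y - reflect2 z).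
  rewrite /inv_norm (sqnorm_reflect y z); apply: norm_div_le.
  exact: (sqr1_le_sqnorm (z - reflect2 y)).
have h2 : `|(z.1 - y.1) / sqnorm (z - y)| <= inv_norm (y - z).
  by rewrite /inv_norm (sqnormC y z); apply: norm_div_le; exact: (sqr1_le_sqnorm (z - y)).
rewrite ler_pdivrMl; last by lra.
apply: (le_trans (ler_normB _ _)).
have := inv_norm_ge0 (y - reflect2 z); have := inv_norm_ge0 (y - z).
nra.
Qed.

(* Apart from its mirror image, [y] pushes [z] to the right only if [z] lies below it. *)
Lemma BSkernel1_le z y : 0 < z.2 -> 0 < y.2 ->
  (BSkernel z y).1 <= (2 * pi)^-1 *
   ((if 0 < (z - reflect2 y).2 then inv_norm (z - reflect2 y) else 0) +
    (if (z - y).2 < 0 then inv_norm (z - y) else 0)).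
Proof.
move=> z2 y2; rewrite BSkernel1E ler_wpM2l ?invr_ge0 ?mulr_ge0 ?pi_ge0//.
have -> : 0 < (z - reflect2 y).2 by rewrite /= opprK addr_gt0.
apply: lerD.
  apply: le_trans (ler_norm _) _; apply: norm_div_le.
  by have := sqr2_le_sqnorm (z - reflect2 y); rewrite /= opprK.
case: (ltrP (z - y).2 0) => h.
  apply: le_trans (ler_norm _) _.
  by rewrite normrN; apply: norm_div_le; exact: (sqr2_le_sqnorm (z - y)).
by rewrite oppr_le0 divr_ge0 ?sqnorm_ge0.
Qed.

(** From $0=\cos(\pi/2)=1-2\sin^2(\pi/4)$ and $\sin(\pi/4)\le\pi/4$. Both the constant of the sparse
    condition and the one in [V_P] rely on it. *)
Lemma pi_ge_sqrt8 : Num.sqrt 8 <= pi :> R.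
Proof.
have p0 := pi_gt0 R.
rewrite -[leRHS]ger0_norm ?(ltW p0)// -sqrtr_sqr ler_wsqrtr//.
have s4 : sin (pi / 4) <= pi / 4 :> R.
  have q0 : 0 < pi / 4 :> R by rewrite divr_gt0.
  have [|c _] := @MVT R sin cos 0 (pi / 4) q0 (fun x _ => is_derive_sin x).
    by apply: continuous_subspaceT => x; exact: continuous_sin.
  by rewrite sin0 !subr0 => ->; rewrite ler_piMl ?cos_le1// ltW.
have s40 : 0 <= sin (pi / 4) :> R.
  by apply: sin_ge0_pi; rewrite divr_ge0 ?(ltW p0)//= ler_pdivrMr// ler_peMr ?(ltW p0)// ler1n.
have : cos (pi / 2) = 1 - 2 * sin (pi / 4) ^+ 2 :> R.
  have -> : pi / 2 = pi / 4 + pi / 4 :> R by field.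
  by rewrite cosD -!expr2 cos2sin2; ring.
rewrite cos_pihalf.
move: (sin _) s4 s40 => s; move: pi p0 => p p0 s4 s40 E; nra.
Qed.

End biot_savart.

(** * The velocity generated at a fixed time *)

Section snapshot.
Context {R : realType} d (X : measurableType d).
Variables (mu : {finite_measure set X -> \bar R}) (Z : X -> R * R) (M : R).
Hypotheses (mZ : measurable_fun setT Z) (M0 : 0 <= M) (ZM : density_le mu Z M).
Let m := fine (mu setT).

(** The near/far bound with radius 1 on the integral of $1/|z-c|$. A velocity component is at most
    twice this, one share for the point vortices and one for their images. *)
Definition speed : R := 16 * M + m.

Definition push_velocity (z : R * R) : R * R :=
  (\int[mu]_y (BSkernel z (Z y)).1, \int[mu]_y (BSkernel z (Z y)).2).

Lemma speed_ge0 : 0 <= speed.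
Proof. by rewrite addr_ge0 ?mulr_ge0// /m mass_ge0. Qed.

Lemma integral_inv_norm_le c : (\int[mu]_y (inv_norm (Z y - c))%:E <= speed%:E)%E.
Proof.
by have := density_inv_norm mZ M0 ZM c ltr01; rewrite mulr1 divr1.
Qed.

Lemma measurable_Z1 : measurable_fun setT (fun y => (Z y).1).
Proof. exact: (measurableT_comp measurable_fst mZ). Qed.

Lemma measurable_Z2 : measurable_fun setT (fun y => (Z y).2).
Proof. exact: (measurableT_comp measurable_snd mZ). Qed.

Lemma measurable_inv_norm_shift c : measurable_fun setT (fun y => inv_norm (Z y - c)).
Proof.
apply: (measurableT_comp measurable_inv_norm).
by apply/measurable_fun_pair; apply: measurable_funB => //;
  [exact: measurable_Z1|exact: measurable_Z2].
Qed.

Lemma integrable_inv_norm c : mu.-integrable setT (EFin \o (fun y => inv_norm (Z y - c))).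
Proof.
apply: ge0_integrable_EFin (integral_inv_norm_le c).
  exact: measurable_inv_norm_shift.
by move=> y; exact: inv_norm_ge0.
Qed.

Lemma Rintegral_inv_norm_le c : \int[mu]_y inv_norm (Z y - c) <= speed.
Proof.
apply: ge0_Rintegral_le (integral_inv_norm_le c) => y; exact: inv_norm_ge0.
Qed.

Section kernel_measurability.
Context d' (X' : measurableType d') (Z' : X' -> R * R).
Hypothesis mZ' : measurable_fun setT Z'.

Let mp1 : measurable_fun setT (fun p : X' * X => (Z' p.1).1).
Proof. exact: (measurableT_comp measurable_fst (measurableT_comp mZ' measurable_fst)). Qed.
Let mp2 : measurable_fun setT (fun p : X' * X => (Z' p.1).2).
Proof. exact: (measurableT_comp measurable_snd (measurableT_comp mZ' measurable_fst)). Qed.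
Let mq1 : measurable_fun setT (fun p : X' * X => (Z p.2).1).
Proof. exact: (measurableT_comp measurable_fst (measurableT_comp mZ measurable_snd)). Qed.
Let mq2 : measurable_fun setT (fun p : X' * X => (Z p.2).2).
Proof. exact: (measurableT_comp measurable_snd (measurableT_comp mZ measurable_snd)). Qed.

Lemma measurable_dx : measurable_fun setT (fun p : X' * X => (Z' p.1).1 - (Z p.2).1).
Proof. exact: measurable_funB. Qed.

Lemma measurable_dy : measurable_fun setT (fun p : X' * X => (Z' p.1).2 - (Z p.2).2).
Proof. exact: measurable_funB. Qed.

Lemma measurable_sy : measurable_fun setT (fun p : X' * X => (Z' p.1).2 + (Z p.2).2).
Proof. exact: measurable_funD. Qed.

Lemma measurable_qm : measurable_fun setT (fun p : X' * X => sqnorm (Z' p.1 - Z p.2)).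
Proof.
by apply: measurable_funD; apply: measurable_funX; [exact: measurable_dx|exact: measurable_dy].
Qed.

Lemma measurable_qp : measurable_fun setT (fun p : X' * X => sqnorm (Z' p.1 - reflect2 (Z p.2))).
Proof.
apply: measurable_funD; apply: measurable_funX; first exact: measurable_dx.
by under eq_fun do rewrite /= opprK; exact: measurable_sy.
Qed.

End kernel_measurability.

Lemma measurable_quot d' (T : measurableType d') (f g : T -> R) :
  measurable_fun setT f -> measurable_fun setT g -> measurable_fun setT (fun x => f x / g x).
Proof.
move=> mf mg; apply: measurable_funM => //.
exact: (measurableT_comp (@measurable_invr R)).
Qed.

Lemma measurable_BSkernel1 d' (X' : measurableType d') (Z' : X' -> R * R) :
  measurable_fun setT Z' ->
  measurable_fun setT (fun p : X' * X => (BSkernel (Z' p.1) (Z p.2)).1).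
Proof.
move=> mZ'; under eq_fun do rewrite BSkernel1E.
apply: measurable_funM => //; apply: measurable_funB; apply: measurable_quot.
- exact: measurable_sy.
- exact: measurable_qp.
- exact: measurable_dy.
- exact: measurable_qm.
Qed.

Lemma measurable_BSkernel2 d' (X' : measurableType d') (Z' : X' -> R * R) :
  measurable_fun setT Z' ->
  measurable_fun setT (fun p : X' * X => (BSkernel (Z' p.1) (Z p.2)).2).
Proof.
move=> mZ'; under eq_fun do rewrite BSkernel2E.
apply: measurable_funM => //; apply: measurable_funB; apply: measurable_quot.
- exact: measurable_dx.
- exact: measurable_qm.
- exact: measurable_dx.
- exact: measurable_qp.
Qed.

Let majorant z y := inv_norm (Z y - reflect2 z) + inv_norm (Z y - z).

Let majorant_int z : mu.-integrable setT (EFin \o majorant z).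
Proof. by apply: integrable_EFinD; exact: integrable_inv_norm. Qed.

Let majorant_le z : \int[mu]_y majorant z y <= 2 * speed.
Proof.
rewrite RintegralD//; [|exact: integrable_inv_norm..].
have -> : 2 * speed = speed + speed by ring.
by apply: lerD; exact: Rintegral_inv_norm_le.
Qed.

Let majorant_int_le z : (\int[mu]_y (majorant z y)%:E <= (2 * speed)%:E)%E.
Proof.
rewrite -(fineK (integrable_fin_num measurableT (majorant_int z))) lee_fin.
exact: majorant_le.
Qed.

Section one_point.
Variable k : R * R -> R * R -> R.
Hypothesis mk : forall z, measurable_fun setT (fun y => k z (Z y)).
Hypothesis kM : forall z y, `|k z (Z y)| <= majorant z y.

Lemma integrable_kernel z : mu.-integrable setT (EFin \o (fun y => k z (Z y))).
Proof. exact: (dominated_integrable (mk z) (kM z) (majorant_int z)). Qed.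

Lemma norm_Rintegral_kernel z : `|\int[mu]_y k z (Z y)| <= 2 * speed.
Proof.
apply: (le_trans (le_normr_Rintegral measurableT (integrable_kernel z))).
apply: le_trans (majorant_le z).
apply: le_Rintegral => //; exact: (integrable_abse (integrable_kernel z)).
Qed.

Lemma prod_integrable_kernel d' (X' : measurableType d') (nu : {finite_measure set X' -> \bar R})
    (Z' : X' -> R * R) :
  measurable_fun setT (fun p : X' * X => k (Z' p.1) (Z p.2)) ->
  (nu \x mu)%E.-integrable setT (EFin \o (fun p => k (Z' p.1) (Z p.2))).
Proof.
move=> mk'; apply: (@prod_integrable _ _ _ _ _ nu mu _ (2 * speed)) => // x /=.
apply: le_trans (majorant_int_le (Z' x)).
apply: ge0_le_integral => //.
- by apply/measurable_EFinP; exact: measurableT_comp.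
- by apply: (measurable_int mu); exact: majorant_int.
- by move=> y _; rewrite lee_fin.
Qed.

End one_point.

Let measurable_diag : measurable_fun setT (fun y : X => (y, y)).
Proof. exact: measurable_fun_pair. Qed.

Lemma measurable_BSkernel1r z : measurable_fun setT (fun y => (BSkernel z (Z y)).1).
Proof.
exact: (measurableT_comp (measurable_BSkernel1 (Z' := cst z) (measurable_cst _)) measurable_diag).
Qed.

Lemma measurable_BSkernel2r z : measurable_fun setT (fun y => (BSkernel z (Z y)).2).
Proof.
exact: (measurableT_comp (measurable_BSkernel2 (Z' := cst z) (measurable_cst _)) measurable_diag).
Qed.

Lemma integrable_BSkernel1 z : mu.-integrable setT (EFin \o (fun y => (BSkernel z (Z y)).1)).
Proof.
apply: (integrable_kernel (k := fun z y => (BSkernel z y).1)) => [?|? ?].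
  exact: measurable_BSkernel1r.
exact: norm_BSkernel1.
Qed.

Lemma integrable_BSkernel2 z : mu.-integrable setT (EFin \o (fun y => (BSkernel z (Z y)).2)).
Proof.
apply: (integrable_kernel (k := fun z y => (BSkernel z y).2)) => [?|? ?].
  exact: measurable_BSkernel2r.
exact: norm_BSkernel2.
Qed.

Lemma push_velocity1_le z : `|(push_velocity z).1| <= 2 * speed.
Proof.
apply: (norm_Rintegral_kernel (k := fun z y => (BSkernel z y).1)) => [?|? ?].
  exact: measurable_BSkernel1r.
exact: norm_BSkernel1.
Qed.

Lemma push_velocity2_le z : `|(push_velocity z).2| <= 2 * speed.
Proof.
apply: (norm_Rintegral_kernel (k := fun z y => (BSkernel z y).2)) => [?|? ?].
  exact: measurable_BSkernel2r.
exact: norm_BSkernel2.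
Qed.

Section two_measures.
Context d' (X' : measurableType d') (nu : {finite_measure set X' -> \bar R}).
Variable Z' : X' -> R * R.
Hypothesis mZ' : measurable_fun setT Z'.

Lemma prod_integrable_BSkernel1 :
  (nu \x mu)%E.-integrable setT (EFin \o (fun p => (BSkernel (Z' p.1) (Z p.2)).1)).
Proof.
apply: (prod_integrable_kernel (k := fun z y => (BSkernel z y).1)) => [?|? ?|].
- exact: measurable_BSkernel1r.
- exact: norm_BSkernel1.
- exact: measurable_BSkernel1.
Qed.

Lemma prod_integrable_BSkernel2 :
  (nu \x mu)%E.-integrable setT (EFin \o (fun p => (BSkernel (Z' p.1) (Z p.2)).2)).
Proof.
apply: (prod_integrable_kernel (k := fun z y => (BSkernel z y).2)) => [?|? ?|].
- exact: measurable_BSkernel2r.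
- exact: norm_BSkernel2.
- exact: measurable_BSkernel2.
Qed.

Lemma integrable_push_velocity1 :
  nu.-integrable setT (EFin \o (fun x => (push_velocity (Z' x)).1)).
Proof.
apply: (integrable_section prod_integrable_BSkernel1) => x.
exact: (integrable_BSkernel1 (Z' x)).
Qed.

Lemma integrable_push_velocity2 :
  nu.-integrable setT (EFin \o (fun x => (push_velocity (Z' x)).2)).
Proof.
apply: (integrable_section prod_integrable_BSkernel2) => x.
exact: (integrable_BSkernel2 (Z' x)).
Qed.

End two_measures.
End snapshot.

(** * Pointwise interpolation of the logarithm *)

Section interpolation.
Context {R : realType}.

(** With $s=4z_2y_2/|z-y|^2$ the right side is a multiple of $z_2^2y_2^2/(|z-y|\,|z-\bar y|^3)$,
    whose singularity at $y=z$ is integrable. The proof writes $1+s=x^{16}$ and uses $\ln x\le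
    x-1$. *)
Lemma ln_pow4_le (s : R) : 0 <= s ->
  ln (1 + s) ^+ 4 <= 400 * s ^+ 2 / Num.sqrt (1 + s) ^+ 3.
Proof.
move=> s0; have s1 : 1 <= 1 + s by rewrite lerDl.
have sqrt_ge1 (x : R) : 1 <= x -> 1 <= Num.sqrt x.
  by move=> x1; rewrite -(sqrtr1 R) ler_wsqrtr.
pose x2 := Num.sqrt (1 + s); pose x4 := Num.sqrt x2; pose x8 := Num.sqrt x4.
pose x := Num.sqrt x8.
have h2 : 1 <= x2 by exact: sqrt_ge1.
have h4 : 1 <= x4 by exact: sqrt_ge1.
have h8 : 1 <= x8 by exact: sqrt_ge1.
have h : 1 <= x by exact: sqrt_ge1.
have x0 : 0 < x by exact: lt_le_trans h.
have E8 : x8 = x ^+ 2 by rewrite sqr_sqrtr// (le_trans ler01).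
have E4 : x4 = x ^+ 4 by rewrite -[LHS](@sqr_sqrtr _ x4) ?(le_trans ler01)// -/x8 E8 -exprM.
have E2 : x2 = x ^+ 8 by rewrite -[LHS](@sqr_sqrtr _ x2) ?(le_trans ler01)// -/x4 E4 -exprM.
have E1 : 1 + s = x ^+ 16.
  by rewrite -[LHS](@sqr_sqrtr _ (1 + s)) ?(le_trans ler01)// -/x2 E2 -exprM.
rewrite -/x2 E2 (_ : s = x ^+ 16 - 1); last by rewrite -E1; ring.
rewrite (_ : 1 + _ = x ^+ 16); last by ring.
rewrite lnXn//.
have ln0 : 0 <= ln x by exact: ln_ge0.
have lnx : ln x <= x - 1.
  have : ln (1 + (x - 1)) <= x - 1 by apply: le_ln1Dx; rewrite ltrBrDl subrr.
  by rewrite subrKC.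
rewrite ler_pdivlMr ?exprn_gt0//.
apply: (@le_trans _ _ (((x - 1) *+ 16) ^+ 4 * (x ^+ 8) ^+ 3)).
  rewrite ler_wpM2r ?exprn_ge0 ?(ltW x0)//.
  by rewrite lerXn2r ?nnegrE ?mulrn_wge0// ?lerMn2r// subr_ge0.
pose t := x - 1; have xE : x = 1 + t by rewrite /t; ring.
have t0 : 0 <= t by rewrite subr_ge0.
(* This is the square root of the goal, since $16^4=256^2$ and $400=20^2$. *)
have key : 256 * t ^+ 2 * x ^+ 12 <= 20 * (x ^+ 16 - 1).
  have x12 : 0 <= x ^+ 12 by rewrite exprn_ge0// ltW.
  have x11 : 1 <= x ^+ 12 by exact: exprn_ege1.
  have -> : x ^+ 16 - 1 = t * (1 + x + x ^+ 2 + x ^+ 3) * x ^+ 12 + (x ^+ 12 - 1).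
    by rewrite /t; ring.
  have h1 : 256 * t ^+ 2 <= 20 * (t * (1 + x + x ^+ 2 + x ^+ 3)).
    (* Completing the square in $80-136t+80t^2+20t^3$ shows that this cubic is non-negative for
       $t\ge0$; it is what makes the constant 20 sufficient. *)
    have -> : 20 * (t * (1 + x + x ^+ 2 + x ^+ 3)) =
        256 * t ^+ 2 + t * (80 * (1 - 17 / 20 * t) ^+ 2 + 111 / 5 * t ^+ 2 + 20 * t ^+ 3).
      by rewrite xE; field.
    rewrite lerDl; apply: mulr_ge0 => //.
    have := sqr_ge0 (1 - 17 / 20 * t); have := sqr_ge0 t; have := exprn_ge0 3 t0.
    by move: (_ ^+ 2) (_ ^+ 2) (_ ^+ 3) => A B C; lra.
  move: (1 + x + x ^+ 2 + x ^+ 3) h1 => S h1.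
  by have := ler_wpM2r x12 h1; lra.
have -> : (t *+ 16) ^+ 4 * (x ^+ 8) ^+ 3 = (256 * t ^+ 2 * x ^+ 12) ^+ 2 by ring.
have -> : 400 * (x ^+ 16 - 1) ^+ 2 = (20 * (x ^+ 16 - 1)) ^+ 2 by ring.
have A0 : 0 <= 256 * t ^+ 2 * x ^+ 12.
  exact: mulr_ge0 (mulr_ge0 (ler0n _ _) (sqr_ge0 t)) (exprn_ge0 _ (ltW x0)).
by rewrite [leLHS]expr2 [leRHS]expr2; exact: (ler_pM A0 A0 key key).
Qed.

(** Four-term AM-GM for $a,b,b,c$, obtained by pairing [a] with [c] and then their mean with [b]. *)
Lemma AMGM4 (l a b c : R) : 0 <= a -> 0 <= b -> 0 <= c ->
  l ^+ 4 <= a * b ^+ 2 * c -> 4 * l <= a + 2 * b + c.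
Proof.
move=> a0 b0 c0 lE.
have [l0|l0] := lerP l 0; first by nra.
have h1 : l ^+ 2 <= b * ((a + c) / 2).
  rewrite -ler_sqr ?nnegrE ?exprn_ge0 ?(ltW l0) ?mulr_ge0 ?addr_ge0//.
  rewrite -exprM (le_trans lE)//.
  have : a * c <= ((a + c) / 2) ^+ 2 by have := sqr_ge0 (a - c); nra.
  move=> ac; rewrite exprMn (_ : a * b ^+ 2 * c = b ^+ 2 * (a * c)); last by ring.
  by rewrite ler_wpM2l// sqr_ge0.
have h2 : b * ((a + c) / 2) <= ((a + c + 2 * b) / 4) ^+ 2.
  by have := sqr_ge0 (a + c - 2 * b); nra.
have h3 : l <= (a + c + 2 * b) / 4.
  by rewrite -ler_sqr ?nnegrE ?(ltW l0) ?(le_trans h1)//; nra.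
by nra.
Qed.

(** For [e > 0] and points of the half-plane this is $\ln(1+4z_2y_2/(|z-y|^2+e))$; as a difference,
    each logarithm can be differentiated separately. *)
Definition log_ratio (e : R) (z y : R * R) : R :=
  ln (sqnorm (z - reflect2 y) + e) - ln (sqnorm (z - y) + e).

Lemma log_ratio_le (e : R) (z y : R * R) : 0 < e -> 0 < z.2 -> 0 < y.2 ->
  0 < sqnorm (z - y) ->
  log_ratio e z y <= ln (1 + 4 * z.2 * y.2 / sqnorm (z - y)).
Proof.
move=> e0 z0 y0 q0.
rewrite /log_ratio sqnorm_reflectE; set q := sqnorm (z - y) in q0 *.
have k0 : 0 < 4 * z.2 * y.2 by rewrite !mulr_gt0.
set k := 4 * z.2 * y.2 in k0 *.
have qe : 0 < q + e by rewrite addr_gt0.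
have k3 : 0 < q + k + e by exact: addr_gt0 (addr_gt0 q0 k0) e0.
rewrite -ln_div ?posrE//.
have k1 : 0 < (q + k + e) / (q + e) by exact: divr_gt0.
have k2 : 0 < 1 + k / q by exact: addr_gt0 ltr01 (divr_gt0 k0 q0).
rewrite ler_ln ?posrE//.
have -> : (q + k + e) / (q + e) = 1 + k / (q + e) by field; rewrite gt_eqF.
rewrite lerD2l ler_pM2l// lef_pV2 ?posrE//.
by rewrite lerDl ltW.
Qed.

Lemma log_ratio_ge0 (e : R) (z y : R * R) : 0 < e -> 0 < z.2 -> 0 < y.2 ->
  0 <= log_ratio e z y.
Proof.
move=> e0 z0 y0; have q0 := sqnorm_ge0 (z - y).
rewrite subr_ge0 sqnorm_reflectE ler_ln ?posrE ?ltr_wpDl//.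
- by rewrite lerD2r lerDl !mulr_ge0// ltW.
- by rewrite addr_ge0// !mulr_ge0// ltW.
Qed.

Lemma quotient_le (Y P rq rD p a b c : R) :
  0 <= Y -> Y <= P -> 0 < rq -> 0 < rD -> 0 < p -> 0 < a -> 0 < b -> 0 < c ->
  a <= rq -> b <= rD -> c <= p ->
  Y / (rq * rD) <= P * p / (a * b * c).
Proof.
move=> Y0 YP q0 D0 p0 a0 b0 c0 aq bD cp.
rewrite ler_pdivrMr ?mulr_gt0// mulrAC ler_pdivlMr ?mulr_gt0//.
have -> : P * p * (rq * rD) = P * ((rq * rD) * p) by ring.
have ab0 : 0 <= a * b by rewrite mulr_ge0// ltW.
apply: ler_pM => //; first by rewrite mulr_ge0// ltW.
apply: ler_pM => //; first exact: ltW.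
by apply: ler_pM => //; exact: ltW.
Qed.

(** With $u,w$ the coordinates of $z-y$, the denominators left by [ln_pow4_le] are bounded below
    through $|z-y|\ge\sqrt{|u||w|}$, $|z-\bar y|\ge\max(z_2,|u|)$ and $z_2+y_2\ge\max(z_2,|w|)$, so
    that the singular factor separates in the two coordinates. The constant is
    $6400=400\cdot4^2$. *)
Lemma log_ratio_pow4_le (e : R) (z y : R * R) : 0 < e -> 0 < z.2 -> 0 < y.2 ->
  z.1 - y.1 != 0 -> z.2 - y.2 != 0 ->
  log_ratio e z y ^+ 4 <=
    ((z.2 + y.2) / sqnorm (z - reflect2 y)) * (z.2 + y.2) ^+ 2 *
    (6400 * z.2 ^+ 2 *
      (((Num.sqrt `|z.1 - y.1|)^-1 * (Num.max z.2 `|z.1 - y.1|)^-1) *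
       ((Num.sqrt `|z.2 - y.2|)^-1 * (Num.max z.2 `|z.2 - y.2|)^-1))).
Proof.
move=> e0 z0 y0 u0 w0.
set u := z.1 - y.1 in u0 *; set w := z.2 - y.2 in w0 *.
have q0 : 0 < sqnorm (z - y).
  by rewrite /sqnorm/= -/u -/w ltr_pwDl ?sqr_ge0// exprn_even_gt0.
apply: (@le_trans _ _ (ln (1 + 4 * z.2 * y.2 / sqnorm (z - y)) ^+ 4)).
  rewrite lerXn2r ?nnegrE ?log_ratio_ge0 ?log_ratio_le//.
  by apply: le_trans (log_ratio_le e0 z0 y0 q0); exact: log_ratio_ge0.
set s := 4 * z.2 * y.2 / _.
have s0 : 0 <= s by rewrite divr_ge0 ?(ltW q0)// !mulr_ge0// ltW.
apply: (le_trans (ln_pow4_le s0)).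
set q := sqnorm (z - y) in q0 s s0 *.
set D := sqnorm (z - reflect2 y).
have DE : D = q * (1 + s) by rewrite /D sqnorm_reflectE /s -/q; field; rewrite gt_eqF.
have D0 : 0 < D by rewrite DE mulr_gt0// ltr_pwDl.
have sE : Num.sqrt (1 + s) = Num.sqrt D / Num.sqrt q.
  by rewrite -sqrtrV ?(ltW q0)// -sqrtrM ?(ltW D0)// DE; congr Num.sqrt; field; rewrite gt_eqF.
set p := z.2 + y.2.
have p0 : 0 < p by rewrite addr_gt0.
set rq := Num.sqrt q in sE *; set rD := Num.sqrt D in sE *.
have rq0 : 0 < rq by rewrite sqrtr_gt0.
have rD0 : 0 < rD by rewrite sqrtr_gt0.
have qE : q = rq ^+ 2 by rewrite sqr_sqrtr// ltW.
have DE2 : D = rD ^+ 2 by rewrite sqr_sqrtr// ltW.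
set a1 := Num.sqrt `|u|; set a2 := Num.sqrt `|w|.
set b1 := Num.max z.2 `|u|; set b2 := Num.max z.2 `|w|.
have a10 : 0 < a1 by rewrite sqrtr_gt0 normr_gt0.
have a20 : 0 < a2 by rewrite sqrtr_gt0 normr_gt0.
have b10 : 0 < b1 by rewrite lt_max z0.
have b20 : 0 < b2 by rewrite lt_max z0.
have ha : a1 * a2 <= rq.
  rewrite /a1 /a2 /rq -sqrtrM// ler_wsqrtr// /q /sqnorm/= -/u -/w.
  rewrite -(real_normK (num_real u)) -(real_normK (num_real w)).
  move: (normr_ge0 u) (normr_ge0 w).
  by move: `|u| `|w| => a b ? ?; nra.
have hb1 : b1 <= rD.
  rewrite ge_max; apply/andP; split; rewrite -[leLHS]ger0_norm ?(ltW z0)// -sqrtr_sqr.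
    apply: ler_wsqrtr; rewrite /D /sqnorm/= opprK -/u.
    by have := sqr_ge0 u; nra.
  apply: ler_wsqrtr; rewrite real_normK ?num_real//.
  by rewrite /D /sqnorm/= -/u lerDl sqr_ge0.
have hb2 : b2 <= p.
  rewrite ge_max /p lerDl (ltW y0)/= ler_norml /w; apply/andP; split; lra.
have yp : y.2 ^+ 2 <= p ^+ 2 by rewrite lerXn2r ?nnegrE ?(ltW y0) ?(ltW p0)// lerDr ltW.
have -> : 400 * s ^+ 2 / Num.sqrt (1 + s) ^+ 3 =
    6400 * z.2 ^+ 2 / D * (y.2 ^+ 2 / (rq * rD)).
  rewrite sE /s -/q qE DE2; field.
  by rewrite !gt_eqF.
have -> : p / D * p ^+ 2 * (6400 * z.2 ^+ 2 * (a1^-1 * b1^-1 * (a2^-1 * b2^-1))) =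
    6400 * z.2 ^+ 2 / D * (p ^+ 2 * p / ((a1 * a2) * b1 * b2)).
  by field; rewrite !gt_eqF.
apply: ler_wpM2l; last first.
  by apply: quotient_le ha hb1 hb2; rewrite ?sqr_ge0// mulr_gt0.
exact: divr_ge0 (mulr_ge0 (ler0n _ _) (sqr_ge0 _)) (ltW D0).
Qed.

(** AM-GM turns the product of the three factors into a sum, so that they can be integrated one by
    one. The weights stay free until the optimization in [mirror_energy_ge]. *)
Lemma log_ratio_interpolation (e al be ga : R) (z y : R * R) :
  0 < e -> 0 < z.2 -> 0 < y.2 -> 0 < al -> 0 < be -> 0 < ga ->
  al * be ^+ 2 * ga = 1 ->
  ((4 * log_ratio e z y)%:E <=
    (al * ((z.2 + y.2) / sqnorm (z - reflect2 y)) + 2 * (be * (z.2 + y.2)))%:E +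
    (ga * (6400 * z.2 ^+ 2))%:E *
      (isqrt_decay z.2 (y - z)%R.1 * isqrt_decay z.2 (y - z)%R.2))%E.
Proof.
move=> e0 z0 y0 al0 be0 ga0 abc.
have := log_ratio_pow4_le e0 z0 y0.
have : 0 < 6400 :> R by rewrite ltr0n.
move: (6400 : R) => k k6 pow4.
have k0 : 0 < ga * (k * z.2 ^+ 2) by rewrite mulr_gt0// mulr_gt0// exprn_gt0.
have decay_gt0 u : (0 < isqrt_decay z.2 u)%E.
  by rewrite /isqrt_decay mule_gt0 ?isqrt_gt0// lte_fin invr_gt0 lt_max z0.
(* On the two lines through [z] parallel to the axes, one [isqrt] is [+oo] and the factors
   multiplying it are positive, so the right side is [+oo]. *)
have [u0|u0] := eqVneq (z.1 - y.1) 0.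
  rewrite {1}/isqrt_decay {1}/isqrt /= -oppr_eq0 opprB u0 eqxx.
  by rewrite gt0_mulye ?lte_fin ?invr_gt0 ?lt_max ?z0// gt0_mulye// gt0_muley ?lte_fin// leey.
have [w0|w0] := eqVneq (z.2 - y.2) 0.
  rewrite {2}/isqrt_decay {1}/isqrt /= -oppr_eq0 opprB w0 eqxx.
  by rewrite gt0_mulye ?lte_fin ?invr_gt0 ?lt_max ?z0// gt0_muley// gt0_muley ?lte_fin// leey.
rewrite /isqrt_decay /isqrt /= -[y.1 - z.1 == 0]oppr_eq0 -[y.2 - z.2 == 0]oppr_eq0 !opprB (negbTE u0) (negbTE w0).
rewrite -!EFinM -EFinD lee_fin !(distrC y.1) !(distrC y.2).
have q0 : 0 < sqnorm (z - reflect2 y).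
  by rewrite sqnorm_reflectE ltr_wpDl ?sqnorm_ge0// !mulr_gt0.
have m0 (x : R) : 0 <= Num.max z.2 x by rewrite le_max ltW.
have p0 : 0 <= z.2 + y.2 by exact: addr_ge0 (ltW z0) (ltW y0).
apply: AMGM4.
- exact: mulr_ge0 (ltW al0) (divr_ge0 p0 (ltW q0)).
- exact: mulr_ge0 (ltW be0) p0.
- apply: mulr_ge0; first exact: ltW.
  by rewrite !mulr_ge0 ?invr_ge0 ?sqrtr_ge0.
apply: (le_trans (pow4 u0 w0)).
rewrite -[leLHS]mul1r -abc le_eqVlt; apply/orP; left; apply/eqP.
by ring.
Qed.

End interpolation.

(** * Symmetrization of the kernel *)

Section snapshot_identities.
Context {R : realType} d (X : measurableType d).
Variables (mu : {finite_measure set X -> \bar R}) (Z : X -> R * R) (M : R).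
Hypotheses (mZ : measurable_fun setT Z) (M0 : 0 <= M) (ZM : density_le mu Z M)
  (Z2 : forall x, 0 < (Z x).2).
Let m := fine (mu setT).
Notation vel x := (push_velocity mu Z (Z x)).
Notation speed := (speed mu M).

Definition mirror_interaction (z y : R * R) : R :=
  (z.2 + y.2) / sqnorm (z - reflect2 y).

Lemma norm_mirror_interaction z y : `|mirror_interaction z y| <= inv_norm (y - reflect2 z).
Proof.
rewrite /inv_norm (sqnorm_reflect y z); apply: norm_div_le.
by have := sqr2_le_sqnorm (z - reflect2 y); rewrite /= opprK.
Qed.

Lemma measurable_mirror_interaction d' (X' : measurableType d') (Z' : X' -> R * R) :
  measurable_fun setT Z' ->
  measurable_fun setT (fun p : X' * X => mirror_interaction (Z' p.1) (Z p.2)).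
Proof.
by move=> mZ'; apply: measurable_quot; [exact: measurable_sy|exact: measurable_qp].
Qed.

Let measurable_diag : measurable_fun setT (fun y : X => (y, y)).
Proof. exact: measurable_fun_pair. Qed.

Lemma integrable_mirror_interaction z :
  mu.-integrable setT (EFin \o (fun y => mirror_interaction z (Z y))).
Proof.
apply: (@dominated_integrable _ _ _ _ _ (fun y => inv_norm (Z y - reflect2 z))).
- exact: (measurableT_comp (measurable_mirror_interaction (Z' := cst z) (measurable_cst _)) measurable_diag).
- by move=> y; exact: norm_mirror_interaction.
- exact: integrable_inv_norm mZ M0 ZM _.
Qed.

(** The direct interaction is antisymmetric and cancels; only that with the image survives. *)
Lemma BSkernel1_sym (z y : R * R) : (BSkernel z y).1 + (BSkernel y z).1 =
  2 * ((2 * pi)^-1 * mirror_interaction z y).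
Proof.
rewrite !BSkernel1E (sqnorm_reflect y z) (sqnormC y z) /mirror_interaction.
by ring.
Qed.

Lemma BSkernel2_antisym (z y : R * R) : (BSkernel z y).2 = - (BSkernel y z).2.
Proof. by rewrite !BSkernel2E (sqnorm_reflect y z) (sqnormC y z); ring. Qed.

(** The density bounds control the second argument of the kernel; symmetrization carries them over
    to the first. *)
Lemma integrable_BSkernel1l z :
  mu.-integrable setT (EFin \o (fun x => (BSkernel (Z x) z).1)).
Proof.
have -> : (fun x => (BSkernel (Z x) z).1) =
    (fun x => 2 * ((2 * pi)^-1 * mirror_interaction z (Z x)) - (BSkernel z (Z x)).1).
  by apply/funext => x; rewrite -BSkernel1_sym; ring.
apply: integrable_EFinB; last exact: (integrable_BSkernel1 mZ M0 ZM z).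
do 2 apply: integrable_EFinZ; exact: integrable_mirror_interaction.
Qed.

Lemma integrable_BSkernel2l z :
  mu.-integrable setT (EFin \o (fun x => (BSkernel (Z x) z).2)).
Proof.
have -> : (fun x => (BSkernel (Z x) z).2) = (fun x => - (BSkernel z (Z x)).2).
  by apply/funext => x; rewrite BSkernel2_antisym.
by apply: integrable_EFinN; exact: (integrable_BSkernel2 mZ M0 ZM z).
Qed.

(** Exchanging the two integrations changes the sign of the kernel, so the integral equals its own
    opposite. *)
Lemma Rintegral_velocity2 : \int[mu]_x (vel x).2 = 0.
Proof.
have i2 := prod_integrable_BSkernel2 mZ M0 ZM mu mZ.
have E : \int[mu]_x (vel x).2 = - \int[mu]_x (vel x).2.
  rewrite [LHS](Rintegral_swap i2); last 2 first.
  - by move=> x; exact: (integrable_BSkernel2 mZ M0 ZM (Z x)).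
  - by move=> y; exact: (integrable_BSkernel2l (Z y)).
  rewrite -mulN1r -RintegralZl//; last exact: (integrable_push_velocity2 mZ M0 ZM mu mZ).
  apply: eq_Rintegral => y _; rewrite -RintegralZl//; last first.
    exact: (integrable_BSkernel2 mZ M0 ZM (Z y)).
  by apply: eq_Rintegral => x _; rewrite [LHS]BSkernel2_antisym mulN1r.
by lra.
Qed.

Definition mirror_energy : R :=
  \int[mu]_x \int[mu]_y mirror_interaction (Z x) (Z y).

Let pi_cancel1 (p a : R) : p != 0 -> a = p * (2 * ((2 * p)^-1 * a)).
Proof. by move=> p0; field. Qed.

Let pi_cancel2 (p a : R) : p != 0 -> a = (2 * p)^-1 * (p * (a + a)).
Proof. by move=> p0; field. Qed.

Let pi_neq0 : pi != 0 :> R.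
Proof. by rewrite gt_eqF// pi_gt0. Qed.

Lemma Rintegral_mirror_interaction x :
  \int[mu]_y mirror_interaction (Z x) (Z y) =
    pi * ((vel x).1 + \int[mu]_y (BSkernel (Z y) (Z x)).1).
Proof.
have ix := integrable_BSkernel1 mZ M0 ZM (Z x).
have iy := integrable_BSkernel1l (Z x).
rewrite -(RintegralD measurableT ix iy).
rewrite -(RintegralZl _ measurableT (integrable_EFinD ix iy)).
apply: eq_Rintegral => y _; rewrite BSkernel1_sym.
exact: (pi_cancel1 _ pi_neq0).
Qed.

Lemma integrable_BSkernel1_swap (nu : {finite_measure set X -> \bar R}) :
  nu.-integrable setT (EFin \o (fun x => \int[mu]_y (BSkernel (Z y) (Z x)).1)).
Proof.
have -> : (fun x => \int[mu]_y (BSkernel (Z y) (Z x)).1) =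
    (fun x => pi^-1 * \int[mu]_y mirror_interaction (Z x) (Z y) - (vel x).1).
  by apply/funext => x; rewrite Rintegral_mirror_interaction (mulKf pi_neq0) addrAC subrr add0r.
apply: integrable_EFinB; last exact: (integrable_push_velocity1 mZ M0 ZM nu mZ).
apply: integrable_EFinZ.
apply: (integrable_section (f := fun p => mirror_interaction (Z p.1) (Z p.2))); last first.
  by move=> x; exact: (integrable_mirror_interaction (Z x)).
apply: (@prod_integrable _ _ _ _ _ nu mu _ speed).
  exact: measurable_mirror_interaction.
move=> x; apply: le_trans (integral_inv_norm_le mZ M0 ZM (reflect2 (Z x))).
apply: ge0_le_integral; first exact: measurableT.
- by move=> y _; rewrite lee_fin normr_ge0.
- apply/measurable_EFinP; apply: (measurableT_comp (@normr_measurable _ setT)).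
  exact: (integrable_EFin_measurable (integrable_mirror_interaction (Z x))).
- by apply/measurable_EFinP; exact: measurable_inv_norm_shift.
- by move=> y _; rewrite lee_fin; exact: norm_mirror_interaction.
Qed.

Lemma Rintegral_velocity1 : \int[mu]_x (vel x).1 = (2 * pi)^-1 * mirror_energy.
Proof.
have i1 := prod_integrable_BSkernel1 mZ M0 ZM mu mZ.
have E : \int[mu]_x (vel x).1 = \int[mu]_x \int[mu]_y (BSkernel (Z y) (Z x)).1.
  rewrite [LHS](Rintegral_swap i1)//.
  - by move=> x; exact: (integrable_BSkernel1 mZ M0 ZM (Z x)).
  - by move=> y; exact: (integrable_BSkernel1l (Z y)).
have iv := integrable_push_velocity1 mZ M0 ZM mu mZ.
have iw := integrable_BSkernel1_swap mu.
rewrite /mirror_energy; under [in RHS]eq_Rintegral do rewrite Rintegral_mirror_interaction.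
rewrite (RintegralZl _ measurableT (integrable_EFinD iv iw)).
rewrite (RintegralD measurableT iv iw) -E.
exact: (pi_cancel2 _ pi_neq0).
Qed.

Lemma mirror_energy_ge0 : 0 <= mirror_energy.
Proof.
apply: Rintegral_ge0 => x _; apply: Rintegral_ge0 => y _.
by rewrite divr_ge0 ?sqnorm_ge0// addr_ge0// ltW.
Qed.

End snapshot_identities.

(** * Drift of the sparse part *)

Section sparse.
Context {R : realType} d (X : measurableType d).
Variables (mu nu : {finite_measure set X -> \bar R}) (Z : X -> R * R) (M N : R).
Hypotheses (mZ : measurable_fun setT Z) (M0 : 0 <= M) (ZM : density_le mu Z M)
  (N0 : 0 <= N) (ZN : density_le nu Z N) (Z2 : forall x, 0 < (Z x).2).
Let m := fine (mu setT).
Let n := fine (nu setT).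

(** Testing with the constant 1 gives $n\le0\cdot(+\infty)=0$. *)
Lemma density_le0_mass : N = 0 -> n = 0.
Proof.
move=> NE; have := ZN (g := cst 1%E) (measurable_cst _) (fun _ => lee01).
rewrite NE mul0e integral_cst// mul1e => h.
by rewrite /n (_ : nu setT = 0%E)//; apply/eqP; rewrite eq_le h measure_ge0.
Qed.

(** By [BSkernel1_le] only half of each singularity pushes to the right. The image and the direct
    term cost the same, and this factor 2 cancels against the prefactor $1/(2\pi)$. *)
Lemma Rintegral_BSkernel1_le (r : R) (y : X) : 0 < r ->
  \int[nu]_x (BSkernel (Z x) (Z y)).1 <= pi^-1 * (8 * N * r + n / r).
Proof.
move=> r0; have p0 := pi_gt0 R.
pose ku x := (if 0 < (Z x - reflect2 (Z y)).2 then inv_norm (Z x - reflect2 (Z y)) else 0).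
pose kl x := (if (Z x - Z y).2 < 0 then inv_norm (Z x - Z y) else 0).
have mshift c : measurable_fun setT (fun x => (Z x - c).2).
  by apply: measurable_funB => //; exact: measurable_Z2.
have mku : measurable_fun setT ku.
  apply: measurable_fun_ifT => //; last exact: measurable_inv_norm_shift.
  exact: measurable_fun_ltr.
have mkl : measurable_fun setT kl.
  apply: measurable_fun_ifT => //; last exact: measurable_inv_norm_shift.
  exact: measurable_fun_ltr.
have ku0 x : 0 <= ku x by rewrite /ku; case: ifP => // _; exact: inv_norm_ge0.
have kl0 x : 0 <= kl x by rewrite /kl; case: ifP => // _; exact: inv_norm_ge0.
have hu := density_inv_norm_upper mZ N0 ZN (reflect2 (Z y)) r0.
have hl := density_inv_norm_lower mZ N0 ZN (Z y) r0.
have iu : nu.-integrable setT (EFin \o ku) by exact: ge0_integrable_EFin mku ku0 hu.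
have il : nu.-integrable setT (EFin \o kl) by exact: ge0_integrable_EFin mkl kl0 hl.
apply: (@le_trans _ _ (\int[nu]_x ((2 * pi)^-1 * (ku x + kl x)))).
  apply: le_Rintegral => //.
  - exact: (integrable_BSkernel1l mZ N0 ZN (Z y)).
  - by apply: integrable_EFinZ; exact: integrable_EFinD.
  - by move=> x _; exact: BSkernel1_le.
rewrite RintegralZl//; last exact: integrable_EFinD.
rewrite RintegralD//.
have h : \int[nu]_x ku x + \int[nu]_x kl x <= 2 * (8 * N * r + n / r).
  by rewrite mulr_natl mulr2n; apply: lerD; exact: ge0_Rintegral_le.
rewrite invfM [2^-1 * _]mulrC -[leLHS]mulrA; apply: ler_wpM2l.
  by rewrite invr_ge0 ltW.
by rewrite ler_pdivrMl.
Qed.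

(** The sparse part is integrated first, against the velocity due to a single point of [mu], so that
    its small density [N] controls the singularity instead of [M]. It is applied with $Q=C_0/(2m)$,
    which turns the right side into $C_0n$. *)
Lemma sparse_velocity_le (Q : R) : 0 <= Q -> 0 < n -> N <= Q ^+ 2 * n ->
  \int[nu]_x (push_velocity mu Z (Z x)).1 <= m * (2 * Q * n).
Proof.
move=> Q0 n0 NQ.
have Qp : 0 < Q.
  rewrite lt0r Q0 andbT; apply: contraTneq n0 => Q00.
  by rewrite density_le0_mass ?ltxx//; apply/eqP; rewrite eq_le N0 andbT (le_trans NQ)// Q00 expr0n mul0r.
have p0 := pi_gt0 R.
have s80 : 0 < Num.sqrt 8 :> R by rewrite sqrtr_gt0.
have s8E : Num.sqrt 8 ^+ 2 = 8 :> R by rewrite sqr_sqrtr.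
rewrite (Rintegral_swap (prod_integrable_BSkernel1 mZ M0 ZM nu mZ)); last 2 first.
- by move=> x; exact: (integrable_BSkernel1 mZ M0 ZM (Z x)).
- by move=> y; exact: (integrable_BSkernel1l mZ N0 ZN (Z y)).
(* This radius minimizes $8Nr+n/r$ when $N=Q^2n$. The minimum is $2\sqrt8\,Qn$, and $\sqrt8$ is
   absorbed by $\pi$. *)
have r0 : 0 < (Num.sqrt 8 * Q)^-1 by rewrite invr_gt0 mulr_gt0.
have bound y : \int[nu]_x (BSkernel (Z x) (Z y)).1 <= 2 * Q * n.
  apply: (le_trans (Rintegral_BSkernel1_le y r0)).
  rewrite invrK; apply: (@le_trans _ _ (pi^-1 * (2 * Num.sqrt 8 * Q * n))).
    rewrite ler_wpM2l ?invr_ge0 ?(ltW p0)//.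
    have : 8 * N / (Num.sqrt 8 * Q) <= Num.sqrt 8 * Q * n.
      rewrite ler_pdivrMr ?mulr_gt0// -{1}s8E.
      rewrite [leRHS](_ : _ = Num.sqrt 8 ^+ 2 * (Q ^+ 2 * n)); last by ring.
      by rewrite ler_wpM2l// sqr_ge0.
    by lra.
  rewrite mulrC ler_pdivrMr// [leLHS](_ : _ = (2 * Q * n) * Num.sqrt 8); last by ring.
  by rewrite ler_wpM2l ?pi_ge_sqrt8// !mulr_ge0// ltW.
have := @le_Rintegral _ _ _ mu setT (fun y => \int[nu]_x (BSkernel (Z x) (Z y)).1)
  (fun=> 2 * Q * n) measurableT.
rewrite Rintegral_cst// -/m [X in _ -> _ -> _ -> _ <= X]mulrC; apply => //.
- exact: (integrable_BSkernel1_swap mZ N0 ZN mu).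
- exact: (finite_measure_integrable_cst _ _ measurableT).
Qed.

End sparse.

(** * Regularized kernels and their distance to the Biot-Savart kernel *)

Section regularized_kernels.
Context {R : realType}.
Implicit Types z y : R * R.

(** [2 * reg1] and [2 * reg2] are the partial derivatives of [log_ratio e] in the coordinates of
    [z]. As [e] tends to 0, the pair [(reg1, reg2)] tends to $2\pi K(z,y)^\perp$ off the
    diagonal. *)
Definition reg1 (e : R) z y : R :=
  (z.1 - y.1) / (sqnorm (z - reflect2 y) + e) - (z.1 - y.1) / (sqnorm (z - y) + e).

Definition reg2 (e : R) z y : R :=
  (z.2 + y.2) / (sqnorm (z - reflect2 y) + e) - (z.2 - y.2) / (sqnorm (z - y) + e).

Lemma reg1_defect (e : R) z y : 0 < e ->
  `|reg1 e z y + 2 * pi * (BSkernel z y).2| <=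
  inv_norm_defect e (y - reflect2 z) + inv_norm_defect e (y - z).
Proof.
move=> e0; have p0 : pi != 0 :> R by rewrite gt_eqF// pi_gt0.
rewrite BSkernel2E mulVKf ?mulf_neq0// /reg1.
set a := z.1 - y.1; rewrite /inv_norm_defect (sqnorm_reflect y z) (sqnormC y z).
set qp := sqnorm (z - reflect2 y); set qm := sqnorm (z - y).
have -> : a / (qp + e) - a / (qm + e) + (a / qm - a / qp) =
  (a / (qp + e) - a / qp) - (a / (qm + e) - a / qm) by ring.
apply: (le_trans (ler_normB _ _)); apply: lerD; apply: norm_div_defect => //.
- exact: (sqr1_le_sqnorm (z - reflect2 y)).
- exact: (sqr1_le_sqnorm (z - y)).
Qed.

Lemma reg2_defect (e : R) z y : 0 < e ->
  `|reg2 e z y - 2 * pi * (BSkernel z y).1| <=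
  inv_norm_defect e (y - reflect2 z) + inv_norm_defect e (y - z).
Proof.
move=> e0; have p0 : pi != 0 :> R by rewrite gt_eqF// pi_gt0.
rewrite BSkernel1E mulVKf ?mulf_neq0// /reg2.
rewrite /inv_norm_defect (sqnorm_reflect y z) (sqnormC y z).
have hp : (z.2 + y.2) ^+ 2 <= sqnorm (z - reflect2 y).
  by have := sqr2_le_sqnorm (z - reflect2 y); rewrite /= opprK.
have hm := sqr2_le_sqnorm (z - y); rewrite /= in hm.
set qp := sqnorm (z - reflect2 y) in hp *; set qm := sqnorm (z - y) in hm *.
set a := z.2 + y.2 in hp *; set b := z.2 - y.2 in hm *.
have -> : a / (qp + e) - b / (qm + e) - (a / qp - b / qm) =
  (a / (qp + e) - a / qp) - (b / (qm + e) - b / qm) by ring.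
by apply: (le_trans (ler_normB _ _)); apply: lerD; exact: norm_div_defect.
Qed.

Lemma norm_reg1 (e : R) z y : 0 < e <= 1 -> `|reg1 e z y| <= 2 / e.
Proof.
move=> e01; have -> : 2 / e = e^-1 + e^-1 by ring.
apply: (le_trans (ler_normB _ _)); apply: lerD; apply: norm_div_reg => //.
- exact: (sqr1_le_sqnorm (z - reflect2 y)).
- exact: (sqr1_le_sqnorm (z - y)).
Qed.

Lemma norm_reg2 (e : R) z y : 0 < e <= 1 -> `|reg2 e z y| <= 2 / e.
Proof.
move=> e01; have -> : 2 / e = e^-1 + e^-1 by ring.
apply: (le_trans (ler_normB _ _)); apply: lerD; apply: norm_div_reg => //.
- by have := sqr2_le_sqnorm (z - reflect2 y); rewrite /= opprK.
- exact: (sqr2_le_sqnorm (z - y)).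
Qed.

(** A crude bound, serving integrability at fixed [e]: $\ln x\le x-1$ for the first logarithm and
    monotonicity for the second. *)
Lemma log_ratio_le_bound (e B : R) z y : 0 < e -> 0 < z.2 -> 0 < y.2 ->
  `|z.1| <= B -> `|z.2| <= B -> `|y.1| <= B -> `|y.2| <= B ->
  `|log_ratio e z y| <= 8 * B ^+ 2 + e - ln e.
Proof.
move=> e0 z0 y0 z1B z2B y1B y2B.
rewrite ger0_norm ?log_ratio_ge0// /log_ratio.
have qm0 := sqnorm_ge0 (z - y); have qp0 := sqnorm_ge0 (z - reflect2 y).
have qpB : sqnorm (z - reflect2 y) <= 8 * B ^+ 2.
  move: z1B z2B y1B y2B; rewrite !ler_norml /sqnorm/= opprK.
  move=> /andP[? ?] /andP[? ?] /andP[? ?] /andP[? ?].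
  have B0 : 0 <= B by lra.
  have -> : 8 * B ^+ 2 = (2 * B) ^+ 2 + (2 * B) ^+ 2 by ring.
  have sq (a : R) : - (2 * B) <= a -> a <= 2 * B -> a ^+ 2 <= (2 * B) ^+ 2.
    by move=> ? ?; nra.
  by apply: lerD; apply: sq; lra.
have h1 : ln (sqnorm (z - reflect2 y) + e) <= 8 * B ^+ 2 + e.
  have x0 : 0 < sqnorm (z - reflect2 y) + e by rewrite ltr_wpDl.
  have : ln (1 + (sqnorm (z - reflect2 y) + e - 1)) <= sqnorm (z - reflect2 y) + e - 1.
    by apply: le_ln1Dx; lra.
  by rewrite subrKC; lra.
have h2 : ln e <= ln (sqnorm (z - y) + e).
  by rewrite ler_ln ?posrE ?ltr_wpDl// lerDr.
by lra.
Qed.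

End regularized_kernels.

(** * The regularized energy at a fixed time *)

Section energy_snapshot.
Context {R : realType} d (X : measurableType d).
Variables (mu : {finite_measure set X -> \bar R}) (Z : X -> R * R) (M : R).
Hypotheses (mZ : measurable_fun setT Z) (M0 : 0 <= M) (ZM : density_le mu Z M)
  (Z2 : forall x, 0 < (Z x).2).
Let m := fine (mu setT).
Notation vel x := (push_velocity mu Z (Z x)).
Notation speed := (speed mu M).

Let measurable_diag : measurable_fun setT (fun y : X => (y, y)).
Proof. exact: measurable_fun_pair. Qed.

Let section_measurable (k : R * R -> R * R -> R) :
  (forall Z' : X -> R * R, measurable_fun setT Z' ->
    measurable_fun setT (fun p : X * X => k (Z' p.1) (Z p.2))) ->
  forall z, measurable_fun setT (fun y => k z (Z y)).
Proof.
by move=> h z; exact: (measurableT_comp (h (cst z) (measurable_cst _)) measurable_diag).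
Qed.

Section regularization.
Variable e : R.
Hypothesis e01 : 0 < e <= 1.

Let e0 : 0 < e. Proof. by case/andP: e01. Qed.

Lemma measurable_reg1 (Z' : X -> R * R) : measurable_fun setT Z' ->
  measurable_fun setT (fun p : X * X => reg1 e (Z' p.1) (Z p.2)).
Proof.
move=> mZ'; apply: measurable_funB; apply: measurable_quot.
- exact: measurable_dx.
- by apply: measurable_funD => //; exact: measurable_qp.
- exact: measurable_dx.
- by apply: measurable_funD => //; exact: measurable_qm.
Qed.

Lemma measurable_reg2 (Z' : X -> R * R) : measurable_fun setT Z' ->
  measurable_fun setT (fun p : X * X => reg2 e (Z' p.1) (Z p.2)).
Proof.
move=> mZ'; apply: measurable_funB; apply: measurable_quot.
- exact: measurable_sy.
- by apply: measurable_funD => //; exact: measurable_qp.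
- exact: measurable_dy.
- by apply: measurable_funD => //; exact: measurable_qm.
Qed.

Let i1 z : mu.-integrable setT (EFin \o (fun y => reg1 e z (Z y))).
Proof.
apply: (@bounded_integrable _ _ _ _ _ (2 / e)) => [|y]; last exact: norm_reg1.
exact: (section_measurable measurable_reg1).
Qed.

Let i2 z : mu.-integrable setT (EFin \o (fun y => reg2 e z (Z y))).
Proof.
apply: (@bounded_integrable _ _ _ _ _ (2 / e)) => [|y]; last exact: norm_reg2.
exact: (section_measurable measurable_reg2).
Qed.

Let defect_int c r : 0 < r ->
  mu.-integrable setT (EFin \o (fun y => inv_norm_defect e (Z y - c))) /\
  \int[mu]_y inv_norm_defect e (Z y - c) <= 16 * M * r + m * (e / r ^+ 3).
Proof.
move=> r0; have h := density_inv_norm_defect mZ M0 ZM c e0 r0.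
have d0 y : 0 <= inv_norm_defect e (Z y - c) by exact: inv_norm_defect_ge0.
split; last exact: ge0_Rintegral_le.
apply: ge0_integrable_EFin h => //.
have -> : (fun y => inv_norm_defect e (Z y - c)) =
    (fun y => inv_norm (Z y - c) * (e / (sqnorm (Z y - c) + e))).
  by apply/funext => y; rewrite inv_norm_defectE.
apply: measurable_funM; first exact: measurable_inv_norm_shift.
apply: measurable_quot => //; apply: measurable_funD => //.
apply: (measurableT_comp measurable_sqnorm).
by apply/measurable_fun_pair; apply: measurable_funB => //;
  [exact: measurable_Z1|exact: measurable_Z2].
Qed.

(** The bound of [density_inv_norm_defect], with the radius [r] still free. *)
Definition defect_mass (r : R) : R := 16 * M * r + m * (e / r ^+ 3).

Let kernel_defect (f k : X -> R) (c r : R) z : 0 < r ->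
  mu.-integrable setT (EFin \o f) -> mu.-integrable setT (EFin \o k) ->
  (forall y, `|f y + c * k y| <=
     inv_norm_defect e (Z y - reflect2 z) + inv_norm_defect e (Z y - z)) ->
  `|\int[mu]_y f y + c * \int[mu]_y k y| <= 2 * defect_mass r.
Proof.
move=> r0 fi ki h.
have ick := integrable_EFinZ c ki; have ifk := integrable_EFinD fi ick.
rewrite -(RintegralZl _ measurableT ki) -(RintegralD measurableT fi ick).
apply: (le_trans (le_normr_Rintegral measurableT ifk)).
have [d1 l1] := defect_int (reflect2 z) r0; have [d2 l2] := defect_int z r0.
have -> : 2 * defect_mass r = defect_mass r + defect_mass r by ring.
apply: le_trans (lerD l1 l2); rewrite -(RintegralD measurableT d1 d2).
apply: le_Rintegral => //; first exact: (integrable_abse ifk).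
exact: integrable_EFinD.
Qed.

Lemma Rintegral_reg1 r z : 0 < r ->
  `|\int[mu]_y reg1 e z (Z y) + 2 * pi * (push_velocity mu Z z).2| <= 2 * defect_mass r.
Proof.
move=> r0; apply: (@kernel_defect _ (fun y => (BSkernel z (Z y)).2) _ _ z r0 (i1 z)).
  exact: (integrable_BSkernel2 mZ M0 ZM z).
by move=> y; exact: reg1_defect.
Qed.

Lemma Rintegral_reg2 r z : 0 < r ->
  `|\int[mu]_y reg2 e z (Z y) - 2 * pi * (push_velocity mu Z z).1| <= 2 * defect_mass r.
Proof.
move=> r0; rewrite -mulNr.
apply: (@kernel_defect _ (fun y => (BSkernel z (Z y)).1) _ _ z r0 (i2 z)).
  exact: (integrable_BSkernel1 mZ M0 ZM z).
by move=> y; rewrite mulNr; exact: reg2_defect.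
Qed.

(** The share of the first point of the pair in the time derivative of [log_ratio e]; the second
    point contributes the same expression with the pair swapped. *)
Definition half_rate (p : X * X) : R :=
  2 * ((vel p.1).1 * reg1 e (Z p.1) (Z p.2) + (vel p.1).2 * reg2 e (Z p.1) (Z p.2)).

Lemma measurable_half_rate : measurable_fun setT half_rate.
Proof.
apply: measurable_funM => //; apply: measurable_funD; apply: measurable_funM.
- exact: (measurableT_comp
    (integrable_EFin_measurable (integrable_push_velocity1 mZ M0 ZM mu mZ)) measurable_fst).
- exact: measurable_reg1.
- exact: (measurableT_comp
    (integrable_EFin_measurable (integrable_push_velocity2 mZ M0 ZM mu mZ)) measurable_fst).
- exact: measurable_reg2.
Qed.

Lemma norm_half_rate p : `|half_rate p| <= 16 * speed / e.
Proof.
have s0 : 0 <= speed by exact: speed_ge0.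
have v1 := push_velocity1_le mZ M0 ZM (Z p.1).
have v2 := push_velocity2_le mZ M0 ZM (Z p.1).
have r1 := norm_reg1 (Z p.1) (Z p.2) e01.
have r2 := norm_reg2 (Z p.1) (Z p.2) e01.
rewrite normrM ger0_norm//.
have -> : 16 * speed / e = 2 * ((2 * speed) * (2 / e) + (2 * speed) * (2 / e)) by field; exact: lt0r_neq0.
rewrite ler_wpM2l//; apply: (le_trans (ler_normD _ _)).
by rewrite !normrM; apply: lerD; apply: ler_pM.
Qed.

(** Integrated in [y], the pair [(reg1, reg2)] is within [2 * defect_mass r] of $2\pi v^\perp$ in
    each coordinate, and $v\cdot v^\perp=0$. *)
Lemma Rintegral_half_rate r x : 0 < r ->
  `|\int[mu]_y half_rate (x, y)| <= 16 * speed * defect_mass r.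
Proof.
move=> r0.
have s0 : 0 <= speed by exact: speed_ge0.
have v1 := push_velocity1_le mZ M0 ZM (Z x).
have v2 := push_velocity2_le mZ M0 ZM (Z x).
have r1 := Rintegral_reg1 (Z x) r0.
have r2 := Rintegral_reg2 (Z x) r0.
have -> : \int[mu]_y half_rate (x, y) =
    2 * ((vel x).1 * \int[mu]_y reg1 e (Z x) (Z y) + (vel x).2 * \int[mu]_y reg2 e (Z x) (Z y)).
  have j1 := integrable_EFinZ (vel x).1 (i1 (Z x)).
  have j2 := integrable_EFinZ (vel x).2 (i2 (Z x)).
  rewrite -(RintegralZl _ measurableT (i1 (Z x))) -(RintegralZl _ measurableT (i2 (Z x))).
  rewrite -(RintegralD measurableT j1 j2).
  by rewrite -(RintegralZl _ measurableT (integrable_EFinD j1 j2)).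
move: (\int[mu]_y reg1 _ _ _) (\int[mu]_y reg2 _ _ _) (defect_mass r) r1 r2.
move: (vel x).1 (vel x).2 speed v1 v2 s0 => a b s va vb s0.
move: pi => p u v D h1 h2.
(* The terms added here cancel: this is the orthogonality of $v$ and $v^\perp$. *)
have -> : 2 * (a * u + b * v) = 2 * (a * (u + 2 * p * b) + b * (v - 2 * p * a)) by ring.
have -> : 16 * s * D = 2 * ((2 * s) * (2 * D) + (2 * s) * (2 * D)) by ring.
rewrite normrM ger0_norm// ler_wpM2l//; apply: (le_trans (ler_normD _ _)).
by rewrite !normrM; apply: lerD; apply: ler_pM.
Qed.

(** Swapping the pair shows that both summands have the same integral, which is computed with the
    second point innermost so that [Rintegral_half_rate] applies. *)
Lemma Rintegral_rate r : 0 < r ->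
  `|\int[(mu \x mu)%E]_p (half_rate p + half_rate (p.2, p.1))| <=
    32 * m * speed * defect_mass r.
Proof.
move=> r0.
have mh := measurable_half_rate.
have mh' : measurable_fun setT (fun p : X * X => half_rate (p.2, p.1)).
  by apply: (measurableT_comp mh); exact: measurable_fun_pair.
have ih := bounded_prod_integrable mu mu mh norm_half_rate.
have ih' := bounded_prod_integrable mu mu mh' (fun p => norm_half_rate (p.2, p.1)).
have s1 x : mu.-integrable setT (EFin \o (fun y => half_rate (x, y))).
  apply: (@bounded_integrable _ _ _ _ _ (16 * speed / e)) => [|y]; last exact: norm_half_rate.
  exact: (measurableT_comp mh (pair1_measurable x)).
have s2 y : mu.-integrable setT (EFin \o (fun x => half_rate (x, y))).
  apply: (@bounded_integrable _ _ _ _ _ (16 * speed / e)) => [|x]; last exact: norm_half_rate.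
  exact: (measurableT_comp mh (pair2_measurable y)).
rewrite (RintegralD measurableT ih ih').
rewrite -(Rintegral_sections ih s1) -(Rintegral_sections ih' s2).
have -> : \int[mu]_x \int[mu]_y half_rate (y, x) = \int[mu]_x \int[mu]_y half_rate (x, y).
  exact/esym/(Rintegral_swap ih s1 s2).
have ii := integrable_section ih s1.
have h : `|\int[mu]_x \int[mu]_y half_rate (x, y)| <= m * (16 * speed * defect_mass r).
  apply: (le_trans (le_normr_Rintegral measurableT ii)).
  rewrite mulrC -(Rintegral_cst mu measurableT).
  apply: le_Rintegral => //.
  - exact: (integrable_abse ii).
  - exact: (finite_measure_integrable_cst _ _ measurableT).
  - by move=> x _; exact: Rintegral_half_rate.
apply: (le_trans (ler_normD _ _)); apply: (le_trans (lerD h h)).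
by rewrite le_eqVlt; apply/orP; left; apply/eqP; ring.
Qed.

End regularization.

Section log_energy.
Variables (e B : R).
Hypotheses (e0 : 0 < e) (ZB1 : forall x, `|(Z x).1| <= B) (ZB2 : forall x, `|(Z x).2| <= B).

Lemma measurable_log_ratio (Z' : X -> R * R) : measurable_fun setT Z' ->
  measurable_fun setT (fun p : X * X => log_ratio e (Z' p.1) (Z p.2)).
Proof.
move=> mZ'; apply: measurable_funB; apply: (measurableT_comp (@measurable_ln R));
  apply: measurable_funD => //; [exact: measurable_qp|exact: measurable_qm].
Qed.

Lemma norm_log_ratio x y : `|log_ratio e (Z x) (Z y)| <= 8 * B ^+ 2 + e - ln e.
Proof. exact: log_ratio_le_bound. Qed.

Lemma prod_integrable_log_ratio :
  (mu \x mu)%E.-integrable setT (EFin \o (fun p => log_ratio e (Z p.1) (Z p.2))).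
Proof.
apply: bounded_prod_integrable; first exact: measurable_log_ratio.
by move=> p; exact: norm_log_ratio.
Qed.

Lemma integrable_log_ratio x :
  mu.-integrable setT (EFin \o (fun y => log_ratio e (Z x) (Z y))).
Proof.
apply: bounded_integrable => [|y]; last exact: norm_log_ratio.
exact: (section_measurable measurable_log_ratio).
Qed.

Definition log_energy : R := \int[(mu \x mu)%E]_p log_ratio e (Z p.1) (Z p.2).

Let J := \int[mu]_x (Z x).2.

Let i2 : mu.-integrable setT (EFin \o (fun x => (Z x).2)).
Proof. by apply: bounded_integrable ZB2; exact: measurable_Z2. Qed.

(** The decay scale of the singular factor is the height of [x]: its integral $64M/x_2$ cancels one
    power of $x_2^2$, and what remains is linear in the height, so that it integrates to a multiple
    of $MJ$. *)
Lemma log_energy_section (al be ga : R) x : 0 < al -> 0 < be -> 0 < ga ->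
  al * be ^+ 2 * ga = 1 ->
  4 * \int[mu]_y log_ratio e (Z x) (Z y) <=
    al * \int[mu]_y mirror_interaction (Z x) (Z y) + 2 * (be * (m * (Z x).2 + J)) +
    ga * (64 * (6400 * (M * (Z x).2))).
Proof.
move=> al0 be0 ga0 abc; have z0 := Z2 x.
have il := integrable_log_ratio x.
have im := integrable_mirror_interaction mZ M0 ZM (Z x).
have ic := finite_measure_integrable_cst mu (Z x).2 measurableT.
have ip := integrable_EFinD ic i2.
pose k := ga * (6400 * (Z x).2 ^+ 2).
have k0 : 0 <= k.
  by apply: mulr_ge0 (ltW ga0) (mulr_ge0 (ler0n _ _) (sqr_ge0 _)).
have j1 := integrable_EFinZ al im.
have j2 := integrable_EFinZ 2 (integrable_EFinZ be ip).
have j := integrable_EFinD j1 j2.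
pose f y := al * mirror_interaction (Z x) (Z y) + 2 * (be * ((Z x).2 + (Z y).2)).
have f0 y : 0 <= f y.
  have p0 : 0 <= (Z x).2 + (Z y).2 by exact: addr_ge0 (ltW z0) (ltW (Z2 y)).
  apply: addr_ge0; apply: mulr_ge0 => //; first exact: ltW.
    exact: divr_ge0 p0 (sqnorm_ge0 _).
  exact: mulr_ge0 (ltW be0) p0.
pose h y := (isqrt_decay (Z x).2 (Z y - Z x)%R.1 * isqrt_decay (Z x).2 (Z y - Z x)%R.2)%E.
have h0 y : (0 <= h y)%E by rewrite mule_ge0// isqrt_decay_ge0.
have mh : measurable_fun setT h.
  apply: emeasurable_funM; apply: (measurableT_comp (measurable_isqrt_decay _));
  apply: measurable_funB => //; [exact: measurable_Z1|exact: measurable_Z2].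
have hle := density_isqrt_decay M0 ZM (Z x) z0.
rewrite -(RintegralZl _ measurableT il).
have -> : al * \int[mu]_y mirror_interaction (Z x) (Z y) + 2 * (be * (m * (Z x).2 + J)) =
    \int[mu]_y f y.
  rewrite (RintegralD measurableT j1 j2) (RintegralZl _ measurableT im).
  rewrite (RintegralZl _ measurableT (integrable_EFinZ be ip)) (RintegralZl _ measurableT ip).
  by rewrite (RintegralD measurableT ic i2) Rintegral_cst// [m * _]mulrC.
rewrite -lee_fin EFinD.
have i4 := integrable_EFinZ 4 il.
rewrite /Rintegral !fineK; last 2 first.
- exact: (integrable_fin_num measurableT j).
- exact: (integrable_fin_num measurableT i4).
apply: (@le_trans _ _ (\int[mu]_y ((f y)%:E + k%:E * h y))%E).
  apply: ge0_le_integral; first exact: measurableT.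
  - move=> y _; rewrite lee_fin; apply: mulr_ge0 => //; exact: log_ratio_ge0.
  - exact: (measurable_int mu).
  - apply: emeasurable_funD; first exact: (measurable_int mu).
    by apply: emeasurable_funM => //.
  - move=> y _; exact: log_ratio_interpolation.
rewrite ge0_integralD//; last 4 first.
- by move=> y _; rewrite lee_fin.
- exact: (measurable_int mu).
- by move=> y _; rewrite mule_ge0// lee_fin.
- by apply: emeasurable_funM.
apply: leeD => //; rewrite ge0_integralZl_EFin//.
apply: (@le_trans _ _ (k%:E * (M * (64 / (Z x).2))%:E)%E).
  by apply: lee_wpmul2l => //; rewrite lee_fin.
rewrite -EFinM lee_fin /k.
rewrite le_eqVlt; apply/orP; left; apply/eqP.
move: (Z x).2 z0 (6400 : R) => z z0' q; field.
by rewrite gt_eqF.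
Qed.

Lemma log_energy_le (al be ga : R) : 0 < al -> 0 < be -> 0 < ga ->
  al * be ^+ 2 * ga = 1 ->
  4 * log_energy <=
    al * mirror_energy mu Z + 2 * (be * (2 * m * J)) + ga * (64 * (6400 * (M * J))).
Proof.
move=> al0 be0 ga0 abc.
have il := integrable_section prod_integrable_log_ratio integrable_log_ratio.
rewrite /log_energy -(Rintegral_sections prod_integrable_log_ratio integrable_log_ratio).
rewrite -(RintegralZl _ measurableT il).
have im : mu.-integrable setT
    (EFin \o (fun x => \int[mu]_y mirror_interaction (Z x) (Z y))).
  have -> : (fun x => \int[mu]_y mirror_interaction (Z x) (Z y)) =
      (fun x => pi * ((vel x).1 + \int[mu]_y (BSkernel (Z y) (Z x)).1)).
    by apply/funext => x; exact: (Rintegral_mirror_interaction mZ M0 ZM).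
  apply: integrable_EFinZ; apply: integrable_EFinD.
    exact: (integrable_push_velocity1 mZ M0 ZM mu mZ).
  exact: (integrable_BSkernel1_swap mZ M0 ZM mu).
have ic := finite_measure_integrable_cst mu J measurableT.
have j1 := integrable_EFinZ al im.
have j2 := integrable_EFinD (integrable_EFinZ m i2) ic.
have j3 := integrable_EFinZ 2 (integrable_EFinZ be j2).
have i2' := integrable_EFinZ 64 (integrable_EFinZ 6400 (integrable_EFinZ M i2)).
have j4 := integrable_EFinZ ga i2'.
apply: le_trans (le_Rintegral measurableT (integrable_EFinZ 4 il)
  (integrable_EFinD (integrable_EFinD j1 j3) j4) _) _.
  by move=> x _; exact: log_energy_section.
rewrite (RintegralD measurableT (integrable_EFinD j1 j3) j4) (RintegralD measurableT j1 j3).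
rewrite (RintegralZl _ measurableT im) (RintegralZl _ measurableT (integrable_EFinZ be j2)).
rewrite (RintegralZl _ measurableT j2) (RintegralD measurableT (integrable_EFinZ m i2) ic).
rewrite (RintegralZl _ measurableT i2) Rintegral_cst//.
rewrite (RintegralZl _ measurableT i2').
rewrite (RintegralZl _ measurableT (integrable_EFinZ 6400 (integrable_EFinZ M i2))).
rewrite (RintegralZl _ measurableT (integrable_EFinZ M i2)) (RintegralZl _ measurableT i2).
rewrite -/J -/m le_eqVlt; apply/orP; left; apply/eqP; rewrite /mirror_energy.
by move: (6400 : R) => q; ring.
Qed.

End log_energy.
End energy_snapshot.

(** * Time derivative of the regularized logarithm *)

Section log_ratio_derivative.
Context {R : realType}.

Lemma is_derive_ln_sq (u v : R -> R) (e s u' v' : R) : 0 < e ->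
  is_derive s 1 u u' -> is_derive s 1 v v' ->
  is_derive s 1 (fun r => ln (u r ^+ 2 + v r ^+ 2 + e))
    (2 * (u s * u' + v s * v') / (u s ^+ 2 + v s ^+ 2 + e)).
Proof.
move=> e0 du dv.
have q0 : 0 < u s ^+ 2 + v s ^+ 2 + e by rewrite ltr_wpDl// addr_ge0// sqr_ge0.
have dq : is_derive s 1 (fun r => u r ^+ 2 + v r ^+ 2 + e) (2 * (u s * u' + v s * v')).
  apply: is_derive_eq.
  by rewrite /GRing.scale/= ?expr1 ?addr0; ring.
have dln := @is_derive1_ln R _ q0.
have := @is_derive1_comp _ (@ln R) (fun r => u r ^+ 2 + v r ^+ 2 + e) s _ _ dln dq.
by rewrite mulrC.
Qed.

Lemma is_derive_log_ratio (e s : R) (z y : R -> R * R) (z1 z2 y1 y2 : R) : 0 < e ->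
  is_derive s 1 (fun r => (z r).1) z1 -> is_derive s 1 (fun r => (z r).2) z2 ->
  is_derive s 1 (fun r => (y r).1) y1 -> is_derive s 1 (fun r => (y r).2) y2 ->
  is_derive s 1 (fun r => log_ratio e (z r) (y r))
    (2 * (z1 * reg1 e (z s) (y s) + z2 * reg2 e (z s) (y s)) +
     2 * (y1 * reg1 e (y s) (z s) + y2 * reg2 e (y s) (z s))).
Proof.
move=> e0 dz1 dz2 dy1 dy2.
have d1 : is_derive s 1 (fun r => (z r).1 - (y r).1) (z1 - y1) by exact: is_deriveB.
have d2 : is_derive s 1 (fun r => (z r).2 + (y r).2) (z2 + y2) by exact: is_deriveD.
have d3 : is_derive s 1 (fun r => (z r).2 - (y r).2) (z2 - y2) by exact: is_deriveB.
have D := is_deriveB (is_derive_ln_sq e0 d1 d2) (is_derive_ln_sq e0 d1 d3).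
have -> : (fun r => log_ratio e (z r) (y r)) =
   (fun r => ln (((z r).1 - (y r).1) ^+ 2 + ((z r).2 + (y r).2) ^+ 2 + e)) -
   (fun r => ln (((z r).1 - (y r).1) ^+ 2 + ((z r).2 - (y r).2) ^+ 2 + e)).
  by apply/funext => r; rewrite /log_ratio /sqnorm /= opprK.
apply: (is_derive_eq D).
rewrite /reg1 /reg2 (sqnorm_reflect (y s) (z s)) (sqnormC (y s) (z s)).
rewrite /sqnorm /= opprK; ring.
Qed.

End log_ratio_derivative.

(** * Removal of the regularization *)

Section monotone_energy_limit.
Context {R : realType} d (X : measurableType d).
Variables (mu : {finite_measure set X -> \bar R}) (Z : X -> R * R).
Hypotheses (mZ : measurable_fun setT Z) (Z2 : forall x, 0 < (Z x).2).

Definition log_kernel (z y : R * R) : R := ln (1 + 4 * z.2 * y.2 / sqnorm (z - y)).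

Lemma cvg_log_ratio (e : R^nat) (z y : R * R) : 0 < z.2 -> 0 < y.2 ->
  (forall n, 0 < e n) -> e @ \oo --> 0 -> 0 < sqnorm (z - y) ->
  log_ratio (e n) z y @[n --> \oo] --> log_kernel z y.
Proof.
move=> z0 y0 e0 el q0.
have qp0 : 0 < sqnorm (z - reflect2 y).
  by rewrite sqnorm_reflectE addr_gt0// !mulr_gt0.
have -> : log_kernel z y = ln (sqnorm (z - reflect2 y)) - ln (sqnorm (z - y)).
  rewrite -ln_div ?posrE// /log_kernel; congr ln.
  by rewrite sqnorm_reflectE [RHS]mulrDl divff// gt_eqF.
have h (q : R) : 0 < q -> ln (q + e n) @[n --> \oo] --> ln q.
  move=> q1; apply: continuous_cvg; first exact: continuous_ln.
  by rewrite -[X in _ --> X]addr0; apply: cvgD => //; exact: cvg_cst.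
by apply: cvgB; exact: h.
Qed.

(* At coincident points [log_kernel] is [ln 1 = 0], by division by zero; hence
   Fatou and not an equality. *)
Lemma log_kernel_integral_le (e u : R^nat) (U : R) :
  (forall n, 0 < e n) -> e @ \oo --> 0 -> u @ \oo --> U ->
  (forall n, (mu \x mu)%E.-integrable setT
     (EFin \o (fun p => log_ratio (e n) (Z p.1) (Z p.2)))) ->
  (forall n, log_energy mu Z (e n) <= u n) ->
  (\int[(mu \x mu)%E]_p (log_kernel (Z p.1) (Z p.2))%:E <= U%:E)%E.
Proof.
move=> e0 el uU ie eu.
have mL n : measurable_fun setT (fun p : X * X => (log_ratio (e n) (Z p.1) (Z p.2))%:E).
  by apply/measurable_EFinP; exact: measurable_log_ratio.
have mk : measurable_fun setT (fun p : X * X => (log_kernel (Z p.1) (Z p.2))%:E).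
  apply/measurable_EFinP/(measurableT_comp (@measurable_ln R)).
  apply: measurable_funD => //; apply: measurable_quot; last exact: measurable_qm.
  apply: measurable_funM; first apply: measurable_funM => //.
  - exact: (measurableT_comp (measurable_Z2 mZ) measurable_fst).
  - exact: (measurableT_comp (measurable_Z2 mZ) measurable_snd).
apply: (@le_trans _ _ (\int[(mu \x mu)%E]_p
   limn_einf (fun n => (log_ratio (e n) (Z p.1) (Z p.2))%:E))%E).
  apply: ge0_le_integral => //.
  - move=> p _; rewrite lee_fin ln_ge0// lerDl divr_ge0 ?sqnorm_ge0//.
    by rewrite mulr_ge0 ?mulr_ge0// ltW.
  - under eq_fun do rewrite -[limn_einf _]oppeK -limn_esupN.
    apply: measurableT_comp => //; apply: measurable_fun_limn_esup => n.
    by apply: measurableT_comp => //.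
  - move=> p _; have [q0|q0] := eqVneq (sqnorm (Z p.1 - Z p.2)) 0.
      rewrite /log_kernel q0 invr0 mulr0 addr0 ln1.
      rewrite limn_einf_lim; apply: lime_ge; first exact: is_cvg_einfs.
      apply: nearW => n; apply: le_ereal_inf_tmp => _ [k _ <-].
      by rewrite lee_fin log_ratio_ge0.
    have c := cvg_log_ratio (Z2 p.1) (Z2 p.2) e0 el.
    have {}c := c _; rewrite (@cvg_limn_einf_sup _ _ (log_kernel (Z p.1) (Z p.2))%:E)//.
    by apply: cvg_EFin; [exact: nearW|apply: c; rewrite lt0r q0 sqnorm_ge0].
apply: le_trans (fatou _ _ _ _) _ => //.
  by move=> n p _; rewrite lee_fin log_ratio_ge0.
(* Written as the lower limit of [u], the bound [U] can be compared with the lower limit of the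
   regularized energies. *)
rewrite -(@cvg_limn_einf_sup _ (EFin \o u) U%:E _).1; last exact: cvg_EFin (nearW _ _) uU.
rewrite !limn_einf_lim; apply: lee_lim; [exact: is_cvg_einfs|exact: is_cvg_einfs|].
apply: nearW => n; apply: le_ereal_inf_tmp => _ [k nk <-].
apply: (@le_trans _ _ (\int[(mu \x mu)%E]_p (log_ratio (e k) (Z p.1) (Z p.2))%:E)%E).
  by apply: ge_ereal_inf; eexists; [exists k|].
rewrite -(fineK (integrable_fin_num measurableT (ie k))) lee_fin.
exact: eu.
Qed.

End monotone_energy_limit.

(** * Evolution in time of the transported measure *)

Section transport.
Context {R : realType} d (X : measurableType d).
Variables (mu : {finite_measure set X -> \bar R}) (Psi : R -> X -> R * R) (M B : R).
Hypotheses
  (mPsi : forall t : R, 0 <= t -> measurable_fun setT (Psi t))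
  (M0 : 0 <= M)
  (dens : forall t : R, 0 <= t -> density_le mu (Psi t) M)
  (Psi2 : forall (t : R) x, 0 <= t -> 0 < (Psi t x).2)
  (ode1 : forall (t : R) x, 0 < t ->
     is_derive t 1 (fun s => (Psi s x).1) (push_velocity mu (Psi t) (Psi t x)).1)
  (ode2 : forall (t : R) x, 0 < t ->
     is_derive t 1 (fun s => (Psi s x).2) (push_velocity mu (Psi t) (Psi t x)).2)
  (c1 : forall x, (Psi t x).1 @[t --> 0^'+] --> (Psi 0 x).1)
  (c2 : forall x, (Psi t x).2 @[t --> 0^'+] --> (Psi 0 x).2)
  (b1 : forall x, `|(Psi 0 x).1| <= B)
  (b2 : forall x, `|(Psi 0 x).2| <= B).
Let m := fine (mu setT).
Notation vmax := (speed mu M).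

Let pos2 (t : R) : 0 <= t -> forall x, 0 < (Psi t x).2.
Proof. by move=> t0 x; exact: Psi2. Qed.

Let m0 : 0 <= m. Proof. by rewrite fine_ge0. Qed.

Let s0 : 0 <= vmax. Proof. exact: speed_ge0. Qed.

Let v1 t x : 0 <= t -> `|(push_velocity mu (Psi t) (Psi t x)).1| <= 2 * vmax.
Proof. by move=> t0; exact: (push_velocity1_le (mPsi t0) M0 (dens t0)). Qed.

Let v2 t x : 0 <= t -> `|(push_velocity mu (Psi t) (Psi t x)).2| <= 2 * vmax.
Proof. by move=> t0; exact: (push_velocity2_le (mPsi t0) M0 (dens t0)). Qed.

Let bounded_trajectory (f f' : R -> R) (t : R) : 0 <= t ->
  f s @[s --> 0^'+] --> f 0 -> (forall s : R, 0 < s -> is_derive s 1 f (f' s)) ->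
  (forall s, 0 < s -> `|f' s| <= 2 * vmax) -> `|f 0| <= B ->
  `|f t| <= B + 2 * vmax * t.
Proof.
rewrite le_eqVlt => /predU1P[<-|t0] f0 df f'b fB; first by rewrite mulr0 addr0.
have [s sp E] := MVT_right t0 f0 df.
have -> : f t = f 0 + f' s * t by rewrite -E; ring.
apply: (le_trans (ler_normD _ _)); apply: lerD => //.
by rewrite normrM (gtr0_norm t0) ler_wpM2r ?(ltW t0)// f'b.
Qed.

Lemma bounded_Psi1 (t : R) x : 0 <= t -> `|(Psi t x).1| <= B + 2 * vmax * t.
Proof.
move=> t0; apply: (@bounded_trajectory (fun s => (Psi s x).1)
  (fun s => (push_velocity mu (Psi s) (Psi s x)).1)) => //.
by move=> s /ltW; exact: v1.
Qed.

Lemma bounded_Psi2 (t : R) x : 0 <= t -> `|(Psi t x).2| <= B + 2 * vmax * t.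
Proof.
move=> t0; apply: (@bounded_trajectory (fun s => (Psi s x).2)
  (fun s => (push_velocity mu (Psi s) (Psi s x)).2)) => //.
by move=> s /ltW; exact: v2.
Qed.

Lemma integrable_Psi1 (nu : {finite_measure set X -> \bar R}) (t : R) : 0 <= t ->
  nu.-integrable setT (EFin \o (fun x => (Psi t x).1)).
Proof.
move=> t0; apply: (bounded_integrable nu (measurable_Z1 (mPsi t0))).
by move=> x; exact: bounded_Psi1.
Qed.

Lemma integrable_Psi2 (nu : {finite_measure set X -> \bar R}) (t : R) : 0 <= t ->
  nu.-integrable setT (EFin \o (fun x => (Psi t x).2)).
Proof.
move=> t0; apply: (bounded_integrable nu (measurable_Z2 (mPsi t0))).
by move=> x; exact: bounded_Psi2.
Qed.

Lemma center1_growth (nu : {finite_measure set X -> \bar R}) (c t : R) :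
  (forall s : R, 0 < s -> c <= \int[nu]_x (push_velocity mu (Psi s) (Psi s x)).1) ->
  0 <= t -> c * t <= \int[nu]_x (Psi t x).1 - \int[nu]_x (Psi 0 x).1.
Proof.
move=> h t0; apply: (@integral_growth _ _ _ nu (measureT_lty nu) (fun s x => (Psi s x).1)
  (fun s x => (push_velocity mu (Psi s) (Psi s x)).1) (2 * vmax)) => //.
- by move=> s sp; exact: integrable_Psi1.
- by move=> s x /ltW; exact: v1.
Qed.

(** [nu] will be the sparse part; it is carried by the flow that the full [mu] generates. *)
Lemma center1_growth_le (nu : {finite_measure set X -> \bar R}) (c t : R) :
  (forall s : R, 0 < s -> \int[nu]_x (push_velocity mu (Psi s) (Psi s x)).1 <= c) ->
  0 <= t -> \int[nu]_x (Psi t x).1 - \int[nu]_x (Psi 0 x).1 <= c * t.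
Proof.
move=> h t0.
have iv (s : R) : 0 < s -> nu.-integrable setT
    (EFin \o (fun x => (push_velocity mu (Psi s) (Psi s x)).1)).
  move=> /ltW sp.
  exact: (integrable_push_velocity1 (mPsi sp) M0 (dens sp) nu (mPsi sp)).
have N (f : X -> R) : nu.-integrable setT (EFin \o f) ->
    \int[nu]_x (- f x) = - \int[nu]_x f x.
  move=> fi; rewrite -mulN1r -(RintegralZl _ measurableT fi).
  by apply: eq_Rintegral => x _; rewrite mulN1r.
have H : - c * t <= \int[nu]_x (- (Psi t x).1) - \int[nu]_x (- (Psi 0 x).1).
  apply: (@integral_growth _ _ _ nu (measureT_lty nu) (fun s x => - (Psi s x).1)
    (fun s x => - (push_velocity mu (Psi s) (Psi s x)).1) (2 * vmax)) => //.
  - by move=> s sp; exact: (integrable_EFinN (integrable_Psi1 nu sp)).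
  - by move=> x; exact: cvgN.
  - by move=> s x sp; have d1 := ode1 x sp; exact: is_deriveN.
  - by move=> s x /ltW sp; rewrite normrN; exact: v1.
  - by move=> s sp; rewrite (N _ (iv s sp)) lerN2 h.
move: H; rewrite (N _ (integrable_Psi1 nu t0)) (N _ (integrable_Psi1 nu (lexx 0))).
by rewrite mulNr; move: (c * t) => ct; lra.
Qed.

Definition height : R := \int[mu]_x (Psi 0 x).2.

Lemma height_conserved (t : R) : 0 <= t -> \int[mu]_x (Psi t x).2 = height.
Proof.
move=> t0.
have z (s : R) : 0 < s -> \int[mu]_x (push_velocity mu (Psi s) (Psi s x)).2 = 0.
  by move=> /ltW sp; exact: (Rintegral_velocity2 (mPsi sp) M0 (dens sp)).
have iv (s : R) : 0 < s -> mu.-integrable setT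
    (EFin \o (fun x => (push_velocity mu (Psi s) (Psi s x)).2)).
  move=> /ltW sp.
  exact: (integrable_push_velocity2 (mPsi sp) M0 (dens sp) mu (mPsi sp)).
have N (f : X -> R) : mu.-integrable setT (EFin \o f) ->
    \int[mu]_x (- f x) = - \int[mu]_x f x.
  move=> fi; rewrite -mulN1r -(RintegralZl _ measurableT fi).
  by apply: eq_Rintegral => x _; rewrite mulN1r.
have H1 : 0 * t <= \int[mu]_x (Psi t x).2 - \int[mu]_x (Psi 0 x).2.
  apply: (@integral_growth _ _ _ mu (measureT_lty mu) (fun s x => (Psi s x).2)
    (fun s x => (push_velocity mu (Psi s) (Psi s x)).2) (2 * vmax)) => //.
  - by move=> s sp; exact: integrable_Psi2.
  - by move=> s x /ltW; exact: v2.
  - by move=> s sp; rewrite z.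
have H2 : 0 * t <= \int[mu]_x (- (Psi t x).2) - \int[mu]_x (- (Psi 0 x).2).
  apply: (@integral_growth _ _ _ mu (measureT_lty mu) (fun s x => - (Psi s x).2)
    (fun s x => - (push_velocity mu (Psi s) (Psi s x)).2) (2 * vmax)) => //.
  - by move=> s sp; exact: (integrable_EFinN (integrable_Psi2 mu sp)).
  - by move=> x; exact: cvgN.
  - by move=> s x sp; have dd := ode2 x sp; exact: is_deriveN.
  - by move=> s x /ltW sp; rewrite normrN; exact: v2.
  - by move=> s sp; rewrite (N _ (iv s sp)) z// oppr0.
move: H1 H2; rewrite (N _ (integrable_Psi2 mu t0)) (N _ (integrable_Psi2 mu (lexx 0))).
by rewrite /height mul0r => H1 H2; lra.
Qed.

(** The regularized energy loses at most [defect_mass] per unit of time, up to a constant. A bound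
    on the loss is enough, because it is the initial energy that has to be bounded by quantities at
    time [t]. *)
Lemma log_energy_growth (e r t : R) : 0 < e <= 1 -> 0 < r -> 0 <= t ->
  - (32 * m * vmax * defect_mass mu M e r) * t <=
  log_energy mu (Psi t) e - log_energy mu (Psi 0) e.
Proof.
move=> e01 r0 t0; have e0 : 0 < e by case/andP: e01.
pose f s (p : X * X) := log_ratio e (Psi s p.1) (Psi s p.2).
pose f' s (p : X * X) := half_rate mu (Psi s) e p + half_rate mu (Psi s) e (p.2, p.1).
have multy : ((mu \x mu)%E setT < +oo)%E.
  by rewrite -setXTT product_measure1E// lte_mul_pinfty// ?measureT_lty ?fin_num_measure.
apply: (@integral_growth _ _ _ (mu \x mu)%E multy f f' (2 * (16 * vmax / e))) => //.
- move=> s sp; apply: (prod_integrable_log_ratio mu (mPsi sp) (pos2 sp) e0).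
  + by move=> x; exact: bounded_Psi1.
  + by move=> x; exact: bounded_Psi2.
- move=> p.
  have cq (z y : R -> R * R) : (forall r, 0 <= r -> 0 < (z r).2) ->
      (forall r, 0 <= r -> 0 < (y r).2) -> (z t).1 @[t --> 0^'+] --> (z 0).1 ->
      (z t).2 @[t --> 0^'+] --> (z 0).2 -> (y t).1 @[t --> 0^'+] --> (y 0).1 ->
      (y t).2 @[t --> 0^'+] --> (y 0).2 ->
      log_ratio e (z t) (y t) @[t --> 0^'+] --> log_ratio e (z 0) (y 0).
    move=> z0 y0 cz1 cz2 cy1 cy2.
    have pos (q : R) : 0 <= q -> 0 < q + e by move=> q0; rewrite ltr_wpDl.
    have sq (u : R -> R) : u t @[t --> 0^'+] --> u 0 -> u t ^+ 2 @[t --> 0^'+] --> u 0 ^+ 2.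
      by move=> cu; apply: cvgM.
    rewrite /log_ratio; apply: cvgB; (apply: continuous_cvg;
      [by apply: continuous_ln; apply: pos; exact: sqnorm_ge0|]); rewrite /sqnorm/=.
    + apply: cvgD; last exact: cvg_cst.
      apply: cvgD; first exact: (sq (fun t => (z t).1 - (y t).1) (cvgB cz1 cy1)).
      exact: (sq (fun t => (z t).2 - - (y t).2) (cvgB cz2 (cvgN cy2))).
    + apply: cvgD; last exact: cvg_cst.
      apply: cvgD; first exact: (sq (fun t => (z t).1 - (y t).1) (cvgB cz1 cy1)).
      exact: (sq (fun t => (z t).2 - (y t).2) (cvgB cz2 cy2)).
  apply: (cq (fun s => Psi s p.1) (fun s => Psi s p.2)) => //.
  + by move=> s sp; exact: Psi2.
  + by move=> s sp; exact: Psi2.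
- move=> s p sp.
  exact: (is_derive_log_ratio e0 (ode1 p.1 sp) (ode2 p.1 sp) (ode1 p.2 sp) (ode2 p.2 sp)).
- move=> s p /ltW sp.
  apply: (le_trans (ler_normD _ _)).
  have h := norm_half_rate (mPsi sp) M0 (dens sp) e01.
  by rewrite [leRHS]mulr_natl mulr2n; exact: (lerD (h p) (h (p.2, p.1))).
- move=> s /ltW sp.
  have := Rintegral_rate (mPsi sp) M0 (dens sp) e01 r0.
  by rewrite ler_norml => /andP[].
Qed.

(** Extended-real valued: its finiteness only comes out of [initial_energy_le]. *)
Definition initial_energy : \bar R :=
  (\int[(mu \x mu)%E]_p (log_kernel (Psi 0%R p.1) (Psi 0%R p.2))%:E)%E.

(** The regularization scale $e=\rho^4$ and the radius $\rho$ go to 0 together: [defect_mass] is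
    then the speed bound times $\rho$, and the loss of energy up to time [t] vanishes in the
    limit. *)
Lemma initial_energy_le (al be ga t : R) : 0 <= t -> 0 < al -> 0 < be -> 0 < ga ->
  al * be ^+ 2 * ga = 1 ->
  (initial_energy <= ((al * mirror_energy mu (Psi t) + 2 * (be * (2 * m * height)) +
     ga * (64 * (6400 * (M * height)))) / 4)%:E)%E.
Proof.
move=> t0 al0 be0 ga0 abc.
set U := (al * _ + _ + _) / 4.
pose rho (n : nat) : R := n.+1%:R^-1.
have rho0 n : 0 < rho n by rewrite invr_gt0.
have rho1 n : rho n <= 1 by rewrite invf_le1// ler1n.
have rhol : rho @ \oo --> (0 : R) by exact: cvg_harmonic.
pose e n := rho n ^+ 4.
have e0 n : 0 < e n by rewrite exprn_gt0.
have e01 n : 0 < e n <= 1 by rewrite e0 exprn_ile1// ltW.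
have el : e @ \oo --> (0 : R).
  have -> : (0 : R) = 0 * (0 * (0 * 0)) by rewrite mul0r.
  by apply: cvgM => //; apply: cvgM => //; apply: cvgM.
pose c := 32 * m * vmax * vmax * t.
apply: (@log_kernel_integral_le _ _ _ mu (Psi 0) (mPsi (lexx 0)) (pos2 (lexx 0))
  e (fun n => U + c * rho n) U) => //.
- rewrite -[X in _ --> X]addr0 -[X in _ --> U + X](mulr0 c).
  by apply: cvgD; [exact: cvg_cst|apply: cvgM => //; exact: cvg_cst].
- move=> n; apply: (prod_integrable_log_ratio mu (mPsi (lexx 0)) (pos2 (lexx 0)) (e0 n)).
  + exact: b1.
  + exact: b2.
- move=> n; have g := log_energy_growth (e01 n) (rho0 n) t0.
  have i := log_energy_le (mPsi t0) M0 (dens t0) (pos2 t0) (e0 n)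
    (fun x => bounded_Psi1 x t0) (fun x => bounded_Psi2 x t0) al0 be0 ga0 abc.
  rewrite -/m (height_conserved t0) in i.
  have dE : defect_mass mu M (e n) (rho n) = vmax * rho n.
    rewrite /defect_mass /e (_ : rho n ^+ 4 / rho n ^+ 3 = rho n); first by rewrite /speed; ring.
    by rewrite exprS mulfK// gt_eqF// exprn_gt0.
  rewrite dE in g.
  have iU : log_energy mu (Psi t) (e n) <= U by rewrite ler_pdivlMr// mulrC.
  have -> : c * rho n = 32 * m * vmax * (vmax * rho n) * t by rewrite /c; ring.
  by move: g; rewrite mulNr; lra.
Qed.

(** The optimization over the AM-GM weights. When [L = 0] the weights are undefined, and the sign of
    the mirror energy suffices. *)
Lemma mirror_energy_ge (L t : R) : (L%:E <= initial_energy)%E -> 0 <= t -> 0 <= L ->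
  0 < M -> 0 < m -> 0 < height ->
  L ^+ 4 / ((2 * m * height) ^+ 2 * (64 * (6400 * (M * height)))) <=
    mirror_energy mu (Psi t).
Proof.
move=> LE t0; rewrite le_eqVlt => /predU1P[<-|L0] M1 m1 h1.
  by rewrite expr0n mul0r mirror_energy_ge0// => x; exact: Psi2.
have k0 : 0 < 6400 :> R by rewrite ltr0n.
have ie al be ga := @initial_energy_le al be ga t t0.
move: (6400 : R) k0 ie => k k0 ie.
set b := 2 * m * height; set g := 64 * (k * (M * height)).
have bp : 0 < b by rewrite !mulr_gt0.
have gp : 0 < g by rewrite !mulr_gt0.
have bn := lt0r_neq0 bp; have gn := lt0r_neq0 gp; have Ln := lt0r_neq0 L0.
(* The weights [L / b] and [L / g] make the last two terms contribute 2L and L to a bound on 4L, so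
   the mirror term must supply the remaining L; the first weight is then forced by the
   constraint. *)
have al0 : 0 < b ^+ 2 * g / L ^+ 3 by rewrite divr_gt0 ?exprn_gt0// mulr_gt0 ?exprn_gt0.
have be0 : 0 < L / b by rewrite divr_gt0.
have ga0 : 0 < L / g by rewrite divr_gt0.
have abc : b ^+ 2 * g / L ^+ 3 * (L / b) ^+ 2 * (L / g) = 1 by field; rewrite Ln bn gn.
have := le_trans LE (ie _ _ _ al0 be0 ga0 abc); rewrite lee_fin -/b -/g.
rewrite ler_pdivlMr// divfK// divfK// => h.
rewrite ler_pdivrMr ?mulr_gt0 ?exprn_gt0//.
have : L <= b ^+ 2 * g / L ^+ 3 * mirror_energy mu (Psi t) by lra.
rewrite mulrAC ler_pdivlMr ?exprn_gt0// -exprS => h2.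
by apply: le_trans h2 _; rewrite mulrC.
Qed.

End transport.

(** * Borel structure of the plane and the essential support *)

Section rational_boxes.
Context {R : realType}.

(** A countable base of the topology, used for measurability of open sets and for countable unions
    of null sets. *)
Definition rbox (k : rat * rat * nat) : set (R * R) :=
  [set z | `|z.1 - ratr k.1.1| < k.2.+1%:R^-1 /\ `|z.2 - ratr k.1.2| < k.2.+1%:R^-1].

Lemma rbox_nbhs (x : R * R) (U : set (R * R)) : nbhs x U ->
  exists2 k, rbox k x & rbox k `<=` U.
Proof.
move=> /nbhs_ballP[e /= e0 eU].
have [n ne] : exists n : nat, 2 * n.+1%:R^-1 < e.
  exists (Num.bound (2 / e)); rewrite ltr_pdivrMr// mulrC -ltr_pdivrMr//.
  rewrite (lt_trans (archi_boundP (ltW (divr_gt0 (ltr0n _ 2) e0))))//.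
  by rewrite ltr_nat.
set d : R := n.+1%:R^-1 in ne *; have d0 : 0 < d by rewrite invr_gt0.
have rat_near (a : R) : exists q, `|a - ratr q| < d.
  have [q] := @rat_in_itvoo R (a - d) (a + d) ltac:(lra).
  by rewrite in_itv/= => /andP[q1 q2]; exists q; rewrite ltr_norml; lra.
have [q1 h1] := rat_near x.1; have [q2 h2] := rat_near x.2.
exists (q1, q2, n) => // y [/= g1 g2]; apply: eU; split; rewrite /ball/=.
- move: h1 g1; rewrite -/d !ltr_norml => /andP[? ?] /andP[? ?]; lra.
- move: h2 g2; rewrite -/d !ltr_norml => /andP[? ?] /andP[? ?]; lra.
Qed.

Lemma measurable_rbox k : measurable (rbox k).
Proof.
have m1 (q : R) (f : R * R -> R) (r : R) : measurable_fun setT f ->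
    measurable [set z | `|f z - q| < r].
  move=> mf.
  have mg : measurable_fun setT (fun z => `|f z - q|).
    by apply: measurableT_comp => //; exact: measurable_funB.
  have := @measurable_fun_ltr _ _ _ setT _ (cst r) mg (measurable_cst _) measurableT [set true].
  by rewrite setTI; exact.
by apply: measurableI; apply: m1.
Qed.

(** The sigma-algebra is the product one; an open set is the countable union of the rational boxes
    that it contains. *)
Lemma open_measurable_plane (U : set (R * R)) : open U -> measurable U.
Proof.
move=> oU.
pose F (n : nat) : set (R * R) :=
  if unpickle n is Some k then if `[< rbox k `<=` U >] then rbox k else set0 else set0.
have -> : U = \bigcup_n F n.
  apply/seteqP; split => [x Ux|x [n _]].
    have [k kx kU] := rbox_nbhs (open_nbhs_nbhs (conj oU Ux)).
    by exists (pickle k); [exact: I|rewrite /F pickleK asboolT].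
  by rewrite /F; case: unpickle => // k; case: asboolP => // kU /kU.
apply: bigcup_measurable => n _; rewrite /F; case: unpickle => // k.
by case: ifP => // _; exact: measurable_rbox.
Qed.

Lemma continuous_measurable_plane (D : set (R * R)) (f : R * R -> R) :
  open D -> {in D, continuous f} -> measurable_fun D f.
Proof.
move=> oD cf; apply: (measurability _ (RGenOpens.measurableE R)).
move=> _ [_ [a [b ->] <-]]; apply: open_measurable_plane.
rewrite openE => x [Dx fx]; rewrite /interior.
apply: filterI; first exact: open_nbhs_nbhs.
apply: cf; first exact/mem_set.
by apply: open_nbhs_nbhs; split => //; exact: interval_open.
Qed.

Lemma open_halfplane : open (halfplane R).
Proof.
apply: (@open_comp _ _ (@snd R R) [set u | 0 < u]) => [x _|]; first exact: cvg_snd.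
exact: open_gt.
Qed.

Lemma measurable_halfplane : measurable (halfplane R).
Proof. by apply: open_measurable_plane; exact: open_halfplane. Qed.

Lemma ae_impl (P Q : R * R -> Prop) : {ae leb2 R, forall y, P y} ->
  (forall y, P y -> Q y) -> {ae leb2 R, forall y, Q y}.
Proof.
by move=> [N [mN N0 sub]] PQ; exists N; split => // y /= nQ; apply: sub => /= /PQ.
Qed.

Lemma ae_impl2 (P Q S : R * R -> Prop) : {ae leb2 R, forall y, P y} ->
  {ae leb2 R, forall y, Q y} -> (forall y, P y -> Q y -> S y) ->
  {ae leb2 R, forall y, S y}.
Proof.
move=> aP aQ PQS; have [N [mN N0 sub]] := negligibleU aP aQ.
exists N; split => // y /= nS; apply: sub; apply: contrapT => /not_orP[/contrapT p /contrapT q].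
exact/nS/PQS.
Qed.

(** Each point off the support lies in a rational box on which [f] vanishes almost everywhere, and
    there are countably many such boxes. *)
Lemma ae_supp (f : R * R -> R) : ae_halfplane (fun x => f x != 0 -> supp f x).
Proof.
pose P (n : nat) (y : R * R) := if unpickle n is Some k then
   ae_halfplane (fun y => rbox k y -> f y = 0) -> halfplane R y -> rbox k y -> f y = 0 else True.
have : {ae leb2 R, forall y, forall n, P n y}.
  apply: ae_foralln => n; rewrite /P; case: unpickle => [k|]; last exact: aeW.
  have [h|h] := pselect (ae_halfplane (fun y => rbox k y -> f y = 0)).
    by apply: (ae_impl h) => y hy _; exact: hy.
  by apply: aeW => y /h.
move=> /ae_impl; apply => y Py Hy /eqP fy U Uy aeU; apply: fy.
have [k ky kU] := rbox_nbhs Uy.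
have := Py (pickle k); rewrite /P pickleK; apply => //.
by apply: (ae_impl aeU) => z h Hz /kU; exact: h.
Qed.

End rational_boxes.

(** * Finite measures given by a density *)

Lemma product_sigma_finite {R : realType} d1 d2 (T1 : measurableType d1)
    (T2 : measurableType d2) (m1 : {sigma_finite_measure set T1 -> \bar R})
    (m2 : {sigma_finite_measure set T2 -> \bar R}) : sigma_finite setT (m1 \x m2)%E.
Proof.
have /sigma_finiteP[F [TF ndF Foo]] := sigma_finiteT m1.
have /sigma_finiteP[G [TG ndG Goo]] := sigma_finiteT m2.
exists (fun n => F n `*` G n) => [|k].
  apply/seteqP; split => // -[x y] _.
  have [n _ Fx] : (\bigcup_n F n) x by rewrite -TF.
  have [k _ Gy] : (\bigcup_n G n) y by rewrite -TG.
  exists (maxn n k) => //; split.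
  - by apply/subsetPset: x Fx; exact/ndF/leq_maxl.
  - by apply/subsetPset: y Gy; exact/ndG/leq_maxr.
have [? ?] := Foo k; have [? ?] := Goo k; split; first exact: measurableX.
by rewrite product_measure1E// lte_mul_pinfty// ge0_fin_numE.
Qed.

(** The proofs are parameters so that the structure of a finite measure can be attached to the term
    itself. *)
Definition weighted_measure {R : realType} d (T : measurableType d)
    (la : {measure set T -> \bar R}) (w : T -> R)
    (mw : measurable_fun setT w) (w0 : forall x, 0 <= w x)
    (wfin : (\int[la]_x (w x)%:E < +oo)%E) : set T -> \bar R :=
  fun A => (\int[la]_(x in A) (w x)%:E)%E.

Section weighted_measure_structure.
Context {R : realType} d (T : measurableType d) (la : {measure set T -> \bar R})
  (w : T -> R) (mw : measurable_fun setT w) (w0 : forall x, 0 <= w x)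
  (wfin : (\int[la]_x (w x)%:E < +oo)%E).
Notation nu := (weighted_measure mw w0 wfin).
Local Open Scope ereal_scope.

Let nu0 : nu set0 = 0. Proof. exact: integral_set0. Qed.

Let nu_ge0 A : 0 <= nu A.
Proof. by apply: integral_ge0 => x _; rewrite lee_fin. Qed.

Let nu_sigma : semi_sigma_additive nu.
Proof.
apply: semi_sigma_additive_nng_induced; first exact/measurable_EFinP.
by move=> x; rewrite lee_fin.
Qed.

HB.instance Definition _ := isMeasure.Build _ _ _ nu nu0 nu_ge0 nu_sigma.

Let nu_fin : fin_num_fun nu.
Proof.
move=> A mA; rewrite ge0_fin_numE//; apply: le_lt_trans wfin.
apply: ge0_subset_integral => //; first exact/measurable_EFinP.
by move=> x _; rewrite lee_fin.
Qed.

HB.instance Definition _ := @Measure_isFinite.Build _ _ _ nu nu_fin.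

End weighted_measure_structure.

(** The same measure under a name that remembers the proof of sigma-finiteness, as the Radon-Nikodym
    theorem asks for the structure. *)
Definition sigma_finite_copy {R : realType} d (T : measurableType d)
  (la : {measure set T -> \bar R}) (sf : sigma_finite setT la) : set T -> \bar R := la.

Section sigma_finite_copy_structure.
Context {R : realType} d (T : measurableType d) (la : {measure set T -> \bar R})
  (sf : sigma_finite setT la).

HB.instance Definition _ := Measure.copy (sigma_finite_copy sf) la.
HB.instance Definition _ := Measure_isSigmaFinite.Build _ _ _ (sigma_finite_copy sf) sf.

End sigma_finite_copy_structure.

Section weighted_integral.
Context {R : realType} d (T : measurableType d) (la : {measure set T -> \bar R})
  (w : T -> R) (sf : sigma_finite setT la) (mw : measurable_fun setT w)
  (w0 : forall x, 0 <= w x) (wfin : (\int[la]_x (w x)%:E < +oo)%E).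
Let nu : {finite_measure set T -> \bar R} := weighted_measure mw w0 wfin.
Let la' : {sigma_finite_measure set T -> \bar R} := sigma_finite_copy sf.
Local Open Scope ereal_scope.

(** The Radon-Nikodym derivative of [nu] has the same integrals as [w] on all measurable sets, hence
    equals [w] almost everywhere; the change of variables known for it then holds for [w]. *)
Lemma ge0_integral_weighted (f : T -> \bar R) : measurable_fun setT f ->
  (forall x, 0 <= f x) ->
  \int[nu]_x f x = \int[la]_x (f x * (w x)%:E).
Proof.
move=> mf f0.
have nula : nu `<< la'.
  apply/null_content_dominatesP => A mA A0; rewrite /nu /= /weighted_measure.
  apply: null_set_integral => //.
  exact/measurable_funTS/measurable_EFinP.
have wi : la.-integrable setT (EFin \o w).
  apply/integrableP; split; first exact/measurable_EFinP.
  by under eq_integral do rewrite /= ger0_norm//.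
have RNi : la.-integrable setT _ := Radon_Nikodym_SigmaFinite.f_integrable nula.
have wRN : ae_eq la setT (EFin \o w) (Radon_Nikodym_SigmaFinite.f nu la').
  apply: integral_ae_eq => //; first exact: measurable_int RNi.
  by move=> E _ mE; rewrite -(Radon_Nikodym_SigmaFinite.f_integral nula mE).
rewrite -(Radon_Nikodym_SigmaFinite.change_of_variables nula f0 measurableT mf).
apply: ae_eq_integral => //.
- by apply: emeasurable_funM => //; exact: measurable_int RNi.
- by apply: emeasurable_funM => //; exact/measurable_EFinP.
- by move: wRN; apply: filterS => x /= h _; rewrite h.
Qed.

Lemma Rintegral_weighted (f : T -> R) : measurable_fun setT f ->
  (\int[nu]_x f x)%R = (\int[la]_x (f x * w x))%R.
Proof.
move=> mf; rewrite /Rintegral; congr fine.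
rewrite integralE [RHS]integralE.
have mEf : measurable_fun setT (EFin \o f) by exact/measurable_EFinP.
rewrite (ge0_integral_weighted (measurable_funepos mEf) (@funepos_ge0 _ _ _)).
rewrite (ge0_integral_weighted (measurable_funeneg mEf) (@funeneg_ge0 _ _ _)).
congr (_ - _); apply: eq_integral => x _.
- by rewrite !funeposE /= -!EFin_max -EFinM maxr_pMl// mul0r.
- by rewrite !funenegE /= -!EFin_max -EFinM maxr_pMl// mul0r mulNr.
Qed.

End weighted_integral.

Lemma weighted_measure_exists {R : realType} d (T : measurableType d)
    (la : {measure set T -> \bar R}) (w : T -> R) :
    sigma_finite setT la -> measurable_fun setT w -> (forall x, 0 <= w x) -> (\int[la]_x (w x)%:E < +oo)%E ->
  {nu : {finite_measure set T -> \bar R} |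
    [/\ forall A, nu A = (\int[la]_(x in A) (w x)%:E)%E,
        forall f, measurable_fun setT f -> (forall x, 0 <= f x)%E ->
          (\int[nu]_x f x = \int[la]_x (f x * (w x)%:E))%E
      & forall f : T -> R, measurable_fun setT f ->
          \int[nu]_x f x = \int[la]_x (f x * w x)]}.
Proof.
move=> sf mw w0 wfin; exists (weighted_measure mw w0 wfin); split => // f.
- exact: ge0_integral_weighted.
- exact: Rintegral_weighted.
Qed.

(** * An everywhere bounded representative of the profile *)

Section clip.
Context {R : realType}.

Definition hbox (B : R) : set (R * R) :=
  [set x | [/\ halfplane R x, `|x.1| <= B & `|x.2| <= B]].

Lemma measurable_hbox B : measurable (hbox B).
Proof.
have m1 (f : R * R -> R) : measurable_fun setT f -> measurable [set z | `|f z| <= B].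
  move=> mf.
  have mg : measurable_fun setT (fun z => `|f z|) by exact: measurableT_comp.
  have := @measurable_fun_ler _ _ _ setT _ (cst B) mg (measurable_cst _) measurableT [set true].
  by rewrite setTI; exact.
have -> : hbox B = halfplane R `&` ([set z | `|z.1| <= B] `&` [set z | `|z.2| <= B]).
  by apply/seteqP; split => [z [? ? ?]|z [? [? ?]]].
by apply: measurableI; [exact: measurable_halfplane|apply: measurableI; exact: m1].
Qed.

(** A representative of [f] on which the almost-everywhere assumptions (sign, bound, support) hold
    at every point. *)
Definition clip (B M : R) (f : R * R -> R) (x : R * R) : R :=
  if x \in hbox B then Num.max 0 (Num.min M (f x)) else 0.

Variables (B M : R) (f : R * R -> R).
Hypotheses (M0 : 0 <= M) (mf : measurable_fun (halfplane R) f).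

Lemma clip_ge0 x : 0 <= clip B M f x.
Proof. by rewrite /clip; case: ifP => // _; rewrite le_max lexx. Qed.

Lemma clip_le x : clip B M f x <= M.
Proof. by rewrite /clip; case: ifP => // _; rewrite ge_max M0 ge_min lexx. Qed.

Lemma clip_out x : ~ hbox B x -> clip B M f x = 0.
Proof. by move=> h; rewrite /clip memNset. Qed.

Lemma measurable_clip : measurable_fun setT (clip B M f).
Proof.
have mD := measurable_hbox B.
have -> : clip B M f = (fun x => Num.max 0 (Num.min M (f x))) \_ (hbox B).
  by apply/funext => x; rewrite /clip /patch.
apply/(measurable_restrictT _ mD).
apply: measurable_maxr => //; apply: measurable_minr => //.
by apply: measurable_funS mf => //; [exact: measurable_halfplane|move=> x []].
Qed.

Lemma integral_clip_lty : (\int[leb2 R]_x (clip B M f x)%:E < +oo)%E.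
Proof.
have mD := measurable_hbox B.
have Dfin : (leb2 R (hbox B) < +oo)%E.
  apply: (@le_lt_trans _ _ (leb2 R (`[- B, B]%classic `*` `[- B, B]%classic))).
    apply: le_measure; rewrite ?inE//; first exact: measurableX.
    by move=> x [_ x1 x2]; split; rewrite /= in_itv/= -ler_norml.
  rewrite product_measure1E//= lebesgue_measure_itv/=.
  by case: ifP => _; rewrite ?mule0 ?ltry// -EFinB -EFinM ltry.
apply: (@le_lt_trans _ _ (\int[leb2 R]_(x in hbox B) M%:E)%E).
  rewrite [leRHS]integral_mkcond; apply: ge0_le_integral => //.
  - by move=> x _; rewrite lee_fin clip_ge0.
  - by apply/measurable_EFinP; exact: measurable_clip.
  - by apply/(measurable_restrictT _ mD); exact: measurable_cst.
  - move=> x _; rewrite /patch; case: ifPn => xD; first by rewrite lee_fin clip_le.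
    by rewrite clip_out//; move: xD; rewrite notin_setE.
by rewrite integral_cst// lte_mul_pinfty.
Qed.

Lemma clip_ae : ae_halfplane (fun x => 0 <= f x) ->
  ae_halfplane (fun x => `|f x| <= M) -> ae_halfplane (fun x => ~ hbox B x -> f x = 0) ->
  ae_halfplane (fun x => f x = clip B M f x).
Proof.
move=> a1 a2 a3.
apply: (ae_impl2 a1 (ae_impl2 a2 a3 (fun _ p q => conj p q))) => x h1 [h2 h3] Hx.
have [xB|xB] := pselect (hbox B x); last by rewrite (h3 Hx xB) clip_out.
rewrite /clip mem_set//.
have fM : f x <= M by rewrite (le_trans (ler_norm _))// h2.
by rewrite (min_idPr fM) (max_idPr (h1 Hx)).
Qed.

End clip.

(** * The norms in terms of representatives *)

Section norms.
Context {R : realType}.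

(** The norm of exponent [+oo] unfolds to an essential supremum only when the space has positive
    measure. *)
Lemma leb2_gt0 : (0 < leb2 R setT)%E.
Proof.
apply: (@lt_le_trans _ _ (leb2 R (`[0, 1]%classic `*` `[0, 1]%classic))).
  by rewrite product_measure1E//= lebesgue_measure_itv/= lte_fin ltr01 oppr0 addr0 mule1.
by apply: le_measure; rewrite ?inE//; exact: measurableX.
Qed.

Lemma Linfnorm_ae (f : R * R -> R) : Linf_finite f ->
  ae_halfplane (fun x => `|f x| <= Linfnorm f).
Proof.
rewrite /Linf_finite /Linfnorm unlock leb2_gt0.
set g := _ \_ _; set s := ess_sup _ _ => sfin.
apply: (ae_impl (ess_sup_ge (leb2 R) (abse \o g))) => x gx Hx; move: gx; rewrite -/s /g /= patchE mem_set// => gx.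
have sf : s \is a fin_num by rewrite ge0_fin_numE// (le_trans _ gx).
by rewrite -lee_fin fineK.
Qed.

Lemma Linfnorm_ge0 (f : R * R -> R) : 0 <= Linfnorm f.
Proof. by rewrite /Linfnorm fine_ge0// Lnorm_ge0. Qed.

Lemma Linf_finite_le (f : R * R -> R) (M : R) :
  ae_halfplane (fun x => `|f x| <= M) -> 0 <= M -> Linf_finite f.
Proof.
move=> fM M0; rewrite /Linf_finite unlock leb2_gt0.
apply: (@le_lt_trans _ _ M%:E); last by rewrite ltry.
apply/ess_supP; apply: (ae_impl fM) => x h /=; rewrite patchE.
case: ifPn => [/set_mem/h|_]; first by rewrite /= lee_fin.
by rewrite (_ : point = 0%E)// abse0 lee_fin.
Qed.

Lemma L1norm_ae (f w : R * R -> R) : measurable_fun (halfplane R) f ->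
  measurable_fun setT w -> (forall x, 0 <= w x) -> (forall x, ~ halfplane R x -> w x = 0) ->
  ae_halfplane (fun x => f x = w x) ->
  L1norm f = fine (\int[leb2 R]_x (w x)%:E)%E.
Proof.
move=> mf mw w0 wout fw; rewrite /L1norm Lnorm1; congr fine.
have mH := @measurable_halfplane R.
apply: ae_eq_integral => //.
- apply: measurableT_comp => //; apply/(measurable_restrictT _ mH).
  exact/measurable_EFinP.
- exact/measurable_EFinP.
- apply: (ae_impl fw) => x h _ /=; rewrite patchE.
  case: ifPn => [/set_mem Hx|]; first by rewrite /= (h Hx) ger0_norm.
  by rewrite notin_setE => /wout ->; rewrite (_ : point = 0%E)// abse0.
Qed.

Lemma bounded_supp_ae (f : R * R -> R) : bounded_set (supp f) ->
  exists2 B : R, 1 <= B & ae_halfplane (fun x => ~ hbox B x -> f x = 0).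
Proof.
move=> [B1 [_ /(_ (B1 + 1))]]; rewrite ltrDl ltr01 => /(_ isT).
set B0 := B1 + 1 => B0P.
(* At least 1, so that the base point (0, 1) lies in the box. *)
exists (Num.max 1 B0); first by rewrite le_max lexx.
apply: (ae_impl (ae_supp f)) => x h Hx nx; apply/eqP; apply: contrapT => /negP fx.
have := B0P _ (h Hx fx); rewrite /Num.norm/= ge_max => /andP[x1 x2]; apply: nx.
by split => //; rewrite le_max ?x1 ?x2 orbT.
Qed.

End norms.

(** * The measure on initial positions *)

Section base_point.
Context {R : realType}.

(* Labels outside the support are sent to a fixed point, so that the trajectories
   of all labels obey the flow equation. *)
Definition base_point (B : R) (x : R * R) : R * R := if x \in hbox B then x else (0, 1).

Lemma base_point_id (B : R) x : hbox B x -> base_point B x = x.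
Proof. by move=> h; rewrite /base_point mem_set. Qed.

Lemma base_point_hbox (B : R) x : 1 <= B -> hbox B (base_point B x).
Proof.
move=> B1; rewrite /base_point; case: ifPn => [/set_mem//|_].
by split; rewrite /halfplane /= ?ltr01 ?normr0 ?normr1//; exact: le_trans ler01 B1.
Qed.

Lemma measurable_base_point (B : R) : measurable_fun setT (base_point B).
Proof.
apply: measurable_fun_ifT => //.
apply: (measurable_fun_bool true); rewrite setTI.
rewrite (_ : _ @^-1` _ = hbox B); first exact: measurable_hbox.
by apply/seteqP; split => x /=; [move=> /set_mem|move=> /mem_set].
Qed.

End base_point.

Section clip_measure.
Context {R : realType} (B M : R) (f : R * R -> R).
Hypotheses (B1 : 1 <= B) (M0 : 0 <= M) (mf : measurable_fun (halfplane R) f)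
  (fw : ae_halfplane (fun x => f x = clip B M f x)).

Let T := (measurableTypeR R * measurableTypeR R)%type.

Let ex := @weighted_measure_exists R _ _ (leb2 R) (clip B M f) (product_sigma_finite _ _) (measurable_clip B M mf)
    (clip_ge0 B M f) (integral_clip_lty B M0 mf).

Definition clip_measure : {finite_measure set T -> \bar R} := sval ex.
Notation nu := clip_measure.

Let mH := @measurable_halfplane R.

Lemma clip_measureE (A : set T) : nu A = (\int[leb2 R]_(x in A) (clip B M f x)%:E)%E.
Proof. by have [] := svalP ex. Qed.

Lemma Rintegral_clip (g : T -> R) : measurable_fun setT g ->
  \int[nu]_x g x = \int[leb2 R]_x (g x * clip B M f x).
Proof. by have [_ _ +] := svalP ex; exact. Qed.

Lemma ge0_integral_clip (g : T -> \bar R) : measurable_fun setT g ->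
  (forall x, 0 <= g x)%E ->
  (\int[nu]_x g x = \int[leb2 R]_x (g x * (clip B M f x)%:E))%E.
Proof. by have [_ + _] := svalP ex; exact. Qed.

Lemma Rintegral_clip_measure (g h : R * R -> R) :
  measurable_fun setT g -> measurable_fun (halfplane R) h ->
  ae_halfplane (fun x => h x = g x * clip B M f x) ->
  \int[leb2 R]_(x in halfplane R) h x = \int[nu]_x g x.
Proof.
move=> mg mh hg; rewrite (Rintegral_clip mg) /Rintegral; congr fine.
rewrite integral_mkcond; apply: ae_eq_integral; first exact: measurableT.
- by apply/(measurable_restrictT _ mH); exact/measurable_EFinP.
- by apply/measurable_EFinP; apply: (measurable_funM mg); exact: measurable_clip.
- apply: (ae_impl hg) => x hx _; rewrite patchE.
  case: ifPn => [/set_mem/hx ->//|]; rewrite notin_setE => nHx.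
  by rewrite clip_out ?mulr0// => -[].
Qed.

(** Off the box the weight vanishes, so moving those labels to the base point leaves the integral
    unchanged. *)
Lemma Rintegral_base_point (g : R * R -> R) : measurable_fun setT g ->
  \int[leb2 R]_(x in halfplane R) (g x * f x) = \int[nu]_x g (base_point B x).
Proof.
move=> mg; apply: Rintegral_clip_measure.
- exact: measurableT_comp mg (measurable_base_point B).
- by apply: measurable_funM => //; exact: measurable_funTS.
- apply: (ae_impl fw) => x /[apply] ->.
  have [xB|xB] := pselect (hbox B x); first by rewrite base_point_id.
  by rewrite clip_out// !mulr0.
Qed.

(** The measure does not charge Lebesgue null sets, nor the set where its weight vanishes. *)
Lemma clip_measure_ae (P : R * R -> Prop) : ae_halfplane (fun x => f x != 0 -> P x) ->
  {ae nu, forall x, P x}.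
Proof.
move=> [N [mN N0 sub]].
have [N' [mN' N'0 sub']] := fw.
pose W := [set x | clip B M f x = 0].
have mw := measurable_clip B M mf.
have mW : measurable W.
  have := mw measurableT [set 0] (measurable_set1 0); rewrite setTI.
  by rewrite (_ : _ @^-1` _ = W).
have mNN : measurable (N `|` N') by exact: measurableU.
exists (N `|` N' `|` W); split.
- exact: measurableU.
- rewrite clip_measureE.
  have mEw : measurable_fun setT (fun x => (clip B M f x)%:E) by exact/measurable_EFinP.
  rewrite -[RHS](@integral0 _ _ _ (leb2 R) (N `|` N' `|` W)).
  apply: ae_eq_integral => //; [exact: measurableU|exact: measurable_funTS|].
  exists (N `|` N'); split => //; first by rewrite measureU0.
  move=> x /= /not_implyP[[//|xW] nx]; exfalso; apply: nx.
  by rewrite xW.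
- move=> x /= nP; apply: contrapT => /not_orP[/not_orP[xN xN'] xW].
  have xB : hbox B x by apply: contrapT => /(@clip_out _ B M f); exact: xW.
  have Hx : halfplane R x by case: xB.
  have xw : f x = clip B M f x by apply: contrapT => h; apply/xN'/sub' => /(_ Hx).
  apply: nP; apply: contrapT => nPx; apply/xN/sub => /(_ Hx); apply: contra_not nPx; apply.
  by rewrite xw; exact/eqP.
Qed.

End clip_measure.

(* Junk values match: when [k] is not integrable both sides are [0]. *)
Lemma Rintegral_scale {R : realType} d (T : measurableType d) (la : {measure set T -> \bar R})
    (k : T -> R) (c : R) : measurable_fun setT k -> (forall x, 0 <= k x) ->
  \int[la]_x (k x * c) = c * \int[la]_x k x.
Proof.
move=> mk k0; rewrite /Rintegral.
have i0 : (0 <= \int[la]_x (k x)%:E)%E by apply: integral_ge0 => x _; rewrite lee_fin.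
have mEk : measurable_fun setT (fun x => (k x)%:E) by exact/measurable_EFinP.
have pos (r : R) : 0 <= r ->
    (\int[la]_x (k x * r)%:E)%E = (r%:E * \int[la]_x (k x)%:E)%E.
  move=> r0; under eq_integral do rewrite mulrC EFinM.
  by rewrite ge0_integralZl//= => x _; rewrite lee_fin.
have fineM (r : R) (a : \bar R) : (0 <= a)%E -> 0 <= r -> fine (r%:E * a)%E = r * fine a.
  case: a => [a|_|]//=; rewrite le_eqVlt => /predU1P[<-|r0].
    by rewrite mul0e mul0r.
  by rewrite gt0_muley ?lte_fin//= mulr0.
have [c0|c0] := lerP 0 c; first by rewrite pos// fineM.
have -> : (fun x => (k x * c)%:E) = (fun x => (- (k x * - c)%:E)%E).
  by apply/funext => x; rewrite -EFinN mulrN opprK.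
have c0' : 0 <= - c by rewrite oppr_ge0 ltW.
rewrite integral_ge0N => [|x _]; last by rewrite lee_fin mulr_ge0.
by rewrite fineN pos// fineM// mulNr opprK.
Qed.

(** * Measurability and area preservation of the flow *)

Section flow.
Context {R : realType}.

Lemma is_derive_fst (f : R -> R * R) (t : R) (df : R * R) :
  is_derive t (1 : R) f df -> is_derive t (1 : R) (fun s => (f s).1) df.1.
Proof.
move=> [df1 dfE].
have h : h^-1 *: ((f \o shift t) (h *: 1) - f t) @[h --> (0:R)^'] --> df by rewrite -dfE; exact: df1.
have h1 : h^-1 *: (((fun s => (f s).1) \o shift t) (h *: 1) - (f t).1) @[h --> (0:R)^'] --> df.1.
  by apply: (cvg_comp _ (@fst R R) h); exact: (@cvg_fst _ _ (nbhs df.1) (nbhs df.2)).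
by apply: DeriveDef; [exact: cvgP h1|exact: cvg_lim h1].
Qed.

Lemma is_derive_snd (f : R -> R * R) (t : R) (df : R * R) :
  is_derive t (1 : R) f df -> is_derive t (1 : R) (fun s => (f s).2) df.2.
Proof.
move=> [df1 dfE].
have h : h^-1 *: ((f \o shift t) (h *: 1) - f t) @[h --> (0:R)^'] --> df by rewrite -dfE; exact: df1.
have h1 : h^-1 *: (((fun s => (f s).2) \o shift t) (h *: 1) - (f t).2) @[h --> (0:R)^'] --> df.2.
  by apply: (cvg_comp _ (@snd R R) h); exact: (@cvg_snd _ _ (nbhs df.1) (nbhs df.2)).
by apply: DeriveDef; [exact: cvgP h1|exact: cvg_lim h1].
Qed.

Variables (v : R -> R * R -> R * R) (Phi : R -> R * R -> R * R).
Hypotheses (fl : is_flow v Phi) (ap : area_preserving Phi).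

Let mH := @measurable_halfplane R.

Lemma flow_halfplane (t : R) x : 0 <= t -> halfplane R x -> halfplane R (Phi t x).
Proof. by case: fl => + _ _ _ t0 Hx => /(_ t t0)[+ _ _]; apply. Qed.

(** The flow is continuous within [spacetime] only, so limits may be taken along maps that
    eventually stay there. *)
Lemma flow_cvg {T : Type} (F : set_system T) {FF : Filter F} (u : T -> R * (R * R)) (t : R) x :
  0 <= t -> halfplane R x -> u a @[a --> F] --> (t, x) ->
  (\forall a \near F, spacetime R (u a)) ->
  Phi (u a).1 (u a).2 @[a --> F] --> Phi t x.
Proof.
move=> t0 Hx ut uS.
case: fl => _ /subspace_continuousP h _ _.
have {}h := h (t, x) (conj t0 Hx).
apply: (cvg_comp u (fun p => Phi p.1 p.2) _ h).
move=> U hU; have {hU} := ut _ hU; rewrite /nbhs/= => hU.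
by apply: filterS2 uS hU => a Sa /(_ Sa).
Qed.

Lemma flow_cvg0 x : halfplane R x -> Phi t x @[t --> 0^'+] --> Phi 0 x.
Proof.
move=> Hx; apply: (flow_cvg (u := fun t => (t, x)) (lexx 0) Hx).
  apply: (@cvg_pair _ _ _ _ (nbhs (0 : R)) (nbhs x) _ _ _ id (cst x)); last exact: cvg_cst.
  exact: cvg_at_right_filter cvg_id.
by near=> t; split => //=; apply: ltW; near: t; exact: nbhs_right_gt.
Unshelve. all: by end_near. Qed.

Lemma continuous_flow (t : R) : 0 <= t -> {in halfplane R, continuous (Phi t)}.
Proof.
move=> t0 x /set_mem Hx; apply: (flow_cvg (u := fun y => (t, y)) t0 Hx).
  by apply: (@cvg_pair _ _ _ _ (nbhs t) (nbhs x) _ _ _ (cst t) id); [exact: cvg_cst|exact: cvg_id].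
have := open_nbhs_nbhs (conj open_halfplane Hx : open_nbhs x (halfplane R)).
by apply: filterS => y Hy; split.
Qed.

(** Extended by the identity, the flow becomes a measure-preserving map of the whole plane. *)
Definition flow_ext (t : R) (x : R * R) : R * R := if x \in halfplane R then Phi t x else x.

Lemma flow_extE (t : R) x : halfplane R x -> flow_ext t x = Phi t x.
Proof. by move=> Hx; rewrite /flow_ext mem_set. Qed.

Lemma measurable_flow_ext (t : R) : 0 <= t -> measurable_fun setT (flow_ext t).
Proof.
move=> t0; have c := continuous_flow t0.
have mHb : measurable_fun setT (fun x => x \in halfplane R).
  apply: (measurable_fun_bool true); rewrite setTI.
  rewrite (_ : _ @^-1` _ = halfplane R)//.
  by apply/seteqP; split => x /=; [move=> /set_mem|move=> /mem_set].
have mif (f g : R * R -> R) : {in halfplane R, continuous f} -> measurable_fun setT g ->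
    measurable_fun setT (fun x => if x \in halfplane R then f x else g x).
  move=> cf mg; apply: measurable_fun_if => //; last exact: measurable_funTS.
  rewrite setTI (_ : _ @^-1` _ = halfplane R); last first.
    by apply/seteqP; split => x /=; [move=> /set_mem|move=> /mem_set].
  exact: continuous_measurable_plane open_halfplane cf.
apply/measurable_fun_pairP; split.
- rewrite (_ : _ \o _ = (fun x => if x \in halfplane R then (Phi t x).1 else x.1)).
    apply: mif => // x Hx; apply: (cvg_comp _ (@fst R R) (c x Hx)); exact: (@cvg_fst _ _ (nbhs (Phi t x).1) (nbhs _)).
  by apply/funext => x; rewrite /flow_ext/=; case: ifP.
- rewrite (_ : _ \o _ = (fun x => if x \in halfplane R then (Phi t x).2 else x.2)).
    apply: mif => // x Hx; apply: (cvg_comp _ (@snd R R) (c x Hx)); exact: (@cvg_snd _ _ (nbhs _) (nbhs (Phi t x).2)).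
  by apply/funext => x; rewrite /flow_ext/=; case: ifP.
Qed.

Lemma flow_ext_preserving (t : R) A : 0 <= t -> measurable A ->
  leb2 R (flow_ext t @^-1` A) = leb2 R A.
Proof.
move=> t0 mA.
have -> : flow_ext t @^-1` A =
    (halfplane R `&` Phi t @^-1` (A `&` halfplane R)) `|` (A `\` halfplane R).
  apply/seteqP; split => x /=; rewrite /flow_ext.
    case: ifPn => [/set_mem Hx Ax|]; first by left; split => //; split => //; exact: flow_halfplane.
    by rewrite notin_setE => Hx Ax; right.
  by case=> [[Hx [Ax _]]|[Ax Hx]]; [rewrite mem_set|rewrite memNset].
have mAH : measurable (A `&` halfplane R) by exact: measurableI.
have mP : measurable (halfplane R `&` Phi t @^-1` (A `&` halfplane R)).
  have := measurable_flow_ext t0 measurableT mAH; rewrite setTI => /(measurableI _ _ mH).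
  congr measurable; apply/seteqP; split => x /= [Hx]; rewrite flow_extE//.
have AHH : A `&` halfplane R `<=` halfplane R by move=> x [].
have mD : measurable (A `\` halfplane R) by exact: measurableD.
have U1 := @measureU _ _ _ (leb2 R) _ _ mP mD.
have U2 := @measureU _ _ _ (leb2 R) _ _ mAH mD.
rewrite U1; last by apply/seteqP; split => x // [[Hx _] [_ /(_ Hx)]].
rewrite (congr1 (fun a => a + _)%E (ap t0 mAH AHH)) -U2 ?setUIDK//.
by apply/seteqP; split => x // [[_ Hx] [_ /(_ Hx)]].
Qed.

Lemma ge0_integral_flow (t : R) (f : R * R -> \bar R) : 0 <= t ->
  measurable_fun setT f -> (forall x, 0 <= f x)%E ->
  (\int[leb2 R]_x f (flow_ext t x) = \int[leb2 R]_x f x)%E.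
Proof.
move=> t0 mf f0; apply: ge0_integral_measure_preserving => //.
- exact: measurable_flow_ext.
- by move=> A; exact: flow_ext_preserving.
Qed.

Lemma ae_flow (t : R) (P : R * R -> Prop) : 0 <= t -> ae_halfplane P ->
  ae_halfplane (fun x => P (Phi t x)).
Proof.
move=> t0 [N [mN N0 sub]]; exists (flow_ext t @^-1` N); split.
- by rewrite -[X in measurable X]setTI; exact: measurable_flow_ext.
- by rewrite flow_ext_preserving.
move=> x /= nx; have Hx : halfplane R x by apply: contrapT => Hx; apply: nx.
rewrite /= flow_extE//; apply: sub => /= h; apply: nx => _; apply: h.
exact: flow_halfplane.
Qed.

Lemma Rintegral_flow (t : R) (f : R * R -> R) : 0 <= t ->
  measurable_fun (halfplane R) f ->
  \int[leb2 R]_(x in halfplane R) f (Phi t x) = \int[leb2 R]_(x in halfplane R) f x.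
Proof.
move=> t0 mf; rewrite /Rintegral; congr fine.
rewrite [LHS]integral_mkcond [RHS]integral_mkcond.
set g := (X in _ = integral _ _ X).
have -> : (fun x => (f (Phi t x))%:E) \_ (halfplane R) = g \o flow_ext t.
  apply/funext => x; rewrite /g /= !patchE /flow_ext.
  case: ifPn => xH; last by rewrite (negbTE xH).
  by rewrite mem_set//; apply: flow_halfplane => //; exact/set_mem.
have mg : measurable_fun setT g.
  by apply/(measurable_restrictT _ mH); exact/measurable_EFinP.
rewrite integralE [RHS]integralE; congr (_ - _)%E.
- by rewrite funepos_comp; exact: (ge0_integral_flow t0 (measurable_funepos mg) (@funepos_ge0 _ _ g)).
- by rewrite funeneg_comp; exact: (ge0_integral_flow t0 (measurable_funeneg mg) (@funeneg_ge0 _ _ g)).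
Qed.

End flow.

(** * Trajectories of the labels *)

Section labels.
Context {R : realType} (v : R -> R * R -> R * R) (Phi : R -> R * R -> R * R) (B : R).
Hypotheses (fl : is_flow v Phi) (ap : area_preserving Phi) (B1 : 1 <= B).
Let mH := @measurable_halfplane R.

Definition label (t : R) (x : R * R) : R * R := Phi t (base_point B x).

Lemma base_point_halfplane x : halfplane R (base_point B x).
Proof. by have [] := base_point_hbox x B1. Qed.

Lemma label_ext (t : R) : label t = flow_ext Phi t \o base_point B.
Proof. by apply/funext => x; rewrite /= flow_extE//; exact: base_point_halfplane. Qed.

Lemma measurable_label (t : R) : 0 <= t -> measurable_fun setT (label t).
Proof.
move=> t0; rewrite label_ext.
exact: measurableT_comp (measurable_flow_ext fl t0) (measurable_base_point B).
Qed.

Lemma label_gt0 (t : R) x : 0 <= t -> 0 < (label t x).2.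
Proof. by move=> t0; exact: (flow_halfplane fl t0 (base_point_halfplane x)). Qed.

Lemma label0 x : label 0 x = base_point B x.
Proof. by case: fl => _ _ + _; apply; exact: base_point_halfplane. Qed.

Lemma label0_le1 x : `|(label 0 x).1| <= B.
Proof. by rewrite label0; have [] := base_point_hbox x B1. Qed.

Lemma label0_le2 x : `|(label 0 x).2| <= B.
Proof. by rewrite label0; have [] := base_point_hbox x B1. Qed.

Lemma label_cvg1 x : (label t x).1 @[t --> 0^'+] --> (label 0 x).1.
Proof.
apply: (cvg_comp _ (@fst R R) (flow_cvg0 fl (base_point_halfplane x))).
exact: (@cvg_fst _ _ (nbhs (label 0 x).1) (nbhs (label 0 x).2)).
Qed.

Lemma label_cvg2 x : (label t x).2 @[t --> 0^'+] --> (label 0 x).2.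
Proof.
apply: (cvg_comp _ (@snd R R) (flow_cvg0 fl (base_point_halfplane x))).
exact: (@cvg_snd _ _ (nbhs (label 0 x).1) (nbhs (label 0 x).2)).
Qed.

Lemma is_derive_label1 (t : R) x : 0 < t ->
  is_derive t (1 : R) (fun s => (label s x).1) (v t (label t x)).1.
Proof.
case: fl => _ _ _ h t0; apply: is_derive_fst.
exact: (h _ _ (base_point_halfplane x) t0).
Qed.

Lemma is_derive_label2 (t : R) x : 0 < t ->
  is_derive t (1 : R) (fun s => (label s x).2) (v t (label t x)).2.
Proof.
case: fl => _ _ _ h t0; apply: is_derive_snd.
exact: (h _ _ (base_point_halfplane x) t0).
Qed.

Variables (M : R) (f : R * R -> R).
Hypotheses (M0 : 0 <= M) (mf : measurable_fun (halfplane R) f).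
Notation nu := (clip_measure B M0 mf).

(** The weight is at most [M] on the box, where labels follow the flow, and 0 elsewhere; the flow
    preserves area. *)
Lemma label_density (t : R) : 0 <= t -> density_le nu (label t) M.
Proof.
move=> t0 g mg g0.
have mgl : measurable_fun setT (fun y => g (label t y)).
  exact: measurableT_comp mg (measurable_label t0).
rewrite (ge0_integral_clip B M0 mf mgl (fun y => g0 (label t y))).
have mgf : measurable_fun setT (fun y => g (flow_ext Phi t y)).
  exact: measurableT_comp mg (measurable_flow_ext fl t0).
rewrite -(ge0_integral_flow fl ap t0 mg g0).
rewrite -(ge0_integralZl (leb2 R) measurableT mgf (fun x _ => g0 (flow_ext Phi t x)))//.
apply: ge0_le_integral => //.
- by move=> x _; rewrite mule_ge0 ?g0// lee_fin clip_ge0.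
- apply: emeasurable_funM => //; apply/measurable_EFinP; exact: measurable_clip.
- exact: emeasurable_funM.
- move=> x _; rewrite muleC.
  have [xB|xB] := pselect (hbox B x).
    rewrite label_ext /= base_point_id//; apply: lee_wpmul2r; first exact: g0.
    by rewrite lee_fin clip_le.
  by rewrite clip_out// mul0e mule_ge0// ?lee_fin// g0.
Qed.

(** The change of variables $y=\Phi_t(x)$. It closes the system: the velocity depends on time
    through the labels alone, which is what the abstract transport argument assumes. *)
Lemma label_velocity (t : R) (w : R * R -> R) z : 0 <= t ->
  measurable_fun (halfplane R) w -> ae_halfplane (fun x => f x = clip B M f x) ->
  ae_halfplane (fun x => w (Phi t x) = f x) ->
  velocity w z = push_velocity nu (label t) z.
Proof.
move=> t0 mw fw wf.
have key (k : R * R -> R) : measurable_fun setT k ->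
    \int[leb2 R]_(y in halfplane R) (k y * w y) = \int[nu]_x k (label t x).
  move=> mk.
  have mkw : measurable_fun (halfplane R) (fun y => k y * w y).
    by apply: measurable_funM => //; exact: measurable_funTS.
  rewrite -(Rintegral_flow fl ap t0 mkw).
  apply: Rintegral_clip_measure.
  - exact: measurableT_comp mk (measurable_label t0).
  - apply: (eq_measurable_fun ((fun y => k y * w y) \o flow_ext Phi t)).
      by move=> x /set_mem Hx /=; rewrite flow_extE.
    apply: (measurable_comp mH _ mkw); last exact: measurable_funTS (measurable_flow_ext fl t0).
    by move=> _ [x Hx <-]; rewrite flow_extE//; exact: (flow_halfplane fl).
  - apply: (ae_impl2 fw wf) => x fx wx Hx; rewrite wx// fx//.
    have [xB|xB] := pselect (hbox B x); first by rewrite /label base_point_id.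
    by rewrite clip_out// !mulr0.
have mid : measurable_fun setT (@id (R * R)) by exact: measurable_id.
by rewrite /velocity /push_velocity; congr pair; apply: key;
  [exact: (measurable_BSkernel1r mid)|exact: (measurable_BSkernel2r mid)].
Qed.

End labels.

(** * Mass, height and energy of a profile *)

Section profile.
Context {R : realType} (f : R * R -> R) (B : R).
Hypotheses (B1 : 1 <= B) (mf : measurable_fun (halfplane R) f) (Lf : Linf_finite f)
  (f0 : ae_halfplane (fun x => 0 <= f x))
  (fB : ae_halfplane (fun x => ~ hbox B x -> f x = 0)).
Notation M := (Linfnorm f).
Let M0 : 0 <= M := Linfnorm_ge0 f.
Notation nu := (clip_measure B (Linfnorm_ge0 f) mf).

Lemma profile_clip : ae_halfplane (fun x => f x = clip B M f x).
Proof. by apply: clip_ae => //; exact: Linfnorm_ae. Qed.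

Lemma profile_mass : L1norm f = fine (nu setT).
Proof.
rewrite clip_measureE; apply: L1norm_ae => //.
- exact: measurable_clip.
- exact: clip_ge0.
- by move=> x Hx; rewrite clip_out// => -[].
- exact: profile_clip.
Qed.

Lemma profile_height :
  \int[leb2 R]_(x in halfplane R) (x.2 * f x) = \int[nu]_x (base_point B x).2.
Proof.
have m2 : measurable_fun setT (@snd R R) by exact: measurable_snd.
exact: (Rintegral_base_point (Linfnorm_ge0 f) mf profile_clip m2).
Qed.

Lemma profile_neq0_mass : ~ ae_halfplane (fun x => f x = 0) -> 0 < L1norm f.
Proof.
move=> nf; rewrite profile_mass lt0r fine_ge0// andbT; apply: contra_notN nf => /eqP n0.
have : nu setT = 0%E.
  by rewrite -[LHS]fineK ?fin_num_measure// n0.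
rewrite clip_measureE => i0.
have mw : measurable_fun setT (fun x => (clip B M f x)%:E).
  by apply/measurable_EFinP; exact: measurable_clip.
have /(ae_eq_integral_abs (leb2 R) measurableT mw).1 h :
    (\int[leb2 R]_x `|(clip B M f x)%:E| = 0)%E.
  by rewrite -[RHS]i0; apply: eq_integral => x _; rewrite gee0_abs// lee_fin clip_ge0.
by apply: (ae_impl2 profile_clip h) => x /[swap] /(_ I) [w0] /[apply]; rewrite w0.
Qed.

Lemma profile_neq0_sup : ~ ae_halfplane (fun x => f x = 0) -> 0 < Linfnorm f.
Proof.
move=> nf; rewrite lt0r Linfnorm_ge0 andbT; apply: contra_notN nf => /eqP n0.
apply: (ae_impl (Linfnorm_ae Lf)) => x h /h; rewrite n0 normr_le0 => /eqP.
by [].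
Qed.

Lemma measurable_log_kernel :
  measurable_fun setT (fun p : (R * R) * (R * R) => log_kernel p.1 p.2).
Proof.
have mid : measurable_fun setT (@id (R * R)) by exact: measurable_id.
apply: (measurableT_comp (@measurable_ln R)).
apply: measurable_funD => //; apply: measurable_quot; last exact: (measurable_qm mid mid).
apply: measurable_funM; first apply: measurable_funM => //.
- exact: (measurableT_comp measurable_snd measurable_fst).
- exact: (measurableT_comp measurable_snd measurable_snd).
Qed.

Lemma log_kernel_ge0 (x y : R * R) : halfplane R x -> halfplane R y -> 0 <= log_kernel x y.
Proof.
move=> x0 y0; rewrite ln_ge0// lerDl divr_ge0 ?sqnorm_ge0//.
by rewrite mulr_ge0 ?mulr_ge0// ltW.
Qed.

(** Truncated so as to be non-negative on the whole plane, as Tonelli requires; nothing changes on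
    the half-plane. *)
Let K (x y : R * R) : R := Num.max 0 (log_kernel x y).

Let K0 x y : 0 <= K x y. Proof. by rewrite le_max lexx. Qed.

Let KE x y : halfplane R x -> halfplane R y -> K x y = log_kernel x y.
Proof. by move=> Hx Hy; rewrite /K (max_idPr _)// log_kernel_ge0. Qed.

Let mK : measurable_fun setT (fun p : (R * R) * (R * R) => K p.1 p.2).
Proof. by apply: measurable_maxr => //; exact: measurable_log_kernel. Qed.

Let mKb : measurable_fun setT (fun p : (R * R) * (R * R) => K p.1 (base_point B p.2)).
Proof.
have mb : measurable_fun setT (fun p : (R * R) * (R * R) => (p.1, base_point B p.2)).
  apply/measurable_fun_pair; first exact: measurable_fst.
  exact: (measurableT_comp (measurable_base_point B) measurable_snd).
exact: (measurableT_comp mK mb).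
Qed.

Let F (x : R * R) : \bar R := (\int[nu]_y (K x (base_point B y))%:E)%E.

Let F0 x : (0 <= F x)%E.
Proof. by apply: integral_ge0 => y _; rewrite lee_fin. Qed.

Let mF : measurable_fun setT F.
Proof.
pose T : measurableType _ := (measurableTypeR R * measurableTypeR R)%type.
have m1 : measurable_fun [set: T * T] (fun p : T * T => (K p.1 (base_point B p.2))%:E).
  by apply/measurable_EFinP; exact: mKb.
have p0 (p : T * T) : (0 <= (K p.1 (base_point B p.2))%:E)%E by rewrite lee_fin.
exact: (measurable_fun_fubini_tonelli_F (m2 := nu) _ m1 p0).
Qed.

Lemma profile_energy :
  \int[leb2 R]_(x in halfplane R) (\int[leb2 R]_(y in halfplane R)
      (ln (1 + 4 * x.2 * y.2 / sqnorm (x - y)) * f x * f y)) =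
  \int[nu]_x fine (F (base_point B x)).
Proof.
rewrite -(Rintegral_base_point (Linfnorm_ge0 f) mf profile_clip (g := fun x => fine (F x))).
  apply: eq_Rintegral => x /set_mem Hx.
  have mKx : measurable_fun setT (fun y => K x y).
    exact: (measurable_fun_pair2 (f := fun p : (R * R) * (R * R) => K p.1 p.2) x mK).
  transitivity (\int[leb2 R]_(y in halfplane R) (K x y * f x * f y)).
    by apply: eq_Rintegral => y /set_mem Hy; rewrite KE.
  rewrite (Rintegral_base_point (Linfnorm_ge0 f) mf profile_clip (g := fun y => K x y * f x)).
    have mKxb : measurable_fun setT (fun y => K x (base_point B y)).
      exact: (measurableT_comp mKx (measurable_base_point B)).
    rewrite [RHS]mulrC.
    exact: (Rintegral_scale nu (f x) mKxb (fun y => K0 x (base_point B y))).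
  exact: measurable_funM.
exact: measurableT_comp.
Qed.

Lemma profile_energy_ge0 : 0 <= \int[nu]_x fine (F (base_point B x)).
Proof. by apply: Rintegral_ge0 => x _; exact: fine_ge0. Qed.

(** [fine] sends infinite values to 0, which can only lower the left side; so the real-valued energy
    is compared with the extended one before finiteness is known. *)
Lemma profile_energy_le : ((\int[nu]_x fine (F (base_point B x)))%:E <=
  \int[(nu \x nu)%E]_p (log_kernel (base_point B p.1) (base_point B p.2))%:E)%E.
Proof.
pose T : measurableType _ := (measurableTypeR R * measurableTypeR R)%type.
have mb : measurable_fun setT (fun p : (R * R) * (R * R) => (base_point B p.1, base_point B p.2)).
  apply/measurable_fun_pair.
  - exact: (measurableT_comp (measurable_base_point B) measurable_fst).
  - exact: (measurableT_comp (measurable_base_point B) measurable_snd).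
have mbb : measurable_fun [set: T * T]
    (fun p : T * T => (K (base_point B p.1) (base_point B p.2))%:E).
  by apply/measurable_EFinP; exact: (measurableT_comp mK mb).
have p0 (p : T * T) : (0 <= (K (base_point B p.1) (base_point B p.2))%:E)%E by rewrite lee_fin.
have bH x : halfplane R (base_point B x) by have [] := base_point_hbox x B1.
apply: (@le_trans _ _ (\int[nu]_x (fine (F (base_point B x)))%:E)%E).
  rewrite /Rintegral; set a := integral _ _ _.
  have a0 : (0 <= a)%E by apply: integral_ge0 => x _; rewrite lee_fin fine_ge0.
  by case: a a0 => [a|_|]//=; rewrite leey.
have mFb : measurable_fun [set: T] (fun x => F (base_point B x)).
  exact: (measurableT_comp mF (measurable_base_point B)).
apply: (@le_trans _ _ (\int[nu]_x F (base_point B x))%E).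
  apply: ge0_le_integral => //.
  - by move=> x _; rewrite lee_fin fine_ge0.
  - by apply/measurable_EFinP; exact: (measurableT_comp _ mFb).
  - by move=> x _; case: (F _) (F0 (base_point B x)) => [a|_|]//=; rewrite leey.
have -> : (\int[(nu \x nu)%E]_p (log_kernel (base_point B p.1) (base_point B p.2))%:E =
    \int[(nu \x nu)%E]_p (K (base_point B p.1) (base_point B p.2))%:E)%E.
  by apply: eq_integral => p _; rewrite KE.
by rewrite (fubini_tonelli1 _ mbb p0).
Qed.

End profile.

(** * Averages and the numerical constants *)

Section conclusion.
Context {R : realType}.

Lemma measurable_slice (w : R -> R * R -> R) (t : R) : 0 <= t ->
  measurable_fun (spacetime R) (fun p : R * (R * R) => w p.1 p.2) ->
  measurable_fun (halfplane R) (w t).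
Proof.
move=> t0 mw.
have mt : measurable_fun (halfplane R) (fun x : R * R => (t, x)).
  by apply: measurable_funTS; exact: measurable_pair1.
have mS : measurable (spacetime R).
  rewrite (_ : spacetime R = `[0, +oo[%classic `*` halfplane R).
    by apply: measurableX => //; exact: measurable_halfplane.
  by apply/seteqP; split => -[s x] /=; rewrite in_itv/= andbT.
apply: (measurable_comp mS _ mw mt).
by move=> _ [x Hx <-].
Qed.

Lemma Rintegral_le_mass d (T : measurableType d) (nu : {finite_measure set T -> \bar R})
    (f : T -> R) (b : R) (S : set T) : nu.-integrable setT (EFin \o f) ->
  {ae nu, forall x, S x} -> (forall x, S x -> f x <= b) -> \int[nu]_x f x <= b * fine (nu setT).
Proof.
move=> fi aeS fb.
have bi : nu.-integrable setT (EFin \o (fun _ => b)).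
  exact: (bounded_integrable nu (measurable_cst b) (fun _ => lexx `|b|)).
have mf : measurable_fun setT f by exact: integrable_EFin_measurable fi.
have <- : \int[nu]_x b = b * fine (nu setT) by rewrite Rintegral_cst.
rewrite -subr_ge0 -RintegralB//.
have -> : \int[nu]_x (b - f x) = \int[nu]_x `|b - f x|.
  rewrite /Rintegral; congr fine; apply: ae_eq_integral => //.
  - by apply/measurable_EFinP; exact: measurable_funB.
  - apply/measurable_EFinP; apply: measurableT_comp => //; exact: measurable_funB.
  - by apply: filterS aeS => x /fb xb _; rewrite ger0_norm// subr_ge0.
by apply: Rintegral_ge0 => x _.
Qed.

Lemma Rintegral_ge_mass d (T : measurableType d) (nu : {finite_measure set T -> \bar R})
    (f : T -> R) (b : R) (S : set T) : nu.-integrable setT (EFin \o f) ->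
  {ae nu, forall x, S x} -> (forall x, S x -> b <= f x) -> b * fine (nu setT) <= \int[nu]_x f x.
Proof.
move=> fi aeS fb.
have := Rintegral_le_mass (integrable_EFinN fi) aeS (b := - b).
have -> : \int[nu]_x (- f x) = - \int[nu]_x f x.
  rewrite -mulN1r -(RintegralZl _ measurableT fi).
  by apply: eq_Rintegral => x _; rewrite mulN1r.
by rewrite mulNr lerN2; apply => x /fb; rewrite lerN2.
Qed.

Lemma Rintegral_gt0 d (T : measurableType d) (nu : {finite_measure set T -> \bar R})
    (f : T -> R) : nu.-integrable setT (EFin \o f) -> (forall x, 0 < f x) ->
  0 < fine (nu setT) -> 0 < \int[nu]_x f x.
Proof.
move=> fi f0 n0; have f0' x : 0 <= f x by exact: ltW.
rewrite lt0r Rintegral_ge0//= andbT; apply/negP => /eqP Ri0.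
have : (\int[nu]_x (f x)%:E = 0)%E.
  by rewrite -[LHS]fineK ?(integrable_fin_num _ fi)//; congr EFin.
have mf := measurable_int _ fi.
have -> : (\int[nu]_x (f x)%:E = \int[nu]_x `|(EFin \o f) x|)%E.
  by apply: eq_integral => x _ /=; rewrite ger0_norm.
move=> i0; have [N [mN N0 sub]] := (ae_eq_integral_abs nu measurableT mf).1 i0.
move: n0; suff -> : nu setT = 0%E by rewrite ltxx.
rewrite -N0; congr (nu _); apply/seteqP; split => // x _; apply: sub => /= h; have [fx] := h I.
by have := f0 x; rewrite fx ltxx.
Qed.

(** With [p] standing for $\pi$, both sides are multiples of $L^4/(m^2h^3M)$, and the claim becomes
    $8\cdot64\cdot6400\,p\le10^3\cdot256\,p^4$. The two bounds on [p] give $p^4\ge16p$, which is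
    enough: this is where $10^{-3}$ is spent. *)
Lemma mass_V_P_le (p L m h M : R) : 2 <= p -> 8 <= p ^+ 2 -> 0 < m -> 0 < h -> 0 < M ->
  m * (10 ^- 3 * (((4 * p)^-1 * L / m) ^+ 4 / ((m^-1 * h) ^+ 3 * m ^+ 2 * M))) <=
  (2 * p)^-1 * (L ^+ 4 / ((2 * m * h) ^+ 2 * (64 * (6400 * (M * h))))).
Proof.
move=> p2 p8 m0 h0 M0.
have q0 : 0 < 6400 :> R by rewrite ltr0n.
have p0 : 0 < p by lra.
have pn := lt0r_neq0 p0; have mn := lt0r_neq0 m0; have hn := lt0r_neq0 h0; have Mn := lt0r_neq0 M0.
pose k := L ^+ 4 / (m ^+ 2 * h ^+ 3 * M).
have k0 : 0 <= k.
  by rewrite divr_ge0 ?exprn_even_ge0// !mulr_ge0 ?exprn_ge0// ltW.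
have -> : m * (10 ^- 3 * (((4 * p)^-1 * L / m) ^+ 4 / ((m^-1 * h) ^+ 3 * m ^+ 2 * M))) =
    k * (10 ^+ 3 * 256 * p ^+ 4)^-1.
  by rewrite /k; field; rewrite pn mn hn Mn.
have -> : (2 * p)^-1 * (L ^+ 4 / ((2 * m * h) ^+ 2 * (64 * (6400 * (M * h))))) =
    k * (8 * 64 * 6400 * p)^-1.
  have r0 : 0 < 64 :> R by rewrite ltr0n.
  move: (6400 : R) (64 : R) q0 r0 => q r q0 r0.
  have qn := lt0r_neq0 q0; have rn := lt0r_neq0 r0.
  by rewrite /k; field; rewrite pn mn hn Mn qn rn.
apply: ler_wpM2l => //; rewrite lef_pV2 ?posrE; last 2 first.
- by rewrite !mulr_gt0// exprn_gt0.
- by rewrite !mulr_gt0// exprn_gt0.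
have p4 : 16 * p <= p ^+ 4.
  rewrite (_ : p ^+ 4 = p ^+ 2 * p * p); last by ring.
  have pp : 8 * p <= p ^+ 2 * p by apply: ler_wpM2r => //; exact: ltW.
  have := ler_wpM2r (ltW p0) pp; have := ler_wpM2l (ltW p0) p2.
  by move: (p ^+ 2 * p * p) => a; rewrite -mulrA; move: (p * p) => b; lra.
have : 8 * 64 * 6400 * p <= 10 ^+ 3 * 256 * (16 * p) by lra.
move=> /le_trans; apply; apply: ler_wpM2l => //; exact: ler0n.
Qed.

Lemma drift_gap (m n V C B t J J0 K K0 : R) : 0 < m -> 0 < n ->
  m * V * t <= J - J0 -> K - K0 <= C * n * t -> - B * m <= J0 -> K0 <= B * n ->
  (V - C) * t - 2 * B <= J / m - K / n.
Proof.
move=> mp np h1 h2 h3 h4.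
have hJ : V * t - B <= J / m.
  rewrite ler_pdivlMr// (_ : (V * t - B) * m = m * V * t + - B * m); last by ring.
  by lra.
have hK : K / n <= C * t + B.
  rewrite ler_pdivrMr// (_ : (C * t + B) * n = C * n * t + B * n); last by ring.
  by lra.
by rewrite mulrBl; move: (V * t) (C * t) hJ hK => a b; lra.
Qed.

End conclusion.

(** * The two centers of mass and the diameter *)

Section solution.
Context {R : realType} (omega0 : R * R -> R) (omega : R -> R * R -> R)
  (Phi : R -> R * R -> R * R) (B : R).
Hypotheses (B1 : 1 <= B) (m0 : measurable_fun (halfplane R) omega0)
  (L0 : Linf_finite omega0) (pos0 : ae_halfplane (fun x => 0 <= omega0 x))
  (B0 : ae_halfplane (fun x => ~ hbox B x -> omega0 x = 0))
  (n0 : ~ ae_halfplane (fun x => omega0 x = 0))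
  (mo : measurable_fun (spacetime R) (fun p : R * (R * R) => omega p.1 p.2))
  (fl : is_flow (fun t => velocity (omega t)) Phi) (ap : area_preserving Phi)
  (tr : forall t : R, 0 <= t -> ae_halfplane (fun x => omega t (Phi t x) = omega0 x)).
Notation M := (Linfnorm omega0).
Notation mu := (clip_measure B (Linfnorm_ge0 omega0) m0).
Notation Psi := (label Phi B).

(* The sigma-algebra of [mu] is that of [measurableTypeR R], which unification
   does not identify with the one inferred for [R]. *)
Let T : measurableType _ := (measurableTypeR R * measurableTypeR R)%type.

Let M0 : 0 <= M := Linfnorm_ge0 omega0.

Let mPsi (t : R) : 0 <= t -> measurable_fun [set: T] (Psi t).
Proof. exact: (measurable_label fl B1). Qed.

Let dens (t : R) : 0 <= t -> density_le mu (Psi t) M.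
Proof. exact: (label_density fl ap B1). Qed.

Let Psi2 (t : R) x : 0 <= t -> 0 < (Psi t x).2.
Proof. exact: (label_gt0 fl B1). Qed.

Let vel (t : R) z : 0 <= t -> velocity (omega t) z = push_velocity mu (Psi t) z.
Proof.
move=> t0; apply: (label_velocity fl ap B1 _ _ _ t0) => //.
- exact: measurable_slice.
- exact: profile_clip.
- exact: tr.
Qed.

Let ode1 (t : R) x : 0 < t ->
  is_derive t 1 (fun s => (Psi s x).1) (push_velocity mu (Psi t) (Psi t x)).1.
Proof. by move=> t0; rewrite -vel ?ltW//; exact: (is_derive_label1 fl B1). Qed.

Let ode2 (t : R) x : 0 < t ->
  is_derive t 1 (fun s => (Psi s x).2) (push_velocity mu (Psi t) (Psi t x)).2.
Proof. by move=> t0; rewrite -vel ?ltW//; exact: (is_derive_label2 fl B1). Qed.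

Let c1 x : (Psi t x).1 @[t --> 0^'+] --> (Psi 0 x).1.
Proof. exact: (label_cvg1 fl B1). Qed.

Let c2 x : (Psi t x).2 @[t --> 0^'+] --> (Psi 0 x).2.
Proof. exact: (label_cvg2 fl B1). Qed.

Let b1 x : `|(Psi 0 x).1| <= B.
Proof. exact: (label0_le1 fl B1). Qed.

Let b2 x : `|(Psi 0 x).2| <= B.
Proof. exact: (label0_le2 fl B1). Qed.

Lemma solution_height : P2 omega0 = (L1norm omega0)^-1 * height mu Psi.
Proof.
rewrite /P2 (profile_height m0 L0 pos0 B0); congr (_ * _).
by apply: eq_Rintegral => x _; rewrite (label0 fl B1).
Qed.

Let Lm : L1norm omega0 = fine (mu setT) := profile_mass m0 L0 pos0 B0.

Let mp : 0 < fine (mu setT).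
Proof. by rewrite -Lm; exact: (profile_neq0_mass m0 L0 pos0 B0). Qed.

Lemma solution_height_gt0 : 0 < height mu Psi.
Proof.
apply: Rintegral_gt0 => //; last by move=> x; exact: Psi2.
exact: (integrable_Psi2 mPsi M0 dens ode2 c2 b2 mu (lexx 0)).
Qed.

Lemma V_P_velocity (t : R) : 0 <= t -> L1norm omega0 * V_P omega0 <=
  \int[mu]_x (push_velocity mu (Psi t) (Psi t x)).1.
Proof.
move=> t0; rewrite (Rintegral_velocity1 (mPsi t0) M0 (dens t0)).
have Mp : 0 < M by exact: profile_neq0_sup.
have hp := solution_height_gt0.
have pp : 2 <= pi :> R by exact: pi_ge2.
have p8 : 8 <= pi ^+ 2 :> R.
  have := pi_ge_sqrt8 (R := R); rewrite -(@ler_pXn2r _ 2)// ?nnegrE ?sqrtr_ge0 ?pi_ge0//.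
  by rewrite sqr_sqrtr// ler0n.
rewrite /V_P solution_height /energy (profile_energy m0 L0 pos0 B0).
set L := (X in (4 * pi)^-1 * X).
rewrite Lm; apply: le_trans (mass_V_P_le _ pp p8 mp hp Mp) _.
apply: ler_wpM2l; first by rewrite invr_ge0 mulr_ge0// pi_ge0.
apply: (mirror_energy_ge mPsi M0 dens Psi2 ode1 ode2 c1 c2 b1 b2) => //.
- apply: le_trans (profile_energy_le B1 m0) _.
  by rewrite /initial_energy; under [leRHS]eq_integral do rewrite !(label0 fl B1).
- exact: profile_energy_ge0.
Qed.

Lemma center_growth (t : R) : 0 <= t -> L1norm omega0 * V_P omega0 * t <=
  \int[mu]_x (Psi t x).1 - \int[mu]_x (Psi 0 x).1.
Proof.
apply: (center1_growth mPsi M0 dens ode1 c1 b1) => s /ltW.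
exact: V_P_velocity.
Qed.

(** Almost every point where [omega t] is nonzero lies in its support; the flow pulls this back to
    the labels, along which the vorticity is constant. *)
Lemma label_supp (t : R) : 0 <= t ->
  ae_halfplane (fun x => omega0 x != 0 -> (supp (omega t) `&` halfplane R) (Psi t x)).
Proof.
move=> t0; apply: (ae_impl2 (ae_impl2 B0 (tr t0) (fun _ p q => conj p q))
  (ae_flow fl ap t0 (ae_supp (omega t)))) => x [xB xt] xs Hx nx.
have xb : hbox B x by apply: contrapT => /(xB Hx) /eqP; rewrite (negbTE nx).
rewrite /label base_point_id//; split; last exact: (flow_halfplane fl t0 Hx).
by apply: xs => //; rewrite xt.
Qed.

Variables (f : R * R -> R) (C0 : R).
Hypotheses (mf : measurable_fun (halfplane R) f)
  (f0 : ae_halfplane (fun x => 0 <= f x)) (fle : ae_halfplane (fun x => f x <= omega0 x))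
  (C00 : 0 <= C0) (fp : 0 < L1norm f)
  (sparse : Linfnorm f <= (C0 / (2 * L1norm omega0)) ^+ 2 * L1norm f).
Notation nu := (clip_measure B (Linfnorm_ge0 f) mf).

Let fB : ae_halfplane (fun x => ~ hbox B x -> f x = 0).
Proof.
apply: (ae_impl2 f0 (ae_impl2 fle B0 (fun _ p q => conj p q))) => x h0 [h1 h2] Hx xB.
by apply/eqP; rewrite eq_le h0// andbT -(h2 Hx xB) h1.
Qed.

Let Lf : Linf_finite f.
Proof.
apply: (@Linf_finite_le _ _ M) => //.
apply: (ae_impl2 f0 (ae_impl2 fle (Linfnorm_ae L0) (fun _ p q => conj p q))) => x h0 [h1 h2] Hx.
rewrite ger0_norm ?h0// (le_trans (h1 Hx))// (le_trans (ler_norm _))//; exact: h2.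
Qed.

Let Lfm : L1norm f = fine (nu setT) := profile_mass mf Lf f0 fB.

Lemma sparse_growth (t : R) : 0 <= t ->
  \int[nu]_x (Psi t x).1 - \int[nu]_x (Psi 0 x).1 <= C0 * L1norm f * t.
Proof.
apply: (center1_growth_le mPsi M0 dens ode1 c1 b1) => s /ltW s0.
have densf : density_le nu (Psi s) (Linfnorm f) by exact: (label_density fl ap B1).
have Q0 : 0 <= C0 / (2 * L1norm omega0) by rewrite divr_ge0// mulr_ge0// Lm ltW.
have fp' : 0 < fine (nu setT) by rewrite -Lfm.
have sp : Linfnorm f <= (C0 / (2 * L1norm omega0)) ^+ 2 * fine (nu setT) by rewrite -Lfm.
apply: le_trans (sparse_velocity_le (mPsi s0) M0 (dens s0) (Linfnorm_ge0 f) densf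
  (fun x => Psi2 x s0) Q0 fp' sp) _.
rewrite -Lm -Lfm le_eqVlt; apply/orP; left; apply/eqP; field.
by rewrite Lm gt_eqF.
Qed.

(** If the diameter were smaller, the first coordinates of any two points of [S] would differ by at
    most [ell]. Averaging the first point over [mu] and the second over [nu] bounds the distance of
    the two centers by [ell], against [drift_gap]. *)
Lemma diam_ge (t : R) : 0 <= t ->
  (((V_P omega0 - C0) * t - (2 * B + 1))%:E <= diam (supp (omega t) `&` halfplane R))%E.
Proof.
move=> t0; set S := _ `&` _; set ell := _ - _.
rewrite leNgt; apply/negP => dlt.
have pq p q : S p -> S q -> p.1 <= ell + q.1.
  move=> Sp Sq; rewrite -lerBlDr.
  have : ((dist p q)%:E <= diam S)%E by apply: ereal_sup_ubound; exists (p, q).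
  move=> /le_lt_trans/(_ dlt); rewrite lte_fin => /ltW; apply: le_trans.
  exact: le_trans (ler_norm _) (norm1_le_sqnorm (p - q)).
have I1 := integrable_Psi1 mPsi M0 dens ode1 c1 b1.
have S1 : {ae mu, forall x, S (Psi t x)}.
  by apply: (clip_measure_ae _ _ (profile_clip L0 pos0 B0)); exact: label_supp.
have S2 : {ae nu, forall x, S (Psi t x)}.
  apply: (clip_measure_ae _ _ (profile_clip Lf f0 fB)).
  apply: (ae_impl2 (label_supp t0) (ae_impl2 f0 fle (fun _ p q => conj p q))) => x h [h1 h2] Hx nx.
  apply: (h Hx); apply: contra_neq nx => x0; apply/eqP.
  by rewrite eq_le h1// andbT -x0 h2.
set J := \int[mu]_x (Psi t x).1; set Jf := \int[nu]_x (Psi t x).1.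
have i1 := I1 mu t t0.
have J_le y : S (Psi t y) -> J <= (ell + (Psi t y).1) * L1norm omega0.
  move=> Sy; rewrite Lm; apply: (Rintegral_le_mass i1 S1) => x Sx; exact: pq.
have aeT (la : {finite_measure set T -> \bar R}) : {ae la, forall x : T, setT x} by exact: aeW.
have J0 : - B * L1norm omega0 <= \int[mu]_x (Psi 0 x).1.
  rewrite Lm; apply: (Rintegral_ge_mass (I1 mu 0 (lexx 0)) (aeT mu)) => x _.
  by have := b1 x; rewrite ler_norml => /andP[].
have Jf0 : \int[nu]_x (Psi 0 x).1 <= B * L1norm f.
  rewrite Lfm; apply: (Rintegral_le_mass (I1 nu 0 (lexx 0)) (aeT nu)) => x _.
  by have := b1 x; rewrite ler_norml => /andP[].
have omp : 0 < L1norm omega0 by rewrite Lm.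
have Jf_ge : (J / L1norm omega0 - ell) * L1norm f <= Jf.
  rewrite Lfm; apply: (Rintegral_ge_mass (I1 nu t t0) S2) => y /J_le.
  by rewrite -ler_pdivrMr// lerBlDl.
have Jt := center_growth t0; have Jft := sparse_growth t0.
rewrite -/J in Jt; rewrite -/Jf in Jft.
have := drift_gap omp fp Jt Jft J0 Jf0; rewrite leNgt => /negP; apply.
(* The initial centers account for [2 * B]; the extra 1 in [ell] makes the contradiction strict. *)
rewrite (le_lt_trans (y := ell))//; last by rewrite /ell ltrD2l ltrN2 ltrDl ltr01.
by rewrite lerBlDl -lerBlDr (ler_pdivlMr _ _ fp).
Qed.

End solution.

Theorem theorem1p1 (R : realType) (omega0 : R * R -> R)
  (omega0_meas : measurable_fun (halfplane R) omega0)
  (omega0_Linf : Linf_finite omega0)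
  (omega0_ge0 : ae_halfplane (fun x => 0 <= omega0 x))
  (omega0_supp : bounded_set (supp omega0))
  (omega0_neq0 : ~ ae_halfplane (fun x => omega0 x = 0)) :
  exists C : R,
  forall omega : R -> R * R -> R, yudovich_solution omega0 omega ->
  forall omega0d omega0r : R * R -> R,
    measurable_fun (halfplane R) omega0d ->
    measurable_fun (halfplane R) omega0r ->
    ae_halfplane (fun x => omega0 x = omega0d x + omega0r x) ->
    ae_halfplane (fun x => 0 <= omega0d x) ->
    ae_halfplane (fun x => 0 <= omega0r x) ->
    compactly_supported omega0d ->
    compactly_supported omega0r ->
  forall C0 : R, 0 <= C0 -> C0 < V_P omega0 ->
    0 < L1norm omega0d ->
    Linfnorm omega0d <= (C0 / (2 * L1norm omega0)) ^+ 2 * L1norm omega0d ->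
  forall t : R, 0 <= t ->
    (((V_P omega0 - C0) * t - C)%:E
       <= diam (supp (omega t) `&` halfplane R))%E.
Proof.
have [B B1 B0] := bounded_supp_ae omega0_supp.
(* The box [B] depends on the support of [omega0] alone, so the constant is fixed before the
   solution and the decomposition. *)
exists (2 * B + 1) => omega [mo _ _ [Phi [fl ap tr]]] f g mf _ fg f0 g0 _ _.
move=> C0 C00 _ fp sparse t t0.
have fle : ae_halfplane (fun x => f x <= omega0 x).
  by apply: (ae_impl2 fg g0) => x fgx gx Hx; rewrite fgx// lerDl gx.
exact: (diam_ge B1 omega0_meas omega0_Linf omega0_ge0 B0 omega0_neq0 mo fl ap tr
  mf f0 fle C00 fp sparse t0).
Qed.
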